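(* Let $0<\alpha<1$ and let $p$ be a prime. For each $n$, let $M$ be a random symmetric matrix in $M_n(\mathbb Z)$ whose entries $m_{ij}$, $1\le i\le j\le n$, are independent, and such that $\Pr(m_{ij}\equiv t\bmod p)\le 1-\alpha$ for every $t\in\mathbb Z/p\mathbb Z$ and all $i\le j$. Let $\mathrm{cok}(M)_p$ be the Sylow $p$-subgroup of $\mathrm{cok}(M)=\mathbb Z^n/\mathrm{col}(M)$ and let $\langle\cdot,\cdot\rangle_{p}$ be the restriction to $\mathrm{cok}(M)_p$ of the canonical duality pairing on the torsion subgroup of $\mathrm{cok}(M)$. Then for every finite abelian $p$-group $G$ with a duality pairing $\langle\cdot,\cdot\rangle_G$, \[\lim_{n\to\infty}\Pr\big((\mathrm{cok}(M)_p,\langle\cdot,\cdot\rangle_{p})\simeq(G,\langle\cdot,\cdot\rangle_G)\big)=\frac{\prod_{k\ge1}(1-p^{1-2k})}{|G|\,|\mathrm{Aut}(G,\langle\cdot,\cdot\rangle_G)|}.\]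
   Context: $\mathrm{col}(M)=M\mathbb Z^n$. For symmetric $M\in M_n(\mathbb Z)$ the torsion subgroup of $\mathrm{cok}(M)$ is $\ker(M)^\perp/\mathrm{col}(M)$ ($\perp$ w.r.t. the standard dot product). Its canonical (Bosch–Lorenzini) duality pairing: for torsion $\tau,\tau'$ choose lifts $T,T'\in\ker(M)^\perp$, positive integers $k,k'$ and $S,S'\in\mathbb Z^n$ with $MS=kT$, $MS'=k'T'$, and set $\langle\tau,\tau'\rangle=S^tMS'/(kk')\bmod\mathbb Z$. A duality pairing on a finite abelian group $A$ is a symmetric bilinear map $A\times A\to\mathbb Q/\mathbb Z$ inducing an isomorphism $A\to\mathrm{Hom}(A,\mathbb Q/\mathbb Z)$. An isomorphism of groups with pairings is a group isomorphism preserving the pairings; $\mathrm{Aut}(G,\langle\cdot,\cdot\rangle_G)$ is the group of pairing-preserving automorphisms of $G$. *)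

(* Defs.v *)
From HB Require Import structures.
From mathcomp Require Import all_boot all_order all_algebra all_fingroup.
From mathcomp Require Import generic_quotient ring_quotient.
From mathcomp Require Import zify.
From mathcomp Require Import all_classical all_reals all_analysis.

Set Implicit Arguments.
Unset Strict Implicit.
Unset Printing Implicit Defensive.

Import Order.TTheory GRing.Theory Num.Theory.
Import numFieldNormedType.Exports.

Local Open Scope classical_set_scope.
Local Open Scope ring_scope.
Local Open Scope quotient_scope.

Section colspan.
Variables (n : nat) (M : 'M[int]_n).

Definition colspan : pred 'cV[int]_n :=
  fun v => `[< exists s : 'cV[int]_n, v = M *m s >].

Lemma colspan_zmod_closed : zmod_closed colspan.
Proof.
split=> [|u v /asboolP[s ->] /asboolP[t ->]].
  by apply/asboolP; exists 0; rewrite mulmx0.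
by apply/asboolP; exists (s - t); rewrite mulmxBr.
Qed.

HB.instance Definition _ :=
  GRing.isZmodClosed.Build 'cV[int]_n colspan colspan_zmod_closed.

Definition colgroup : zmodClosed 'cV[int]_n :=
  GRing.ZmodClosed.clone _ colspan _.

Definition cok : zmodType := Quotient.quot colgroup.

Definition cok_class (v : 'cV[int]_n) : cok := \pi_(Quotient.quot colgroup) v.

End colspan.

Definition int_in_rat : zmodClosed rat :=
  GRing.ZmodClosed.clone rat Num.int_num_subdef _.

Definition QmodZ : zmodType := Quotient.quot int_in_rat.

Definition qz (q : rat) : QmodZ := \pi_(Quotient.quot int_in_rat) q.

(* The p-Sylow subgroup of a possibly infinite abelian group: the subgroup of
   the elements whose order is a power of p. *)
Section sylow.
Variables (p : nat) (V : zmodType).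

Definition ppower_torsion : pred V :=
  fun x => `[< exists k : nat, x *+ (p ^ k)%N = 0 >].

Lemma ppower_torsion_zmod_closed : zmod_closed ppower_torsion.
Proof.
split=> [|x y /asboolP[k xk] /asboolP[l yl]].
  by apply/asboolP; exists 0%N; rewrite mul0rn.
apply/asboolP; exists (k + l)%N; rewrite expnD mulrnBl mulrnA xk mul0rn.
by rewrite mulnC mulrnA yl mul0rn subrr.
Qed.

HB.instance Definition _ :=
  GRing.isZmodClosed.Build V ppower_torsion ppower_torsion_zmod_closed.

Record sylow := Sylow { sylow_val :> V; _ : sylow_val \in ppower_torsion }.

HB.instance Definition _ := [isSub for sylow_val].
HB.instance Definition _ := [Choice of sylow by <:].
HB.instance Definition _ := [SubChoice_isSubZmodule of sylow by <:].

End sylow.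

Section canonical_pairing.
Variables (n : nat) (M : 'M[int]_n).
Implicit Types (x y : cok M) (q : QmodZ).

Definition dot (u v : 'cV[int]_n) : int := (u^T *m v) ord0 ord0.

Definition ker_perp : set 'cV[int]_n :=
  [set u | forall v, M *m v = 0 -> dot u v = 0].

(* q is the value <x, y> computed from some admissible choice of lifts. *)
Definition pairing_value x y q : Prop :=
  exists (T T' S S' : 'cV[int]_n) (k k' : nat),
    [/\ ker_perp T /\ ker_perp T', cok_class M T = x /\ cok_class M T' = y,
        (0 < k)%N /\ (0 < k')%N, M *m S = T *+ k /\ M *m S' = T' *+ k'
      & q = qz ((dot S (M *m S'))%:~R / (k * k')%N%:R)].

(* The default 0 is only used when x or y is not a torsion element; for
   symmetric M the value does not depend on the choices, see
   canonical_pairingE. *)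
Definition canonical_pairing x y : QmodZ := xget 0 [set q | pairing_value x y q].

End canonical_pairing.

Definition sylow_pairing (p n : nat) (M : 'M[int]_n)
    (x y : sylow p (cok M)) : QmodZ :=
  canonical_pairing (x : cok M) (y : cok M).

Section canonical_pairing_theory.
Variables (n : nat) (M : 'M[int]_n).
Hypothesis symM : M^T = M.

Lemma dotC (u v : 'cV[int]_n) : dot u v = dot v u.
Proof. by rewrite /dot -[v in LHS]trmxK -trmx_mul mxE. Qed.

Lemma dot_sym (u v : 'cV[int]_n) : dot u (M *m v) = dot (M *m u) v.
Proof. by rewrite /dot trmx_mul symM mulmxA. Qed.

Lemma dotMnl (u v : 'cV[int]_n) k : dot (u *+ k) v = dot u v *+ k.
Proof. by rewrite /dot -scaler_nat linearZ/= -scalemxAl mxE mulr_natl. Qed.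

Lemma dotBl (u v w : 'cV[int]_n) : dot (u - v) w = dot u w - dot v w.
Proof. by rewrite /dot linearB/= mulmxBl !mxE. Qed.

Lemma cok_classP (u v : 'cV[int]_n) :
  cok_class M u = cok_class M v <-> exists s, u - v = M *m s.
Proof.
have -> : (cok_class M u = cok_class M v) <-> (u - v) \in colspan M.
  rewrite (Quotient.idealrBE (colgroup M)).
  by split=> [h|/eqP h]; [apply/eqP|].
by split=> /asboolP.
Qed.

Lemma qzP (a b : rat) : qz a = qz b <-> a - b \is a Num.int.
Proof.
rewrite /qz; split=> [/eqP|h].
  by rewrite -(Quotient.idealrBE int_in_rat).
by apply/eqP; rewrite -(Quotient.idealrBE int_in_rat).
Qed.

Lemma pairing_value_uniq (x y : cok M) q r :
  pairing_value x y q -> pairing_value x y r -> q = r.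
Proof.
suff half (T T1 T' S S1 S' : 'cV[int]_n) (k k1 k' : nat) :
    cok_class M T = cok_class M T1 -> (0 < k)%N -> (0 < k1)%N -> (0 < k')%N ->
    M *m S = T *+ k -> M *m S1 = T1 *+ k1 -> M *m S' = T' *+ k' ->
    qz ((dot S (M *m S'))%:~R / (k * k')%N%:R) =
    qz ((dot S1 (M *m S'))%:~R / (k1 * k')%N%:R).
  move=> [T [T' [S [S' [k [k' [_ [Tx T'y] [k0 k'0] [MS MS'] ->]]]]]]].
  move=> [U [U' [V [V' [l [l' [_ [Ux U'y] [l0 l'0] [MV MV'] ->]]]]]]].
  rewrite (half T U T' S V S' k l k') ?Tx ?Ux//.
  have dotMC (u v : 'cV[int]_n) : dot u (M *m v) = dot v (M *m u).
    by rewrite dot_sym dotC.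
  rewrite (dotMC V S') [(l * k')%N]mulnC.
  rewrite (half T' U' U S' V' V k' l' l) ?T'y ?U'y//.
  by rewrite (dotMC V' V) mulnC.
move=> /cok_classP[u Tu] k0 k10 k'0 MS MS1 MS'.
have red (s t : 'cV[int]_n) (j : nat) : (0 < j)%N -> M *m s = t *+ j ->
    (dot s (M *m S'))%:~R / (j * k')%N%:R = (dot t S')%:~R / k'%:R :> rat.
  move=> j0 Ms; rewrite dot_sym Ms dotMnl rmorphMn/= -mulr_natl natrM.
  by rewrite -mulf_div divff ?mul1r// pnatr_eq0 -lt0n.
rewrite (red _ _ _ k0 MS) (red _ _ _ k10 MS1).
apply/qzP; rewrite -mulrBl -intrB -dotBl Tu -dot_sym MS' dotC dotMnl.
rewrite rmorphMn/= -mulr_natr mulfK ?pnatr_eq0 -?lt0n//.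
Qed.

Lemma sylow_pairing_value (p : nat) (x y : sylow p (cok M)) :
  (0 < p)%N -> exists q, pairing_value (x : cok M) (y : cok M) q.
Proof.
move=> p0.
have lift (z : sylow p (cok M)) : exists (T S : 'cV[int]_n) (k : nat),
    [/\ ker_perp M T, cok_class M T = z, (0 < k)%N & M *m S = T *+ k].
  have /asboolP[a za] : ppower_torsion p (sylow_val z) by case: z.
  pose T : 'cV[int]_n := repr (sylow_val z).
  have Tz : cok_class M T = z by exact: reprK.
  have /cok_classP[S TS] : cok_class M (T *+ p ^ a) = cok_class M 0.
    by rewrite /cok_class raddfMn raddf0 -[RHS]za -Tz.
  have ka : (0 < p ^ a)%N by rewrite expn_gt0 p0.
  rewrite subr0 in TS; exists T, S, (p ^ a)%N; split=> // v Mv.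
  have : dot T v *+ p ^ a = 0.
    by rewrite -dotMnl TS -dot_sym Mv /dot mulmx0 mxE.
  by move/eqP; rewrite mulrn_eq0 gtn_eqF //= => /eqP.
have [T [S [k [? ? ? ?]]]] := lift x.
have [T' [S' [k' [? ? ? ?]]]] := lift y.
by eexists; exists T, T', S, S', k, k'; split.
Qed.

Lemma canonical_pairingE (x y : cok M) q :
  pairing_value x y q -> canonical_pairing x y = q.
Proof.
move=> xyq; apply: (@pairing_value_uniq x y) (xyq).
exact: (xgetPex 0 (ex_intro _ q xyq)).
Qed.

End canonical_pairing_theory.

Definition is_duality_pairing (A : zmodType) (b : A -> A -> QmodZ) : Prop :=
  [/\ forall x y, b x y = b y x,
      forall x y z, b (x + y) z = b x z + b y z
    & forall chi : {additive A -> QmodZ}, exists! a, forall x, b a x = chi x].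

Definition pairing_isomorphic (A B : zmodType)
    (bA : A -> A -> QmodZ) (bB : B -> B -> QmodZ) : Prop :=
  exists2 f : {additive A -> B},
    bijective f & forall x y, bB (f x) (f y) = bA x y.

Definition pairing_Aut (G : finZmodType) (b : G -> G -> QmodZ) : {set {perm G}} :=
  [set f in Aut [set: G] | [forall x, forall y, b (f x) (f y) == b x y]]%SET.

(* Integer-valued random variables, int carrying the discrete sigma-algebra. *)
Definition int_random_variable (d : measure_display) (T : measurableType d)
    (X : T -> int) : Prop :=
  forall B : set int, measurable (X @^-1` B).

Definition mutually_independent (R : realType) (d : measure_display)
    (T : measurableType d) (P : probability T R) (I : finType)
    (X : I -> T -> int) : Prop :=
  forall (J : {set I}) (B : I -> set int),
    P [set w | forall i, i \in J -> B i (X i w)] =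
    (\prod_(i in J) P (X i @^-1` B i))%E.

Definition upper_index (n : nat) : finType :=
  {ij : 'I_n * 'I_n | (ij.1 <= ij.2)%N}.

Definition upper_entry (n : nat) (T : Type) (M : T -> 'M[int]_n)
    (ij : upper_index n) : T -> int :=
  fun w => M w (val ij).1 (val ij).2.

Definition odd_power_product (R : realType) (p : nat) : R :=
  limn (fun N => \prod_(1 <= k < N.+1) (1 - p%:R ^ (1 - 2 * k%:Z)) : R).

Lemma is_cvg_odd_power_product (R : realType) (p : nat) : (0 < p)%N ->
  cvgn (fun N => \prod_(1 <= k < N.+1) (1 - p%:R ^ (1 - 2 * k%:Z)) : R).
Proof.
move=> p0.
have factor01 k : (0 < k)%N -> 0 <= 1 - (p%:R : R) ^ (1 - 2 * k%:Z) <= 1.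
  move=> k0; have -> : 1 - 2 * k%:Z = - (k.*2.-1)%:Z by lia.
  rewrite -exprnN subr_ge0 lerBlDr lerDl invr_ge0 exprn_ge0// andbT.
  by rewrite invf_le1 ?exprn_gt0 ?ltr0n// exprn_ege1// ler1n.
apply: nonincreasing_is_cvgn => [|].
  apply/nonincreasing_seqP => N; rewrite [leLHS]big_nat_recr//=.
  apply: ler_piMr; last by have /andP[] := factor01 N.+1 isT.
  rewrite big_nat; apply: prodr_ge0 => k /andP[k0 _].
  by have /andP[] := factor01 k k0.
exists 0 => _ [N _ <-]; rewrite big_nat; apply: prodr_ge0 => k /andP[k0 _].
by have /andP[] := factor01 k k0.
Qed.

(* Main.v *)
(** Fix a large modulus q = p^(l+1), a basis g_a of G of orders p^(e_a), and the
    dual basis k_a = sum_b theta_ab g_b with respect to the pairing of G. An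
    r x n matrix Y modulo q describes a homomorphism Z^n -> G. It kills col(M)
    and transports the canonical pairing to that of G exactly when Y M and
    Y M Y^T satisfy congruences ([solves]), and when moreover M mod p has corank
    r it induces an isomorphism from the Sylow p-subgroup onto G. Hence for
    nonsingular M the number of such Y is a constant times |Aut(G)| if cok(M)_p
    is isomorphic to G, and 0 otherwise: the probability becomes the expectation
    of a count that only depends on M mod q.

    Expanding the count in additive characters of Z/q, the isotropic terms do not
    depend on the law of M, and the balanced entries make all the others
    negligible ([near_nonisotropic_sum]); so the uniform law may be used instead
    ([universality]). The corank condition is approximated by polynomials in
    the number of kernel vectors of M mod p, powers of which only add rows to Y.
    For uniform M a change of basis brings Y to the form (I 0), and the kernel of
    a uniform symmetric matrix mod p obeys a recurrence in n, which yields the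
    product of the 1 - p^(1-2k). Finally a singular M has at least p^l primitive
    kernel vectors modulo q, while the expected number of these is bounded. *)

Require Import Defs.
From HB Require Import structures.
From mathcomp Require Import all_boot all_order all_algebra all_fingroup pgroup.
From mathcomp Require Import all_classical all_reals all_analysis.
From mathcomp Require mxabelem.
From mathcomp Require Import cyclic abelian separable cyclotomic complex zify ring lra.

Set Implicit Arguments.
Unset Strict Implicit.
Unset Printing Implicit Defensive.

Import Order.TTheory GRing.Theory Num.Theory.
Import numFieldNormedType.Exports.

Local Open Scope classical_set_scope.
Local Open Scope ring_scope.

(** * Sums over non-isotropic configurations *)

Section geometric_decay.
Variable R : realType.
Implicit Types (a b x eps : R) (n h : nat).

Lemma near_divn h (A : set nat) : (0 < h)%N ->
  (\forall m \near \oo, A m) -> \forall n \near \oo, A (n %/ h)%N.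
Proof. by move=> h_gt0; exact: cvg_divnr. Qed.

Lemma near_expr_le a eps : 0 <= a < 1 -> 0 < eps ->
  \forall n \near \oo, a ^+ n <= eps.
Proof.
move=> /andP[a_ge0 a_lt1] eps_gt0.
have /cvgrPdist_le/(_ _ eps_gt0) : (fun n => a ^+ n) @ \oo --> (0 : R).
  by apply: cvg_expr; rewrite ger0_norm.
by apply: filterS => n; rewrite sub0r normrN ger0_norm// exprn_ge0.
Qed.

Lemma natr_mul_expr_le a n : 0 <= a < 1 -> n.+1%:R * a ^+ n <= (1 - a)^-1.
Proof.
move=> /andP[a_ge0 a_lt1]; rewrite -[leRHS]mul1r ler_pdivlMr ?subr_gt0//.
apply: le_trans (_ : (\sum_(i < n.+1) a ^+ i) * (1 - a) <= _).
  rewrite ler_wpM2r ?subr_ge0 ?(ltW a_lt1)// mulr_natl.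
  rewrite -[n.+1 in leLHS]card_ord -sumr_const; apply: ler_sum => i _.
  by apply: ler_wiXn2l; rewrite ?(ltW a_lt1)// -ltnS.
have -> : (\sum_(i < n.+1) a ^+ i) * (1 - a) = 1 - a ^+ n.+1.
  by rewrite -[RHS]opprB subrX1; ring.
by rewrite lerBlDr lerDl exprn_ge0.
Qed.

Lemma near_natr_mul_expr_le a eps : 0 <= a < 1 -> 0 < eps ->
  \forall n \near \oo, n.+1%:R * a ^+ n <= eps.
Proof.
move=> /andP[a_ge0 a_lt1] eps_gt0; pose b := Num.sqrt a.
have b_ge0 : 0 <= b by exact: sqrtr_ge0.
have b_lt1 : b < 1 by rewrite -(sqrtr1 R) ltr_sqrt.
have b01 : 0 <= b < 1 by rewrite b_ge0.
have bound_gt0 : 0 < eps * (1 - b) by rewrite mulr_gt0// subr_gt0.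
apply: filterS (near_expr_le b01 bound_gt0) => n small.
rewrite -(sqr_sqrtr a_ge0) -exprM mulnC muln2 -addnn exprD mulrA.
apply: le_trans (ler_pM _ _ (natr_mul_expr_le n b01) small) _; rewrite ?exprn_ge0//.
  by rewrite mulr_ge0// exprn_ge0.
by rewrite mulrC mulfK// subr_eq0 gt_eqF.
Qed.

Lemma expr1D_le x n : 0 <= x -> n%:R * x <= 2^-1 ->
  (1 + x) ^+ n <= 1 + 2 * (n%:R * x).
Proof.
move=> x_ge0; elim: n => [|n IHn] nx_small; first by rewrite expr0 mul0r mulr0 addr0.
have nx_small' : n%:R * x <= 2^-1.
  by apply: le_trans nx_small; rewrite ler_wpM2r// ler_nat.
rewrite exprSr; apply: le_trans (ler_wpM2r _ (IHn nx_small')) _; first lra.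
have -> : n.+1%:R * x = n%:R * x + x by rewrite -natr1 mulrDl mul1r.
set y := n%:R * x in nx_small' *.
have : y * x <= 2^-1 * x by rewrite ler_wpM2r.
by lra.
Qed.

Lemma near_expr_mul_expr_divn_le a b h eps : (0 < h)%N -> 0 <= a <= 1 -> 0 <= b ->
  a ^+ h * b <= 2^-1 -> 0 < eps ->
  \forall n \near \oo, a ^+ n * b ^+ (n %/ h) <= eps.
Proof.
move=> h_gt0 /andP[a_ge0 a_le1] b_ge0 half eps_gt0.
have half01 : 0 <= (2^-1 : R) < 1 by lra.
have := near_divn h_gt0 (near_expr_le half01 eps_gt0).
apply: filterS => n /=; apply: le_trans; set m := (n %/ h)%N.
apply: le_trans (_ : (a ^+ h) ^+ m * b ^+ m <= _).
  apply: ler_wpM2r; first exact: exprn_ge0.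
  by rewrite -exprM; apply: ler_wiXn2l => //; rewrite mulnC leq_trunc_div.
by rewrite -exprMn; apply: lerXn2r; rewrite // nnegrE// mulr_ge0// exprn_ge0.
Qed.

Lemma near_expr_mul_expr_quadratic_le a b h eps : (0 < h)%N -> 0 <= a < 1 -> 1 <= b ->
  0 < eps -> \forall n \near \oo, b ^+ n * a ^+ (n %/ h * (n %/ h).-1) <= eps.
Proof.
move=> h_gt0 /andP[a_ge0 a_lt1] b_ge1 eps_gt0.
have b_gt0 : 0 < b by exact: lt_le_trans b_ge1.
have half01 : 0 <= (2^-1 : R) < 1 by lra.
have decay_gt0 : 0 < 2^-1 / b ^+ (2 * h) by rewrite divr_gt0 ?exprn_gt0.
have [k _ decay] : \forall k \near \oo, a ^+ k <= 2^-1 / b ^+ (2 * h).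
  by apply: near_expr_le; rewrite ?a_ge0.
have : \forall m \near \oo, (k < m)%N /\ 2^-1 ^+ m <= eps.
  by apply: filterI; [exact: nbhs_infty_gt|exact: near_expr_le].
move=> /(near_divn h_gt0); apply: filterS => n; set m := (n %/ h)%N => -[km].
apply: le_trans.
have m_gt0 : (0 < m)%N by exact: leq_trans km.
have n_le : (n <= 2 * h * m)%N.
  apply: leq_trans (ltnW (ltn_ceil n h_gt0)) _; rewrite -/m mulnC -mulnA mulnCA.
  by rewrite leq_mul2l mul2n -addnn -addn1 leq_add2l m_gt0 orbT.
have b_le : b ^+ n <= (b ^+ (2 * h)) ^+ m by rewrite -exprM ler_weXn2l.
have a_le : a ^+ (m * m.-1) <= (2^-1 / b ^+ (2 * h)) ^+ m.
  rewrite mulnC exprM; apply: lerXn2r; rewrite ?nnegrE ?exprn_ge0// ?(ltW decay_gt0)//.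
  by apply: decay; rewrite /= -ltnS prednK.
apply: le_trans (ler_pM _ _ b_le a_le) _; rewrite ?exprn_ge0 ?(ltW b_gt0)//.
by rewrite -exprMn mulrCA mulfV ?mulr1// expf_neq0 ?gt_eqF.
Qed.

Lemma near_expr_perturbed_le a b c h eps : (0 < h)%N -> 0 <= a < 1 -> 1 <= b ->
  0 <= c -> 0 < eps ->
  \forall n \near \oo, (b + c * a ^+ (n %/ h)) ^+ n - b ^+ n <= eps * b ^+ n.
Proof.
move=> h_gt0 a01 b_ge1 c_ge0 eps_gt0.
have /andP[a_ge0 _] := a01; have b_gt0 : 0 < b by exact: lt_le_trans b_ge1.
pose d := h%:R * c + 1; have d_gt0 : 0 < d by rewrite ltr_wpDl// mulr_ge0.
have bound_gt0 : 0 < Num.min 2^-1 (eps / 2) / d.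
  by rewrite divr_gt0// lt_min invr_gt0 divr_gt0 ?ltr0n.
have := near_divn h_gt0 (near_natr_mul_expr_le a01 bound_gt0).
apply: filterS => n /=; set m := (n %/ h)%N; set y := c * a ^+ m => m_small.
have y_ge0 : 0 <= y by rewrite mulr_ge0// exprn_ge0.
have ny_small : n%:R * (y / b) <= Num.min 2^-1 (eps / 2).
  apply: le_trans (_ : d * (m.+1%:R * a ^+ m) <= _); last by rewrite mulrC -ler_pdivlMr.
  apply: le_trans (_ : n%:R * y <= _).
    by rewrite ler_wpM2l// ler_pdivrMr// ler_peMr.
  rewrite /y !mulrA ler_wpM2r ?exprn_ge0//.
  apply: le_trans (_ : h%:R * c * m.+1%:R <= _); last by rewrite ler_wpM2r// lerDl.
  by rewrite mulrAC ler_wpM2r// -natrM ler_nat mulnC ltnW// ltn_ceil.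
have [ny_half ny_eps] : n%:R * (y / b) <= 2^-1 /\ n%:R * (y / b) <= eps / 2.
  by apply/andP; rewrite -le_min.
have -> : b + y = b * (1 + y / b) by rewrite mulrDr mulr1 mulrCA mulfV ?mulr1// gt_eqF.
rewrite exprMn -[X in _ - X]mulr1 -mulrBr mulrC ler_wpM2r ?exprn_ge0 ?(ltW b_gt0)//.
rewrite lerBlDl; apply: le_trans (expr1D_le (divr_ge0 y_ge0 (ltW b_gt0)) ny_half) _.
by lra.
Qed.

End geometric_decay.

Lemma sumr_constE (R : nzRingType) (I : finType) (A : pred I) (c : R) :
  \sum_(i | A i) c = #|[pred i | A i]|%:R * c.
Proof. by rewrite mulr_natl -sumr_const. Qed.

Section finite_function_sums.
Variables (I W : finType) (R : comNzRingType).

Lemma sum_ffun_prod (F : W -> R) :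
  \sum_(x : {ffun I -> W}) \prod_i F (x i) = (\sum_w F w) ^+ #|I|.
Proof. by rewrite -(bigA_distr_bigA (fun (_ : I) w => F w)) prodr_const. Qed.

Lemma sum_ffun_expr_card_notin (S : {set W}) (z : R) :
  \sum_(x : {ffun I -> W}) z ^+ #|[set i | x i \notin S]%SET| =
  (#|S|%:R + #|~: S|%:R * z) ^+ #|I|.
Proof.
transitivity (\sum_(x : {ffun I -> W}) \prod_i (if x i \in S then 1 else z)).
  apply: eq_bigr => x _; rewrite (bigID (fun i => x i \in S)) /=.
  rewrite big1 ?mul1r; last by move=> i ->.
  under eq_bigr => i /negbTE -> do [].
  by rewrite prodr_const cardsE; congr (_ ^+ _); apply: eq_card => i.
rewrite (sum_ffun_prod (fun w => if w \in S then 1 else z)).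
congr (_ ^+ _); rewrite (bigID (mem S)) /=; congr (_ + _).
  by under eq_bigr => w -> do []; rewrite sumr_const.
under eq_bigr => w /negbTE -> do [].
by rewrite sumr_constE; congr (_%:R * _); apply: eq_card => w; rewrite !inE.
Qed.

End finite_function_sums.

Section configurations.
Variables (W : finType) (orth : rel W) (null : pred W).

Definition orthogonal_pair n (x : {ffun 'I_n -> W}) (u : upper_index n) : bool :=
  if (val u).1 == (val u).2 then null (x (val u).1)
  else orth (x (val u).1) (x (val u).2).

Definition defects n (x : {ffun 'I_n -> W}) : nat :=
  #|[pred u | ~~ orthogonal_pair x u]|.

Definition isotropic n (x : {ffun 'I_n -> W}) : bool :=
  [forall u, orthogonal_pair x u].

Definition perp (S : {set W}) : {set W} :=
  [set w | [forall s in S, orth w s]]%SET.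

Definition nonorth_pairs n (x : {ffun 'I_n -> W}) : {set 'I_n * 'I_n} :=
  [set ik | (ik.1 != ik.2) && ~~ orth (x ik.1) (x ik.2)]%SET.

Definition heavy (m n : nat) (x : {ffun 'I_n -> W}) : {set W} :=
  [set w | (m <= #|[set i | x i == w]%SET|)%N]%SET.

Definition light_indices (m n : nat) (x : {ffun 'I_n -> W}) : {set 'I_n} :=
  [set i | x i \notin heavy m x]%SET.

Lemma card_nonnull_le_defects n (x : {ffun 'I_n -> W}) :
  (\sum_i ~~ null (x i) <= defects x)%N.
Proof.
pose diagonal (i : 'I_n) : upper_index n := exist _ (i, i) (leqnn i).
have diagonal_inj : injective diagonal by move=> i j /(congr1 val) [].
have -> : (\sum_i ~~ null (x i))%N = #|[pred i | ~~ null (x i)]|.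
  rewrite -sum1_card [RHS]big_mkcond; apply: eq_bigr => i _.
  by rewrite inE; case: (null _).
rewrite /defects -(fintype.card_image diagonal_inj).
apply: subset_leq_card; apply/fintype.subsetP => _ /fintype.imageP[i nonnull ->].
by rewrite inE /orthogonal_pair /= eqxx.
Qed.

Lemma nonisotropic_clique_nonnull (S : {set W}) n (x : {ffun 'I_n -> W}) :
  S \subset perp S -> (forall i, x i \in S) -> ~~ isotropic x ->
  exists i, ~~ null (x i).
Proof.
move=> /fintype.subsetP clique xS /forallPn[u]; rewrite /orthogonal_pair.
case: ifP => [_ nonnull|_]; first by exists (val u).1.
by have := clique _ (xS (val u).1); rewrite inE => /forall_inP/(_ _ (xS _)) ->.
Qed.

Lemma heavy_nonclique m n (x : {ffun 'I_n -> W}) s t :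
  s \in heavy m x -> t \in heavy m x -> ~~ orth s t ->
  (m * m.-1 <= #|nonorth_pairs x|)%N.
Proof.
rewrite !inE => ms mt nonorth.
pose A := [set i | x i == s]%SET; pose B := [set i | x i == t]%SET.
pose D := [set ik : 'I_n * 'I_n | (ik.1 \in A) && (ik.1 == ik.2)]%SET.
have sub : (finset.setX A B :\: D)%SET \subset nonorth_pairs x.
  apply/fintype.subsetP => -[i k]; rewrite !inE /=.
  by move=> /andP[+ /andP[/eqP xi /eqP xk]]; rewrite xi xk eqxx /= => -> /=.
apply: leq_trans (subset_leq_card sub).
rewrite cardsD cardsX; set c := #|_ :&: _|.
have c_le : (c <= #|A|)%N.
  apply: leq_trans (subset_leq_card (subsetIr _ _)) _.
  rewrite -(card_imset (mem A) (f := fun i => (i, i))); last by move=> i j [].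
  apply: subset_leq_card; apply/fintype.subsetP => -[i k]; rewrite inE /=.
  by move=> /andP[iA /eqP <-]; apply/imsetP; exists i.
apply: leq_trans (leq_sub2l _ c_le).
rewrite -[X in (_ <= _ - X)%N]muln1 -mulnBr leq_mul // -subn1.
exact: leq_sub2r.
Qed.

Lemma card_light_indices m n (x : {ffun 'I_n -> W}) :
  (#|light_indices m x| <= #|W| * m)%N.
Proof.
have -> : #|light_indices m x| =
    (\sum_(w | w \notin heavy m x) #|[set i | x i == w]%SET|)%N.
  rewrite -sum1dep_card (partition_big x (fun w => w \notin heavy m x)) //=.
  apply: eq_bigr => w light; rewrite -sum1dep_card; apply: eq_bigl => i.
  by case: eqP => [->|]; rewrite ?light ?andbF.
apply: leq_trans (_ : \sum_(w : W | w \notin heavy m x) m <= _)%N.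
  by apply: leq_sum => w; rewrite inE -ltnNge => /ltnW.
by rewrite sum_nat_const leq_mul2r max_card orbT.
Qed.

Lemma heavy_self_perp m n (x : {ffun 'I_n -> W}) : perp (heavy m x) = heavy m x ->
  (m * #|light_indices m x| <= #|nonorth_pairs x|)%N.
Proof.
move=> self_perp; set O := light_indices m x.
pose pairs_from i := [set ik in nonorth_pairs x | ik.1 == i]%SET.
apply: leq_trans (_ : \sum_(i in O) #|pairs_from i| <= _)%N.
  rewrite mulnC -sum_nat_const; apply: leq_sum => i; rewrite inE => light.
  have := light; rewrite -{1}self_perp inE negb_forall => /existsP[s].
  rewrite negb_imply => /andP[s_heavy nonorth].
  have := s_heavy; rewrite inE => /leq_trans; apply.
  rewrite -(card_imset (mem [set j | x j == s]%SET) (f := pair i)); last by move=> j k [].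
  apply: subset_leq_card; apply/fintype.subsetP => _ /imsetP[k + ->].
  rewrite !inE /= => /eqP xk; rewrite eqxx andbT xk nonorth andbT.
  by apply: contraNneq light => ->; rewrite xk.
rewrite -[X in (_ <= X)%N]sum1_card.
rewrite (partition_big (fun ik => ik.1) predT) //=.
rewrite [X in (_ <= X)%N](bigID (mem O)) /=.
apply: leq_trans (leq_addr _ _); apply: eq_leq; apply: eq_bigr => i _.
by rewrite -sum1dep_card; apply: eq_bigl => ik; rewrite !inE.
Qed.

Hypothesis orthC : symmetric orth.

Lemma card_nonorth_pairs_le n (x : {ffun 'I_n -> W}) :
  (#|nonorth_pairs x| <= 2 * defects x)%N.
Proof.
pose A := [set ik : 'I_n * 'I_n | (ik.1 < ik.2)%N && ~~ orth (x ik.1) (x ik.2)]%SET.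
pose swap (ik : 'I_n * 'I_n) := (ik.2, ik.1).
have A_le : (#|A| <= defects x)%N.
  apply: leq_trans (leq_image_card val _); apply: subset_leq_card.
  apply/fintype.subsetP => -[i k]; rewrite inE /= => /andP[ltik nonorth].
  apply/fintype.imageP; exists (exist _ (i, k) (ltnW ltik)) => //=.
  by rewrite inE /orthogonal_pair /= -val_eqE /= ltn_eqF.
have sub : nonorth_pairs x \subset A :|: swap @: A.
  apply/fintype.subsetP => -[i k]; rewrite !inE /= => /andP[+ nonorth].
  rewrite -val_eqE neq_ltn => /orP[ltik|ltki]; apply/orP; [left|right].
    by rewrite ltik.
  by apply/imsetP; exists (k, i); rewrite // inE /= ltki /= orthC.
apply: leq_trans (subset_leq_card sub) _.
apply: leq_trans (leq_card_setU _ _) _.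
rewrite mul2n -addnn leq_add //; apply: leq_trans A_le.
exact: leq_imset_card.
Qed.

Section weighted_defects.
Variables (R : realType) (rho : R).
Hypothesis rho01 : 0 < rho < 1.

Let tau := Num.sqrt rho.

Let rho_ge0 : 0 <= rho. Proof. by case/andP: rho01 => /ltW. Qed.
Let rho_le1 : rho <= 1. Proof. by case/andP: rho01 => _ /ltW. Qed.
Let tau_ge0 : 0 <= tau. Proof. exact: sqrtr_ge0. Qed.

Let tau01 : 0 <= tau < 1.
Proof. by rewrite tau_ge0 -(sqrtr1 R) ltr_sqrt//; case/andP: rho01. Qed.

Lemma expr_defects_le n (x : {ffun 'I_n -> W}) k :
  (k <= #|nonorth_pairs x|)%N -> rho ^+ defects x <= tau ^+ k.
Proof.
have /andP[_ /ltW tau_le1] := tau01.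
move=> k_le; rewrite -(sqr_sqrtr rho_ge0) -exprM; apply: ler_wiXn2l => //.
exact: leq_trans k_le (card_nonorth_pairs_le x).
Qed.

Definition heavy_sum (m n : nat) (S : {set W}) : R :=
  \sum_(x : {ffun 'I_n -> W} | ~~ isotropic x && (heavy m x == S)) rho ^+ defects x.

Definition nonisotropic_sum (n : nat) : R :=
  \sum_(x : {ffun 'I_n -> W} | ~~ isotropic x) rho ^+ defects x.

Lemma heavy_sum_le m n S (F : {ffun 'I_n -> W} -> R) : (forall x, 0 <= F x) ->
  (forall x, ~~ isotropic x -> heavy m x = S -> rho ^+ defects x <= F x) ->
  heavy_sum m n S <= \sum_x F x.
Proof.
move=> F_ge0 F_bound; rewrite [leRHS](bigID (fun x : {ffun 'I_n -> W} =>
  ~~ isotropic x && (heavy m x == S))) /=.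
apply: ler_wpDr; first by apply: sumr_ge0 => x _; exact: F_ge0.
by apply: ler_sum => x /andP[? /eqP ?]; exact: F_bound.
Qed.

Lemma heavy_sum_nonclique m n (S : {set W}) s t : s \in S -> t \in S -> ~~ orth s t ->
  heavy_sum m n S <= #|W|%:R ^+ n * tau ^+ (m * m.-1).
Proof.
move=> sS tS nonorth; have -> : #|W|%:R ^+ n * tau ^+ (m * m.-1) =
    \sum_(x : {ffun 'I_n -> W}) tau ^+ (m * m.-1).
  by rewrite sumr_const card_ffun card_ord -natrX mulr_natl.
apply: heavy_sum_le => [x|x _ xS]; first exact: exprn_ge0.
by apply/expr_defects_le/(heavy_nonclique (s := s) (t := t)); rewrite ?xS.
Qed.

Lemma heavy_sum_small m n (S : {set W}) (z : R) : 0 < z <= 1 ->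
  heavy_sum m n S <= z ^- (#|W| * m) * (#|S|%:R + #|~: S|%:R * z) ^+ n.
Proof.
move=> /andP[z_gt0 z_le1]; have := sum_ffun_expr_card_notin 'I_n S z.
rewrite card_ord => <-; rewrite mulr_sumr; apply: heavy_sum_le => [x|x _ xS].
  by rewrite mulr_ge0 ?invr_ge0 ?exprn_ge0 ?ltW.
apply: le_trans (_ : 1 <= _); first by rewrite exprn_ile1.
rewrite mulrC ler_pdivlMr ?exprn_gt0// mul1r.
by apply: ler_wiXn2l; rewrite ?(ltW z_gt0)// -xS; exact: card_light_indices.
Qed.

Lemma sum_expr_nonnull_le (S : {set W}) : [exists s in S, ~~ null s] ->
  \sum_(w in S) rho ^+ (~~ null w) <= #|S|%:R - (1 - rho).
Proof.
move=> /existsP[s /andP[sS nonnull]].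
rewrite (bigD1 s) //= nonnull expr1 [leRHS]addrC opprB -addrA lerD2l.
apply: le_trans (_ : \sum_(i in S | i != s) 1 <= _).
  by apply: ler_sum => i _; rewrite exprn_ile1.
rewrite sumr_const (cardD1 s S) sS natrD addKr le_eqVlt; apply/orP; left.
by apply/eqP; congr (_%:R); apply: eq_card => i; rewrite !inE andbC.
Qed.

Lemma heavy_sum_self_perp m n (S : {set W}) : perp S = S -> (0 < #|S|)%N ->
  heavy_sum m n S <= ((#|S|%:R + #|~: S|%:R * tau ^+ m) ^+ n - #|S|%:R ^+ n) +
    (#|S|%:R - (1 - rho)) ^+ n.
Proof.
move=> self_perp S_gt0; have tau_m_ge0 : 0 <= tau ^+ m by exact: exprn_ge0.
pose outside (x : {ffun 'I_n -> W}) := #|[set i | x i \notin S]%SET|.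
pose F (x : {ffun 'I_n -> W}) : R := \prod_i
  (if x i \in S then rho ^+ (~~ null (x i)) else 0).
have F_ge0 x : 0 <= F x by apply: prodr_ge0 => i _; case: ifP; rewrite // exprn_ge0.
pose nonnull := [exists s in S, ~~ null s].
apply: le_trans (_ : \sum_x ((tau ^+ m) ^+ outside x - 0 ^+ outside x +
  nonnull%:R * F x) <= _); last first.
  rewrite big_split /= sumrB !sum_ffun_expr_card_notin mulr0 addr0 card_ord lerD2l.
  have -> : \sum_x nonnull%:R * F x = nonnull%:R * (\sum_(w in S) rho ^+ (~~ null w)) ^+ n.
    rewrite -mulr_sumr (sum_ffun_prod 'I_n (fun w =>
      if w \in S then rho ^+ (~~ null w) else 0)).
    by rewrite -big_mkcond card_ord.
  have base_ge0 : 0 <= #|S|%:R - (1 - rho).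
    by have : 1 <= #|S|%:R :> R; [rewrite ler1n|have := rho_ge0; lra].
  have [nn|_] := boolP nonnull; last by rewrite mul0r exprn_ge0.
  rewrite mul1r; apply: lerXn2r; rewrite ?nnegrE//; last exact: sum_expr_nonnull_le.
  by apply: sumr_ge0 => w _; exact: exprn_ge0.
apply: heavy_sum_le => [x|x xnoniso xS].
  rewrite addr_ge0 ?mulr_ge0// /outside; case: (#|_|) => [|k].
    by rewrite !expr0 subrr.
  by rewrite expr0n subr0 exprn_ge0.
have [out0|out_gt0] := posnP (outside x); last first.
  rewrite expr0n gtn_eqF//= subr0 -exprM; apply: ler_wpDr; first by rewrite mulr_ge0.
  apply: expr_defects_le; have := @heavy_self_perp m n x.
  by rewrite /light_indices xS; exact.
have inS i : x i \in S.
  apply/negPn/negP => notin; have := card0_eq out0 i.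
  by rewrite inE notin.
have [i i_nonnull] : exists i, ~~ null (x i).
  by apply: (nonisotropic_clique_nonnull (S := S)); rewrite ?self_perp.
have -> : nonnull by apply/existsP; exists (x i); rewrite inS i_nonnull.
rewrite out0 !expr0 subrr add0r mul1r.
have -> : F x = rho ^+ (\sum_i ~~ null (x i)).
  by rewrite expr_sum; apply: eq_bigr => j _; rewrite inS.
by apply: ler_wiXn2l => //; exact: card_nonnull_le_defects.
Qed.

Variable Lam : nat.
Hypothesis Lam_gt0 : (0 < Lam)%N.

Let L_ge1 : 1 <= Lam%:R :> R. Proof. by rewrite ler1n. Qed.
Let L_gt0 : 0 < Lam%:R :> R. Proof. by rewrite ltr0n. Qed.

Lemma near_heavy_sum_nonclique h (S : {set W}) s t (eps : R) : (0 < h)%N ->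
  s \in S -> t \in S -> ~~ orth s t -> 0 < eps ->
  \forall n \near \oo, heavy_sum (n %/ h) n S <= eps * Lam%:R ^+ n.
Proof.
move=> h_gt0 sS tS nonorth eps_gt0.
have W_ge1 : 1 <= #|W|%:R :> R by rewrite ler1n; apply/card_gt0P; exists s.
apply: filterS (near_expr_mul_expr_quadratic_le h_gt0 tau01 W_ge1 eps_gt0) => n small.
apply: le_trans (heavy_sum_nonclique _ _ sS tS nonorth) (le_trans small _).
by rewrite ler_peMr ?(ltW eps_gt0)// exprn_ege1.
Qed.

Lemma near_heavy_sum_small h (S : {set W}) (eps : R) : (0 < h)%N -> (0 < #|W|)%N ->
  (1 - (2 * Lam%:R)^-1) ^+ h * (2 * #|W|%:R) ^+ #|W| <= 2^-1 :> R ->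
  (#|S| < Lam)%N -> 0 < eps ->
  \forall n \near \oo, heavy_sum (n %/ h) n S <= eps * Lam%:R ^+ n.
Proof.
move=> h_gt0 W_gt0 half S_lt eps_gt0; set a := 1 - (2 * Lam%:R)^-1 in half.
have W_ge1 : 1 <= #|W|%:R :> R by rewrite ler1n.
pose z : R := (2 * #|W|%:R)^-1.
have z01 : 0 < z <= 1 by rewrite invr_gt0 invf_le1; lra.
have /andP[z_gt0 _] := z01.
have a01 : 0 <= a <= 1.
  have := L_ge1; rewrite /a subr_ge0 lerBlDr lerDl invr_ge0 => L1.
  by rewrite invf_le1; lra.
have W2_ge0 : 0 <= (2 * #|W|%:R) ^+ #|W| :> R by rewrite exprn_ge0// mulr_ge0.
have base_le : #|S|%:R + #|~: S|%:R * z <= Lam%:R * a.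
  have : #|~: S|%:R * z <= 2^-1.
    apply: le_trans (_ : #|W|%:R * z <= _).
      by rewrite ler_wpM2r ?(ltW z_gt0)// ler_nat max_card.
    by rewrite /z invfM mulrCA mulfV ?mulr1// gt_eqF// ltr0n.
  have : #|S|%:R + 1 <= Lam%:R :> R by rewrite natr1 ler_nat.
  have -> : Lam%:R * a = Lam%:R - 2^-1.
    by rewrite /a mulrBr mulr1 invfM mulrCA mulfV ?mulr1// gt_eqF.
  by lra.
apply: filterS (near_expr_mul_expr_divn_le h_gt0 a01 W2_ge0 half eps_gt0) => n small.
apply: le_trans (heavy_sum_small _ _ _ z01) _; rewrite exprM -!exprVn invrK.
apply: le_trans (_ : ((2 * #|W|%:R) ^+ #|W|) ^+ (n %/ h) * (Lam%:R * a) ^+ n <= _).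
  apply: ler_wpM2l; first exact: exprn_ge0.
  have base_ge0 : 0 <= #|S|%:R + #|~: S|%:R * z by rewrite addr_ge0// mulr_ge0// ltW.
  by apply: lerXn2r; rewrite // nnegrE// (le_trans base_ge0).
rewrite [(Lam%:R * a) ^+ n]exprMn mulrCA [leRHS]mulrC ler_wpM2l ?exprn_ge0 ?(ltW L_gt0)//.
by rewrite mulrC.
Qed.

Lemma near_heavy_sum_self_perp h (S : {set W}) (eps : R) : (0 < h)%N ->
  perp S = S -> #|S| = Lam -> 0 < eps ->
  \forall n \near \oo, heavy_sum (n %/ h) n S <= eps * Lam%:R ^+ n.
Proof.
move=> h_gt0 self_perp cardS eps_gt0; have eps2_gt0 : 0 < eps / 2 by rewrite divr_gt0.
pose a : R := 1 - (1 - rho) / Lam%:R.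
have a01 : 0 <= a < 1.
  case/andP: rho01 => rho_gt0 rho_lt1; rewrite /a subr_ge0 ler_pdivrMr// mul1r.
  rewrite ltrBlDr ltrDl divr_gt0 ?subr_gt0// andbT.
  by apply: le_trans L_ge1; lra.
have out_ge0 : 0 <= #|~: S|%:R :> R by [].
apply: filterS2 (near_expr_perturbed_le h_gt0 tau01 L_ge1 out_ge0 eps2_gt0)
  (near_expr_le a01 eps2_gt0) => n perturbed a_small.
have := @heavy_sum_self_perp (n %/ h) n S self_perp; rewrite cardS => /(_ Lam_gt0).
move/le_trans; apply; rewrite [X in _ <= X * _](splitr eps) mulrDl; apply: lerD => //.
have -> : Lam%:R - (1 - rho) = Lam%:R * a.
  by rewrite /a mulrBr mulr1 mulrCA mulfV ?mulr1// gt_eqF.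
by rewrite exprMn mulrC ler_wpM2r// exprn_ge0// ltW.
Qed.

Hypothesis perp_card : forall S : {set W}, (#|S| * #|perp S| <= Lam ^ 2)%N.

Lemma large_clique_self_perp (S : {set W}) :
  S \subset perp S -> (Lam <= #|S|)%N -> perp S = S /\ #|S| = Lam.
Proof.
move=> clique S_ge; have perp_le := perp_card S.
have cardS : #|S| = Lam.
  apply/eqP; rewrite eqn_leq S_ge andbT -leq_sqr.
  by apply: leq_trans perp_le; rewrite leq_mul2l subset_leq_card ?orbT.
split=> //; apply/eqP; rewrite eq_sym eqEcard clique cardS -(@leq_pmul2l Lam)//.
by move: perp_le; rewrite cardS.
Qed.

Lemma near_heavy_sum h (S : {set W}) (eps : R) : (0 < h)%N -> (0 < #|W|)%N ->
  (1 - (2 * Lam%:R)^-1) ^+ h * (2 * #|W|%:R) ^+ #|W| <= 2^-1 :> R -> 0 < eps ->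
  \forall n \near \oo, heavy_sum (n %/ h) n S <= eps * Lam%:R ^+ n.
Proof.
move=> h_gt0 W_gt0 half eps_gt0.
have [/existsP[s /andP[sS /existsP[t /andP[tS nonorth]]]]|clique] :=
  boolP [exists s in S, exists t in S, ~~ orth s t].
  exact: near_heavy_sum_nonclique nonorth eps_gt0.
have [S_lt|S_ge] := ltnP #|S| Lam; first exact: near_heavy_sum_small.
have S_sub : S \subset perp S.
  apply/fintype.subsetP => s sS; rewrite inE; apply/forall_inP => t tS.
  apply: contraNT clique => nonorth.
  by apply/existsP; exists s; rewrite sS; apply/existsP; exists t; rewrite tS.
have [self_perp cardS] := large_clique_self_perp S_sub S_ge.
exact: near_heavy_sum_self_perp.
Qed.

(* Split according to the set S of the values taken at least n/h times. If S
   contains a non-orthogonal pair, there are quadratically many defects; if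
   #|S| < Lam, there are few configurations; otherwise S = perp S, and each value
   outside S causes at least n/h defects. *)
Lemma near_nonisotropic_sum (eps : R) : 0 < eps ->
  \forall n \near \oo, nonisotropic_sum n <= eps * Lam%:R ^+ n.
Proof.
move=> eps_gt0; have [W0|W_gt0] := posnP #|W|.
  apply: filterS (nbhs_infty_gt 0) => n n_gt0; rewrite /nonisotropic_sum big1 => [|x _].
    by rewrite mulr_ge0 ?exprn_ge0 ?ltW.
  by have := card0_eq W0 (x (Ordinal n_gt0)).
pose a : R := 1 - (2 * Lam%:R)^-1; pose b : R := (2 * #|W|%:R) ^+ #|W|.
have b_gt0 : 0 < b by rewrite exprn_gt0// mulr_gt0// ltr0n.
have [h h_gt0 half] : exists2 h, (0 < h)%N & a ^+ h * b <= 2^-1.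
  have a01 : 0 <= a < 1.
    by rewrite /a subr_ge0 invf_le1 ?ltrBlDr ?ltrDl ?invr_gt0; have := L_ge1; lra.
  have [h _ small] : \forall h \near \oo, a ^+ h <= 2^-1 / b.
    by apply: near_expr_le => //; rewrite divr_gt0.
  by exists h.+1 => //; rewrite -ler_pdivlMr//; apply: small => /=.
have count_gt0 : 0 < #|{set W}|%:R :> R.
  by rewrite ltr0n; apply/card_gt0P; exists finset.set0.
have : \forall n \near \oo, forall S : {set W},
    heavy_sum (n %/ h) n S <= eps / #|{set W}|%:R * Lam%:R ^+ n.
  by apply: filter_forall => S; apply: near_heavy_sum; rewrite // divr_gt0.
apply: filterS => n heavy_small.
rewrite /nonisotropic_sum (partition_big (heavy (n %/ h) (n:=n)) predT)//=.
apply: le_trans (ler_sum _ (fun S _ => heavy_small S)) _.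
by rewrite sumr_const -mulrnAl -[_ *+ _]mulr_natr mulfVK ?gt_eqF.
Qed.

End weighted_defects.
End configurations.

(** * Additive characters *)

(* Declares the missing joins: {ffun I -> V} and U * V are finZmodTypes when U
   and V are. *)
HB.saturate finfun_of.
HB.saturate prod.

Lemma prim_root_exists (F : closedFieldType) n : n%:R != 0 :> F ->
  exists z : F, n.-primitive_root z.
Proof.
move=> n_neq0; have n_gt0 : (0 < n)%N by case: n n_neq0 => //; rewrite eqxx.
pose f : {poly F} := 'X^n - 1; have [r fE] := closed_field_poly_normal f.
rewrite (monicP _) ?monicXnsubC // scale1r in fE.
have all_roots : all n.-unity_root r.
  by apply/allP => z; rewrite -root_prod_XsubC -fE.
have size_r : (n < (size r).+1)%N.
  by rewrite -(size_prod_XsubC r id) -fE size_XnsubC.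
have [|z _ z_prim] := hasP (has_prim_root n_gt0 all_roots _ size_r); last by exists z.
by rewrite -separable_prod_XsubC -fE separable_Xn_sub_1.
Qed.

Lemma card_Zq q : (1 < q)%N -> #|'Z_q| = q.
Proof. by move=> q_gt1; rewrite card_ord Zp_cast. Qed.

Lemma prodr_if (R : comPzSemiRingType) (I : finType) (P : pred I) (c : R) :
  \prod_i (if P i then c else 0) = if [forall i, P i] then c ^+ #|I| else 0.
Proof.
case: ifP => [/forallP allP|/negbT].
  by under eq_bigr do rewrite allP; rewrite prodr_const.
by rewrite negb_forall => /existsP[i /negbTE notPi]; rewrite (bigD1 i)//= notPi mul0r.
Qed.

Section characters.
Variables (R : realType) (q : nat).
Hypothesis q_gt1 : (1 < q)%N.

Local Notation C := R[i].

Let natr_q_neq0 : q%:R != 0 :> C.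
Proof. by rewrite pnatr_eq0 -lt0n ltnW. Qed.

Definition zeta : C := xchoose (prim_root_exists natr_q_neq0).

Lemma zeta_prim : q.-primitive_root zeta.
Proof. exact: xchooseP. Qed.

Definition chi (x : 'Z_q) : C := zeta ^+ x.

Lemma chi0 : chi 0 = 1. Proof. by []. Qed.

Lemma chiD x y : chi (x + y) = chi x * chi y.
Proof.
have addE : (x + y)%R = ((x + y) %% q)%N :> nat.
  exact: (congr1 (modn (x + y)%N) (Zp_cast q_gt1)).
by rewrite /chi addE prim_expr_mod ?exprD//; exact: zeta_prim.
Qed.

Lemma chi_sum (I : Type) (s : seq I) (P : pred I) (F : I -> 'Z_q) :
  chi (\sum_(i <- s | P i) F i) = \prod_(i <- s | P i) chi (F i).
Proof. exact: (big_morph chi chiD chi0). Qed.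

Lemma chi_eq1 x : (chi x == 1) = (x == 0).
Proof.
rewrite /chi -(prim_order_dvd zeta_prim) -val_eqE /=.
have [x0|x_gt0] := posnP (x : nat); first by rewrite x0 dvdn0.
by apply/negbTE; rewrite gtnNdvd// -[X in (_ < X)%N](Zp_cast q_gt1) ltn_ord.
Qed.

Lemma norm_chi x : `|chi x| = 1.
Proof.
suff norm_zeta : `|zeta| = 1 by rewrite normrX norm_zeta expr1n.
have := congr1 Num.norm (prim_expr_order zeta_prim).
rewrite normrX normr1 => /eqP; rewrite pexpr_eq1// ?(ltnW q_gt1)//.
by move/eqP.
Qed.

Lemma conj_chi x : (chi x)^* = chi (- x).
Proof.
have chi_neq0 : chi x != 0 by rewrite -normr_eq0 norm_chi oner_eq0.
apply: (mulfI chi_neq0); rewrite -chiD subrr chi0.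
by rewrite -normCK norm_chi expr1n.
Qed.

Lemma sum_chi_additive (V : finZmodType) (f : V -> 'Z_q) :
  {morph f : x y / x + y} ->
  \sum_x chi (f x) = if [forall x, f x == 0] then #|V|%:R else 0.
Proof.
move=> fD; case: ifP => [/forallP f0|/negbT].
  by under eq_bigr do rewrite (eqP (f0 _)); rewrite sumr_const.
rewrite negb_forall => /existsP[x0 fx0]; apply/eqP.
have chi_neq1 : chi (f x0) - 1 != 0 by rewrite subr_eq0 chi_eq1.
rewrite -(mulIr_eq0 _ (mulIf chi_neq1)) mulrBr mulr1 subr_eq0 mulr_suml.
rewrite [X in _ == X](reindex_inj (addIr x0)) /=.
by apply/eqP/eq_bigr => x _; rewrite fD chiD.
Qed.

Lemma sum_chiM x : \sum_(d : 'Z_q) chi (d * x) = if x == 0 then q%:R else 0.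
Proof.
rewrite (sum_chi_additive (f := *%R^~ x)); last by move=> c d; exact: mulrDl.
rewrite (card_Zq q_gt1); congr (if _ then _ else _).
apply/forallP/eqP => [/(_ 1)|-> d]; last by rewrite mulr0.
by rewrite mul1r => /eqP.
Qed.

Lemma sum_chi_ffun (I T : finType) (F : I -> T -> 'Z_q) :
  \sum_(d : {ffun I -> T}) chi (\sum_i F i (d i)) = \prod_i \sum_t chi (F i t).
Proof. by rewrite bigA_distr_bigA; apply: eq_bigr => d _; rewrite chi_sum. Qed.

Lemma sum_chi_dot (J : finType) (z : J -> 'Z_q) :
  \sum_(d : {ffun J -> 'Z_q}) chi (\sum_j d j * z j) =
  if [forall j, z j == 0] then q%:R ^+ #|J| else 0.
Proof.
rewrite (sum_chi_ffun (fun j t => t * z j)).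
by under eq_bigr do rewrite sum_chiM; exact: prodr_if.
Qed.

Lemma sum_chi_dot2 (I J : finType) (z : I -> J -> 'Z_q) :
  \sum_(d : {ffun I -> {ffun J -> 'Z_q}}) chi (\sum_i \sum_j d i j * z i j) =
  if [forall i, forall j, z i j == 0] then q%:R ^+ (#|J| * #|I|) else 0.
Proof.
rewrite (sum_chi_ffun (fun i (t : {ffun J -> 'Z_q}) => \sum_j t j * z i j)).
under eq_bigr do rewrite sum_chi_dot.
by rewrite (prodr_if (fun i => [forall j, z i j == 0])) exprM.
Qed.

End characters.

Section orthogonality.
Variables (R : realType) (q : nat).
Hypothesis q_gt1 : (1 < q)%N.
Variables (V : finZmodType) (B : V -> V -> 'Z_q).
Hypothesis BC : forall u v, B u v = B v u.
Hypothesis BDl : forall u v w, B (u + v) w = B u w + B v w.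

Local Notation C := R[i].
Local Notation chi := (chi R q_gt1).

Definition orthogonal u v := B u v == 0.

Definition radical : {set V} := [set v | [forall u, B u v == 0]]%SET.

Definition character_sum (S : {set V}) v : C := \sum_(s in S) chi (B v s).

Lemma biadditiveBr u v w : B u (v - w) = B u v - B u w.
Proof. by apply/eqP; rewrite eq_sym subr_eq !(BC u) -BDl subrK. Qed.

Lemma orthogonalC : symmetric orthogonal.
Proof. by move=> u v; rewrite /orthogonal BC. Qed.

Lemma sum_chi_biadditive v :
  \sum_u chi (B u v) = if v \in radical then #|V|%:R else 0.
Proof. by rewrite inE sum_chi_additive. Qed.

Lemma sum_normsq_character_sum_le (S : {set V}) :
  \sum_v `|character_sum S v| ^+ 2 <= (#|S| * #|radical| * #|V|)%:R.
Proof.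
have -> : \sum_v `|character_sum S v| ^+ 2 =
    \sum_(s in S) \sum_(t in S) \sum_v chi (B v (s - t)).
  transitivity (\sum_v \sum_(s in S) \sum_(t in S) chi (B v (s - t))).
    apply: eq_bigr => v _; rewrite normCK /character_sum rmorph_sum /= mulr_suml.
    apply: eq_bigr => s _; rewrite mulr_sumr; apply: eq_bigr => t _.
    by rewrite conj_chi -chiD biadditiveBr.
  rewrite exchange_big; apply: eq_bigr => s _; exact: exchange_big.
rewrite -mulnA natrM mulr_natl -sumr_const; apply: ler_sum => s sS.
under eq_bigr do rewrite sum_chi_biadditive.
rewrite -big_mkcondr /= sumr_const -[leLHS]mulr_natr -natrM ler_nat mulnC leq_mul2r.
apply/orP; right; rewrite -(card_imset (mem radical) (subrI s)).
apply: subset_leq_card; apply/fintype.subsetP => t /andP[tS t_rad].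
by apply/imsetP; exists (s - t); rewrite // subKr.
Qed.

Lemma sum_normsq_character_sum_ge (S : {set V}) :
  (#|perp orthogonal S| * (#|S| * #|S|))%:R <= \sum_v `|character_sum S v| ^+ 2.
Proof.
rewrite (bigID (mem (perp orthogonal S))) /= natrM mulr_natl -sumr_const.
apply: ler_wpDr; first by apply: sumr_ge0 => v _; rewrite exprn_ge0.
apply: ler_sum => v; rewrite inE => /forall_inP v_perp.
have -> : character_sum S v = #|S|%:R.
  rewrite /character_sum (eq_bigr (fun _ => 1)) ?sumr_const// => s /v_perp.
  by move=> /eqP ->; rewrite chi0.
by rewrite normr_nat -natrX.
Qed.

Lemma card_perp_radical (S : {set V}) :
  (#|S| * #|perp orthogonal S| <= #|V| * #|radical|)%N.
Proof.
have [->|[s sS]] := set_0Vmem S; first by rewrite cards0.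
have S_gt0 : (0 < #|S|)%N by apply/card_gt0P; exists s.
have := le_trans (sum_normsq_character_sum_ge S) (sum_normsq_character_sum_le S).
by rewrite ler_nat mulnCA -[(_ * _ * #|V|)%N]mulnA leq_pmul2l// mulnC [(#|radical| * _)%N]mulnC.
Qed.

End orthogonality.

(** * Symmetric matrices with random entries *)

Section upper_triangle.
Variable n : nat.

Lemma upper_idx_subproof (i j : 'I_n) :
  let ij := if (i <= j)%N then (i, j) else (j, i) in (ij.1 <= ij.2)%N.
Proof. by case: ifP => //= /negbT; rewrite -ltnNge => /ltnW. Qed.

Definition upper_idx (i j : 'I_n) : upper_index n :=
  exist (fun ij : 'I_n * 'I_n => (ij.1 <= ij.2)%N) _ (upper_idx_subproof i j).

Lemma upper_idxC i j : upper_idx i j = upper_idx j i.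
Proof. by apply: val_inj; rewrite /=; case: (ltngtP i j) => // /val_inj ->. Qed.

Lemma upper_idxK (u : upper_index n) : upper_idx (val u).1 (val u).2 = u.
Proof. by apply: val_inj; case: u => -[i j] /= ->. Qed.

Lemma upper_idx_eq i j (u : upper_index n) :
  (upper_idx i j == u) = ((i, j) == val u) || ((j, i) == val u).
Proof.
case: u => -[k l] /= kl; rewrite -val_eqE /=.
case: leqP => ij; [rewrite orb_idr//|rewrite orb_idl//] => /eqP[ek el].
  by move: kl; rewrite -ek -el => ji; have -> : i = j by apply/val_inj/eqP; rewrite eqn_leq ij.
by move: kl; rewrite -ek -el leqNgt ij.
Qed.

Definition sym_mx (T : Type) (a : {ffun upper_index n -> T}) : 'M[T]_n :=
  \matrix_(i, j) a (upper_idx i j).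

Definition upper_part (T : Type) (M : 'M[T]_n) : {ffun upper_index n -> T} :=
  [ffun u => M (val u).1 (val u).2].

Lemma tr_sym_mx T (a : {ffun upper_index n -> T}) : (sym_mx a)^T = sym_mx a.
Proof. by apply/matrixP => i j; rewrite !mxE upper_idxC. Qed.

Lemma upper_partK T (M : 'M[T]_n) : M^T = M -> sym_mx (upper_part M) = M.
Proof.
move=> symM; apply/matrixP => i j; rewrite !mxE ffunE /=.
by case: ifP => //= _; rewrite -[in LHS]symM mxE.
Qed.

Lemma sym_mxK T : cancel (@sym_mx T) (@upper_part T).
Proof. by move=> a; apply/ffunP => u; rewrite ffunE mxE upper_idxK. Qed.

Lemma big_sym_mx (V : nmodType) (T : finType) (h : 'M[T]_n -> V) :
  \sum_(M | M^T == M) h M = \sum_a h (sym_mx a).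
Proof.
rewrite (reindex_onto (@sym_mx T) (@upper_part T)) /= => [|M /eqP]; last exact: upper_partK.
by apply: eq_bigl => a; rewrite tr_sym_mx eqxx sym_mxK eqxx.
Qed.

Lemma sum_upper_index (V : zmodType) (F : 'I_n -> 'I_n -> V) :
  \sum_i \sum_j F i j = \sum_(u : upper_index n)
    (if (val u).1 == (val u).2 then F (val u).1 (val u).1
     else F (val u).1 (val u).2 + F (val u).2 (val u).1).
Proof.
rewrite pair_big /= (partition_big (fun ij => upper_idx ij.1 ij.2) predT)//=.
apply: eq_bigr => u _; pose swapped := ((val u).2, (val u).1).
have fiber ij : (upper_idx ij.1 ij.2 == u) = (ij == val u) || (ij == swapped).
  rewrite upper_idx_eq -surjective_pairing; congr (_ || _).
  by rewrite /swapped; case: ij (val u) => i j [k l]; rewrite !xpair_eqE andbC.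
rewrite (eq_bigl _ _ fiber); case: ifP => [/eqP diag|/negbT offdiag].
  have -> : swapped = val u by rewrite [RHS]surjective_pairing /swapped diag.
  by rewrite (eq_bigl (pred1 (val u))) ?big_pred1_eq ?diag// => ij /=; rewrite orbb.
have swapped_neq : (val u == swapped) = false.
  by apply/negbTE; apply: contraNneq offdiag => /(congr1 fst) /= <-.
rewrite (bigD1 (val u)) ?eqxx//=; congr (_ + _).
rewrite (eq_bigl (pred1 swapped)) ?big_pred1_eq// => ij /=.
by case: (altP (ij =P val u)) => [->|]/=; rewrite ?swapped_neq ?andbT.
Qed.

Lemma sum_upper_index_ends (e : 'I_n -> nat) :
  (\sum_(u : upper_index n) (e (val u).1 + e (val u).2) = n.+1 * \sum_i e i)%N.
Proof.
have -> : (\sum_(u : upper_index n) (e (val u).1 + e (val u).2) =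
    \sum_(ij : 'I_n * 'I_n | ij.1 <= ij.2) (e ij.1 + e ij.2))%N.
  rewrite (reindex_onto (fun u : upper_index n => val u)
    (fun ij => upper_idx ij.1 ij.2)) /=; last by move=> [i j] /= ->.
  by apply: eq_bigl => u; rewrite upper_idxK eqxx andbT; case: u.
rewrite -(pair_big_dep xpredT (fun i j : 'I_n => i <= j)%N (fun i j => e i + e j)%N) /=.
under eq_bigr do rewrite big_split /=.
rewrite big_split /= [X in (_ + X)%N](exchange_big_dep xpredT) //= -big_split /= big_distrr /=.
apply: eq_bigr => i _; rewrite !sum_nat_cond_const -mulnDl; congr (_ * _)%N.
have := cardUI [pred j : 'I_n | i <= j]%N [pred j : 'I_n | j <= i]%N.
rewrite !cardsE => <-; rewrite -[n.+1]addn1; congr (_ + _)%N.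
  by rewrite -[RHS]card_ord; apply: eq_card => j; rewrite !inE leq_total.
by rewrite -(card1 i); apply: eq_card => j; rewrite !inE -eqn_leq eq_sym.
Qed.

Lemma card_sym_mx_family (T : finType) (S : 'I_n -> 'I_n -> {set T}) :
  (forall i j, S i j = S j i) ->
  #|[pred A : 'M[T]_n | (A^T == A) && [forall i, forall j, A i j \in S i j]]| =
  (\prod_(u : upper_index n) #|S (val u).1 (val u).2|)%N.
Proof.
move=> symS.
have -> : (\prod_(u : upper_index n) #|S (val u).1 (val u).2|)%N =
    #|family (fun u : upper_index n => mem (S (val u).1 (val u).2))|.
  by rewrite card_family foldrE big_image.
rewrite -(card_imset _ (can_inj (@sym_mxK T))); apply: eq_card => A; rewrite inE.
apply/andP/imsetP => [[/eqP symA /forallP inS]|[f /familyP fS ->]].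
  exists (upper_part A); last by rewrite upper_partK.
  by apply/familyP => u; rewrite ffunE; exact: (forallP (inS _)).
split; first by rewrite tr_sym_mx.
apply/forallP => i; apply/forallP => j; rewrite mxE.
suff <- : S (val (upper_idx i j)).1 (val (upper_idx i j)).2 = S i j by exact: fS.
by rewrite /=; case: ifP => //= _; rewrite symS.
Qed.

End upper_triangle.

Section independent_entries.
Variables (R : realType) (T : finType) (n : nat).
Implicit Types (w : upper_index n -> T -> R) (h : 'M[T]_n -> R).

Definition is_law w : Prop :=
  (forall u x, 0 <= w u x) /\ (forall u, \sum_x w u x = 1).

(* The expectation of h at the random symmetric matrix whose entries on and above
   the diagonal are independent, the one at u having law w u. *)
Definition expect w h : R :=
  \sum_(a : {ffun upper_index n -> T}) (\prod_u w u (a u)) * h (sym_mx a).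

Variable w : upper_index n -> T -> R.

Lemma expectZ c h : expect w (fun M => c * h M) = c * expect w h.
Proof. by rewrite /expect mulr_sumr; apply: eq_bigr => a _; rewrite mulrCA. Qed.

Lemma expectB h h' : expect w (fun M => h M - h' M) = expect w h - expect w h'.
Proof. by rewrite /expect -sumrB; apply: eq_bigr => a _; rewrite mulrBr. Qed.

Lemma expect_sum (I : finType) (h : I -> 'M[T]_n -> R) :
  expect w (fun M => \sum_i h i M) = \sum_i expect w (h i).
Proof. by rewrite /expect exchange_big; apply: eq_bigr => a _; rewrite mulr_sumr. Qed.

Lemma eq_expect h h' : (forall M, M^T = M -> h M = h' M) -> expect w h = expect w h'.
Proof. by move=> hh'; apply: eq_bigr => a _; rewrite hh'// tr_sym_mx. Qed.

Hypothesis w_law : is_law w.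

Lemma expect_cst c : expect w (fun=> c) = c.
Proof.
rewrite /expect -mulr_suml -(bigA_distr_bigA w) big1 ?mul1r// => u _.
by have [_ ->] := w_law.
Qed.

Lemma le_expect h h' : (forall M, M^T = M -> h M <= h' M) -> expect w h <= expect w h'.
Proof.
move=> hh'; apply: ler_sum => a _; apply: ler_wpM2l; last by rewrite hh'// tr_sym_mx.
by apply: prodr_ge0 => u _; case: w_law.
Qed.

Lemma norm_expect_le h h' : (forall M, M^T = M -> `|h M| <= h' M) ->
  `|expect w h| <= expect w h'.
Proof.
move=> hh'; rewrite ler_norml -mulN1r -expectZ; apply/andP; split; apply: le_expect => M symM.
  by have := hh' M symM; rewrite mulN1r ler_norml => /andP[].
by have := hh' M symM; rewrite ler_norml => /andP[].
Qed.

End independent_entries.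

(** * Universality of weighted solution counts *)

(* The data of the congruences imposed on an r x n matrix Y by a symmetric matrix
   M: the entries of Y M and of Y M Y^T - gram_target are killed by the weights. *)
Record congruence_system (q r : nat) := CongruenceSystem {
  row_weight : 'I_r -> 'Z_q;
  gram_weight : 'I_r -> 'I_r -> 'Z_q;
  gram_target : 'I_r -> 'I_r -> 'Z_q
}.

Definition annihilator (q : nat) (c : 'Z_q) : {set 'Z_q} := [set x | c * x == 0]%SET.

Lemma card_annihilator_gt0 q (c : 'Z_q) : (0 < #|annihilator c|)%N.
Proof. by apply/card_gt0P; exists 0; rewrite inE mulr0. Qed.

Section congruence_system_theory.
Variables (q r : nat) (Q : congruence_system q r).

Definition solves n (Y : 'M['Z_q]_(r, n)) (M : 'M['Z_q]_n) : bool :=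
  [forall i, forall s, row_weight Q s * (Y *m M) s i == 0] &&
  [forall st, gram_weight Q st.1 st.2 *
    ((Y *m M *m Y^T) st.1 st.2 - gram_target Q st.1 st.2) == 0].

Definition weighted_solutions (R : pzSemiRingType) n (c : 'M['Z_q]_(r, n) -> R)
    (M : 'M['Z_q]_n) : R :=
  \sum_Y c Y * (solves Y M)%:R.

Definition solution_count n (M : 'M['Z_q]_n) : nat := #|[pred Y | solves Y M]|.

Definition annihilator_count : nat := (\prod_s #|annihilator (row_weight Q s)|)%N.

Lemma weighted_solutions1 (R : nzRingType) n (M : 'M['Z_q]_n) :
  weighted_solutions (fun=> 1) M = (solution_count M)%:R :> R.
Proof.
rewrite -[RHS]mulr1 -sumr_constE [RHS]big_mkcond; apply: eq_bigr => Y _.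
by rewrite mul1r; case: solves.
Qed.

Lemma annihilator_count_gt0 : (0 < annihilator_count)%N.
Proof. by rewrite prodn_gt0// => s; exact: card_annihilator_gt0. Qed.

End congruence_system_theory.

Section phase_form.
Variables (q r : nat) (Q : congruence_system q r).
Hypothesis q_gt1 : (1 < q)%N.

Local Notation colv := {ffun 'I_r -> 'Z_q}.
(* A column of Y together with the Fourier multipliers of the congruences on the
   corresponding column of Y M. *)
Local Notation W := (colv * colv)%type.

Definition mx_of_cols n (y : {ffun 'I_n -> colv}) : 'M['Z_q]_(r, n) :=
  \matrix_(s, i) y i s.

Lemma mx_of_cols_bij n : bijective (@mx_of_cols n).
Proof.
exists (fun Y : 'M['Z_q]_(r, n) => [ffun i => [ffun s => Y s i]]).
  by move=> y; apply/ffunP => i; apply/ffunP => s; rewrite !ffunE mxE.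
by move=> Y; apply/matrixP => s i; rewrite mxE !ffunE.
Qed.

Definition vectors n (x : {ffun 'I_n -> W}) : {ffun 'I_n -> colv} := [ffun i => (x i).1].
Definition multipliers n (x : {ffun 'I_n -> W}) : {ffun 'I_n -> colv} := [ffun i => (x i).2].

Definition zip_ffun n (yd : {ffun 'I_n -> colv} * {ffun 'I_n -> colv}) : {ffun 'I_n -> W} :=
  [ffun i => (yd.1 i, yd.2 i)].

Lemma vectors_zip n (yd : {ffun 'I_n -> colv} * {ffun 'I_n -> colv}) :
  vectors (zip_ffun yd) = yd.1.
Proof. by apply/ffunP => i; rewrite !ffunE. Qed.

Lemma multipliers_zip n (yd : {ffun 'I_n -> colv} * {ffun 'I_n -> colv}) :
  multipliers (zip_ffun yd) = yd.2.
Proof. by apply/ffunP => i; rewrite !ffunE. Qed.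

Lemma zip_ffun_bij n : bijective (@zip_ffun n).
Proof.
exists (fun x => (vectors x, multipliers x)) => [yd|x].
  by rewrite vectors_zip multipliers_zip -surjective_pairing.
by apply/ffunP => i; rewrite !ffunE -surjective_pairing.
Qed.

(* The Fourier multipliers of the congruences on Y M Y^T. *)
Variable E : {ffun 'I_r * 'I_r -> 'Z_q}.

Definition form (w w' : W) : 'Z_q :=
  \sum_s w.2 s * (row_weight Q s * w'.1 s) +
  \sum_st E st * (gram_weight Q st.1 st.2 * (w.1 st.1 * w'.1 st.2)).

Definition polar (w w' : W) : 'Z_q := form w w' + form w' w.

Definition null (w : W) : bool := form w w == 0.

Lemma formDl u v w : form (u + v) w = form u w + form v w.
Proof.
rewrite /form addrACA -!big_split /=.
by congr (_ + _); apply: eq_bigr => s _; rewrite !ffunE; ring.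
Qed.

Lemma formDr u v w : form w (u + v) = form w u + form w v.
Proof.
rewrite /form addrACA -!big_split /=.
by congr (_ + _); apply: eq_bigr => s _; rewrite !ffunE; ring.
Qed.

Lemma polarC w w' : polar w w' = polar w' w.
Proof. exact: addrC. Qed.

Lemma polarDl u v w : polar (u + v) w = polar u w + polar v w.
Proof. by rewrite /polar formDl formDr addrACA. Qed.

Definition annihilated_cols : {set colv} :=
  [set f : colv | [forall s, f s \in annihilator (row_weight Q s)]]%SET.

Lemma card_annihilated_cols : #|annihilated_cols| = annihilator_count Q.
Proof.
have -> : #|annihilated_cols| = #|family (fun s => mem (annihilator (row_weight Q s)))|.
  by apply: eq_card => f; rewrite inE; apply/forallP/familyP.
by rewrite card_family foldrE big_image.
Qed.

Let unit_vector s : W := ([ffun t => (t == s)%:R], 0).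
Let unit_multiplier s : W := (0, [ffun t => (t == s)%:R]).

Lemma radical_fst w : w \in radical polar -> w.1 \in annihilated_cols.
Proof.
rewrite inE => /forallP w_rad; rewrite inE; apply/forallP => s; rewrite inE.
have := w_rad (unit_multiplier s); rewrite /polar /form /= (bigD1 s)//= !ffunE eqxx mul1r.
rewrite !big1 ?addr0//.
1, 2, 3: by move=> t _; rewrite !ffunE ?(mul0r, mulr0).
by move=> t /negbTE ts; rewrite ffunE ts mul0r.
Qed.

Lemma radical_sub_snd w w' : w \in radical polar -> w' \in radical polar ->
  w.1 = w'.1 -> w.2 - w'.2 \in annihilated_cols.
Proof.
rewrite !inE => /forallP w_rad /forallP w'_rad eq1; apply/forallP => s; rewrite inE.
have : polar (unit_vector s) (w - w') = 0.
  rewrite (biadditiveBr polarC polarDl).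
  by rewrite (eqP (w_rad (unit_vector s))) (eqP (w'_rad (unit_vector s))) subr0.
have form_left : form (unit_vector s) (w - w') = 0.
  by rewrite /form /= eq1 subrr !big1 ?addr0// => t _; rewrite !ffunE ?(mul0r, mulr0).
have form_right : form (w - w') (unit_vector s) = row_weight Q s * (w.2 - w'.2) s.
  rewrite /form /= eq1 subrr (bigD1 s)//= !big1 ?addr0.
  - by rewrite [X in _ * (_ * X)]ffunE eqxx mulr1 mulrC.
  - by move=> t _; rewrite !ffunE ?(mul0r, mulr0).
  - by move=> t /negbTE ts; rewrite !ffunE ts !mulr0.
by rewrite /polar form_left form_right add0r => ->.
Qed.

Lemma card_radical : (#|radical polar| <= annihilator_count Q ^ 2)%N.
Proof.
rewrite -card_annihilated_cols -mulnn -cardsX.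
pose base (y : colv) : colv :=
  if [pick d | (y, d) \in radical polar] is Some d then d else 0.
pose shift (w : W) : W := (w.1, w.2 - base w.1).
have shift_inj : injective shift by move=> [y d] [y' d'] /= [-> /addIr ->].
rewrite -(card_imset _ shift_inj); apply: subset_leq_card; apply/fintype.subsetP.
move=> _ /imsetP[w w_rad ->]; rewrite inE /= radical_fst//=.
rewrite /base; case: pickP => [d d_rad|/(_ w.2)].
  exact: (@radical_sub_snd w (w.1, d)).
by rewrite -surjective_pairing w_rad.
Qed.

Lemma card_perp_polar (R : realType) (S : {set W}) :
  (#|S| * #|perp (orthogonal polar) S| <= (q ^ r * annihilator_count Q) ^ 2)%N.
Proof.
apply: leq_trans (card_perp_radical R q_gt1 polarC polarDl S) _.
rewrite expnMn leq_mul ?card_radical// card_prod !card_ffun (card_Zq q_gt1) card_ord.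
by rewrite mulnn.
Qed.

Section phase.
Variable n : nat.
Implicit Types (x : {ffun 'I_n -> W}) (a : {ffun upper_index n -> 'Z_q}).

Definition phase_coef x (u : upper_index n) : 'Z_q :=
  if (val u).1 == (val u).2 then form (x (val u).1) (x (val u).1)
  else polar (x (val u).1) (x (val u).2).

Definition offset : 'Z_q :=
  \sum_st E st * (gram_weight Q st.1 st.2 * gram_target Q st.1 st.2).

Lemma orthogonal_pair_phase x u :
  orthogonal_pair (orthogonal polar) null x u = (phase_coef x u == 0).
Proof. by rewrite /orthogonal_pair /phase_coef; case: ifP. Qed.

Lemma sum_form_sym_mx x a :
  \sum_i \sum_j sym_mx a i j * form (x i) (x j) = \sum_u a u * phase_coef x u.
Proof.
rewrite sum_upper_index; apply: eq_bigr => u _; rewrite /phase_coef.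
have entry : sym_mx a (val u).1 (val u).2 = a u by rewrite mxE upper_idxK.
have entryC : sym_mx a (val u).2 (val u).1 = a u by rewrite mxE upper_idxC upper_idxK.
case: eqP => [diag|_]; first by rewrite -[in RHS]entry -diag.
by rewrite entry entryC -mulrDr.
Qed.

Lemma row_phase x a : let Y := mx_of_cols (vectors x) in
  \sum_i \sum_s multipliers x i s * (row_weight Q s * (Y *m sym_mx a) s i) =
  \sum_i \sum_j sym_mx a i j * (\sum_s (x i).2 s * (row_weight Q s * (x j).1 s)).
Proof.
apply: eq_bigr => i _; under [RHS]eq_bigr do rewrite mulr_sumr.
rewrite exchange_big; apply: eq_bigr => s _; rewrite mxE !mulr_sumr.
by apply: eq_bigr => j _; rewrite !mxE !ffunE upper_idxC; ring.
Qed.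

Lemma gram_phase x a : let Y := mx_of_cols (vectors x) in
  \sum_st E st * (gram_weight Q st.1 st.2 * (Y *m sym_mx a *m Y^T) st.1 st.2) =
  \sum_i \sum_j sym_mx a i j *
    (\sum_st E st * (gram_weight Q st.1 st.2 * ((x i).1 st.1 * (x j).1 st.2))).
Proof.
transitivity (\sum_st \sum_i \sum_j sym_mx a i j *
    (E st * (gram_weight Q st.1 st.2 * ((x i).1 st.1 * (x j).1 st.2)))).
  apply: eq_bigr => st _; rewrite mxE exchange_big !mulr_sumr.
  apply: eq_bigr => j _; rewrite mxE mulr_suml !mulr_sumr.
  by apply: eq_bigr => i _; rewrite !mxE !ffunE; ring.
rewrite exchange_big; apply: eq_bigr => i _; rewrite exchange_big.
by apply: eq_bigr => j _; rewrite mulr_sumr.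
Qed.

Lemma phaseE x a : let Y := mx_of_cols (vectors x) in
  \sum_i \sum_s multipliers x i s * (row_weight Q s * (Y *m sym_mx a) s i) +
  \sum_st E st * (gram_weight Q st.1 st.2 *
    ((Y *m sym_mx a *m Y^T) st.1 st.2 - gram_target Q st.1 st.2)) =
  \sum_u a u * phase_coef x u - offset.
Proof.
move=> Y; rewrite -sum_form_sym_mx /offset row_phase.
under [X in _ + X]eq_bigr do rewrite !mulrBr.
rewrite sumrB addrA gram_phase -big_split; congr (_ - _); apply: eq_bigr => i _.
by rewrite -big_split; apply: eq_bigr => j _; rewrite /form mulrDr.
Qed.

End phase.
End phase_form.

Section universality.
Variables (R : realType) (q r : nat) (Q : congruence_system q r).
Hypothesis q_gt1 : (1 < q)%N.

Local Notation C := R[i].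
Local Notation chi := (chi R q_gt1).
Local Notation colv := {ffun 'I_r -> 'Z_q}.
Local Notation W := (colv * colv)%type.

Definition fourier n (w : upper_index n -> 'Z_q -> R) u (t : 'Z_q) : C :=
  \sum_x (w u x)%:C%C * chi (x * t).

Definition fourier_le (rho : R) n (w : upper_index n -> 'Z_q -> R) : Prop :=
  forall u t, t != 0 -> `|fourier w u t| <= rho%:C%C.

Lemma fourier0 n (w : upper_index n -> 'Z_q -> R) u : is_law w -> fourier w u 0 = 1.
Proof.
move=> [_ w_sum1]; rewrite /fourier.
under eq_bigr do rewrite mulr0 chi0 mulr1.
by rewrite -rmorph_sum w_sum1.
Qed.

Lemma normC_real (x : R) : `|x%:C%C| = `|x|%:C%C.
Proof. by rewrite normc_def /= expr0n addr0 sqrtr_sqr. Qed.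

Lemma weighted_solutions_chi n (c : 'M['Z_q]_(r, n) -> R)
    (a : {ffun upper_index n -> 'Z_q}) :
  (weighted_solutions Q c (sym_mx a))%:C%C * q%:R ^+ (r * n + r * r) =
  \sum_E \sum_(x : {ffun 'I_n -> W}) (c (mx_of_cols (vectors x)))%:C%C *
    chi (- offset Q E) * \prod_u chi (a u * phase_coef Q E x u).
Proof.
rewrite /weighted_solutions (reindex _ (onW_bij _ (@mx_of_cols_bij q r n))) /=.
rewrite rmorph_sum mulr_suml [RHS]exchange_big (reindex _ (onW_bij _ (@zip_ffun_bij q r n))) /=.
rewrite -(pair_bigA _ (fun y d => \sum_E (c (mx_of_cols (vectors (zip_ffun (y, d)))))%:C%C *
    chi (- offset Q E) * \prod_u chi (a u * phase_coef Q E (zip_ffun (y, d)) u))) /=.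
apply: eq_bigr => y _; set Y := mx_of_cols y.
transitivity ((c Y)%:C%C * \sum_(d : {ffun 'I_n -> colv})
  \sum_(E : {ffun 'I_r * 'I_r -> 'Z_q})
   chi (\sum_i \sum_s d i s * (row_weight Q s * (Y *m sym_mx a) s i) +
   \sum_st E st * (gram_weight Q st.1 st.2 *
     ((Y *m sym_mx a *m Y^T) st.1 st.2 - gram_target Q st.1 st.2)))); last first.
  rewrite mulr_sumr; apply: eq_bigr => d _; rewrite mulr_sumr.
  apply: eq_bigr => E _; have := phaseE Q E (zip_ffun (y, d)) a.
  rewrite /= vectors_zip multipliers_zip /= -/Y => ->.
  by rewrite addrC chiD chi_sum mulrA.
under eq_bigr => d _ do under eq_bigr => E _ do rewrite chiD.
under eq_bigr => d _ do rewrite -mulr_sumr sum_chi_dot.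
rewrite -mulr_suml sum_chi_dot2 rmorphM /= -mulrA; congr (_ * _).
rewrite /solves; case: ifP => _; case: ifP => _;
  by rewrite ?mul1r ?mul0r ?mulr0 // card_prod !card_ord exprD.
Qed.

Section fixed_dimension.
Variable n : nat.
Implicit Types (w : upper_index n -> 'Z_q -> R) (c : 'M['Z_q]_(r, n) -> R).

Lemma expect_chi w c :
  (expect w (weighted_solutions Q c))%:C%C * q%:R ^+ (r * n + r * r) =
  \sum_E \sum_(x : {ffun 'I_n -> W}) (c (mx_of_cols (vectors x)))%:C%C *
    chi (- offset Q E) * \prod_u fourier w u (phase_coef Q E x u).
Proof.
rewrite /expect rmorph_sum mulr_suml.
under eq_bigr => a _ do rewrite rmorphM /= -mulrA weighted_solutions_chi mulr_sumr.
rewrite exchange_big; apply: eq_bigr => E _.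
under eq_bigr => a _ do rewrite mulr_sumr.
rewrite exchange_big; apply: eq_bigr => x _.
rewrite /fourier bigA_distr_bigA mulr_sumr; apply: eq_bigr => a _.
by rewrite rmorph_prod mulrCA -big_split.
Qed.

Variable E : {ffun 'I_r * 'I_r -> 'Z_q}.
Local Notation orth := (orthogonal (polar Q E)).
Local Notation null := (null Q E).

Lemma fourier_prod_isotropic w (x : {ffun 'I_n -> W}) : is_law w ->
  isotropic orth null x -> \prod_u fourier w u (phase_coef Q E x u) = 1.
Proof.
move=> w_law /forallP xiso; rewrite big1// => u _.
by have := xiso u; rewrite orthogonal_pair_phase => /eqP ->; rewrite fourier0.
Qed.

Lemma fourier_prod_le (rho : R) w (x : {ffun 'I_n -> W}) : 0 <= rho -> is_law w ->
  fourier_le rho w ->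
  `|\prod_u fourier w u (phase_coef Q E x u)| <= (rho ^+ defects orth null x)%:C%C.
Proof.
move=> rho_ge0 w_law w_le; rewrite normr_prod /defects.
rewrite (bigID (fun u => ~~ orthogonal_pair orth null x u)) /=.
rewrite [X in _ * X]big1 ?mulr1; last first.
  by move=> u; rewrite negbK orthogonal_pair_phase => /eqP ->; rewrite fourier0// normr1.
rewrite -prodr_const rmorph_prod /=; apply: ler_prod => u.
by rewrite orthogonal_pair_phase normr_ge0 => /w_le ->.
Qed.

Lemma norm_expect_term_le (rho : R) w w' c (x : {ffun 'I_n -> W}) : 0 <= rho ->
  is_law w -> is_law w' -> fourier_le rho w -> fourier_le rho w' ->
  (forall Y, `|c Y| <= 1) ->
  `|(c (mx_of_cols (vectors x)))%:C%C * chi (- offset Q E) *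
      \prod_u fourier w u (phase_coef Q E x u) -
    (c (mx_of_cols (vectors x)))%:C%C * chi (- offset Q E) *
      \prod_u fourier w' u (phase_coef Q E x u)| <=
  (if isotropic orth null x then 0 else 2 * rho ^+ defects orth null x)%:C%C.
Proof.
move=> rho_ge0 w_law w'_law w_le w'_le c_le1; rewrite -mulrBr.
case: ifP => [xiso|_]; first by rewrite !fourier_prod_isotropic// subrr mulr0 normr0.
rewrite !normrM norm_chi mulr1 normC_real -[leRHS]mul1r ler_pM//.
- by rewrite ler0c.
- by rewrite -[1]/(1%:C%C) lecR.
rewrite [2 * _]mulr_natl [_ *+ 2]mulr2n rmorphD; apply: le_trans (ler_normB _ _) _.
by apply: lerD; exact: fourier_prod_le.
Qed.

End fixed_dimension.

Lemma norm_expectB_le n (rho : R) (w w' : upper_index n -> 'Z_q -> R)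
    (c : 'M['Z_q]_(r, n) -> R) : 0 <= rho ->
  is_law w -> is_law w' -> fourier_le rho w -> fourier_le rho w' ->
  (forall Y, `|c Y| <= 1) ->
  `|expect w (weighted_solutions Q c) - expect w' (weighted_solutions Q c)| *
     q%:R ^+ (r * n + r * r) <=
  \sum_E 2 * nonisotropic_sum (orthogonal (polar Q E)) (null Q E) rho n.
Proof.
move=> rho_ge0 w_law w'_law w_le w'_le c_le1.
rewrite -lecR rmorphM /= -normC_real rmorphB /= rmorphXn rmorph_nat.
rewrite -[X in `|_| * X]ger0_norm ?exprn_ge0// -normrM mulrBl !expect_chi.
rewrite -sumrB; apply: le_trans (ler_norm_sum _ _ _) _.
rewrite rmorph_sum; apply: ler_sum => E _; rewrite -sumrB.
apply: le_trans (ler_norm_sum _ _ _) _; rewrite mulr_sumr [X in _ <= _ X]big_mkcond rmorph_sum.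
apply: ler_sum => x _; rewrite -if_neg negbK.
exact: norm_expect_term_le.
Qed.

Theorem universality (rho : R) (w w' : forall n, upper_index n -> 'Z_q -> R)
    (c : forall n, 'M['Z_q]_(r, n) -> R) : 0 < rho < 1 ->
  (forall n, is_law (w n)) -> (forall n, is_law (w' n)) ->
  (forall n, fourier_le rho (w n)) -> (forall n, fourier_le rho (w' n)) ->
  (forall n Y, `|c n Y| <= 1) ->
  (expect (w n) (weighted_solutions Q (c n)) -
     expect (w' n) (weighted_solutions Q (c n))) /
    (annihilator_count Q)%:R ^+ n @[n --> \oo] --> 0.
Proof.
move=> rho01 w_law w'_law w_le w'_le c_le1; apply/cvgrPdist_le => eps eps_gt0.
set A := annihilator_count Q; pose Lam := (q ^ r * A)%N.
have q_gt0 : (0 < q)%N by exact: ltnW.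
have A_gt0 : 0 < A%:R :> R by rewrite ltr0n annihilator_count_gt0.
have Lam_gt0 : (0 < Lam)%N by rewrite muln_gt0 expn_gt0 q_gt0 annihilator_count_gt0.
have eps2_gt0 : 0 < eps / 2 by rewrite divr_gt0.
have : \forall n \near \oo, forall E : {ffun 'I_r * 'I_r -> 'Z_q},
    nonisotropic_sum (orthogonal (polar Q E)) (null Q E) rho n <= eps / 2 * Lam%:R ^+ n.
  apply: filter_forall => E; apply: near_nonisotropic_sum => //.
    exact/orthogonalC/polarC.
  exact: card_perp_polar.
apply: filterS => n small; rewrite sub0r normrN normrM normfV (gtr0_norm (exprn_gt0 _ A_gt0)).
rewrite ler_pdivrMr ?exprn_gt0//.
have q_pow_gt0 : 0 < q%:R ^+ (r * n + r * r) :> R by rewrite exprn_gt0// ltr0n.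
have rho_ge0 : 0 <= rho by case/andP: rho01 => /ltW.
rewrite -(ler_pM2r q_pow_gt0).
apply: le_trans (norm_expectB_le rho_ge0 (w_law n) (w'_law n) (w_le n) (w'_le n) (c_le1 n)) _.
apply: le_trans (ler_sum _ (fun E _ => ler_wpM2l (ler0n R 2) (small E))) _.
rewrite sumr_constE (_ : #|_| = (q ^ (r * r))%N); last first.
  by rewrite -[LHS]/#|{: {ffun 'I_r * 'I_r -> 'Z_q}}| card_ffun card_prod !card_ord Zp_cast.
rewrite /Lam natrM !natrX exprMn -exprM exprD le_eqVlt; apply/orP; left; apply/eqP.
by field.
Qed.

End universality.

(** * Counting matrices *)

Lemma card_surj_fiber (X Z : finZmodType) (f : {additive X -> Z}) (z : Z) :
  (forall z', exists x, f x = z') -> (#|[pred x | f x == z]| * #|Z| = #|X|)%N.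
Proof.
move=> f_surj.
have fiberE z' : #|[pred x | f x == z']| = #|[pred x | f x == z]|.
  have [x0 <-] := f_surj z; have [x1 <-] := f_surj z'.
  rewrite -(fintype.card_image (addIr (x1 - x0)) [pred x | f x == f x0]).
  apply: eq_card => x; rewrite inE; apply/eqP/fintype.imageP => [fx|[y /eqP fy ->]].
    exists (x - (x1 - x0)); last by rewrite subrK.
    by rewrite inE (raddfB f) (raddfB f) fx subKr.
  by rewrite (raddfD f) (raddfB f) fy addrC subrK.
rewrite mulnC -sum_nat_const -[RHS]sum1_card (partition_big f predT) //=.
by apply: eq_bigr => z' _; rewrite sum1_card -(fiberE z').
Qed.

Section matrices_with_entries.
Variable T : finType.

Lemma card_mx_family m n (S : 'I_m -> 'I_n -> {set T}) :
  #|[pred A : 'M[T]_(m, n) | [forall i, forall j, A i j \in S i j]]| =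
  (\prod_i \prod_j #|S i j|)%N.
Proof.
pose F (f : {ffun 'I_m * 'I_n -> T}) : 'M[T]_(m, n) := \matrix_(i, j) f (i, j).
have F_inj : injective F.
  by move=> f g /matrixP fg; apply/ffunP => -[i j]; have := fg i j; rewrite !mxE.
transitivity #|family (fun ij : 'I_m * 'I_n => mem (S ij.1 ij.2))|; last first.
  by rewrite card_family foldrE big_image pair_bigA.
rewrite -(card_imset _ F_inj); apply: eq_card => A; rewrite inE.
apply/forallP/imsetP => [inS|[f /familyP inS ->] i]; last first.
  by apply/forallP => j; rewrite mxE; exact: (inS (i, j)).
exists [ffun ij => A ij.1 ij.2]; last by apply/matrixP => i j; rewrite mxE ffunE.
by apply/familyP => -[i j]; rewrite ffunE; exact: (forallP (inS i)).
Qed.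

Lemma card_mx_rows m n (K : {set 'rV[T]_n}) :
  #|[pred A : 'M[T]_(m, n) | [forall i, row i A \in K]]| = (#|K| ^ m)%N.
Proof.
pose F (f : {ffun 'I_m -> 'rV[T]_n}) : 'M[T]_(m, n) := \matrix_(i, j) f i 0 j.
have F_row f i : row i (F f) = f i by apply/rowP => j; rewrite !mxE.
have F_inj : injective F.
  by move=> f g fg; apply/ffunP => i; rewrite -!F_row fg.
transitivity #|(ffun_on (mem K) : {pred {ffun 'I_m -> 'rV[T]_n}})|; last first.
  by rewrite card_ffun_on card_ord.
rewrite -(card_imset _ F_inj); apply: eq_card => A; rewrite inE.
apply/forallP/imsetP => [inK|[f /ffun_onP inK ->] i]; last by rewrite F_row; exact: inK.
exists [ffun i => row i A]; first by apply/ffun_onP => i; rewrite ffunE; exact: inK.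
by apply/row_matrixP => i; rewrite F_row ffunE.
Qed.

End matrices_with_entries.

(** * Matrices modulo a prime power *)

Lemma prime_power_gt1 p l : prime p -> (1 < p ^ l.+1)%N.
Proof. by move=> p_pr; rewrite -(exp1n l.+1) ltn_exp2r// prime_gt1. Qed.

Lemma intr_Zp_eq0 q (z : int) : (1 < q)%N -> ((z%:~R : 'Z_q) == 0) = (q%:Z %| z)%Z.
Proof.
move=> q_gt1; have natr_eq0 (k : nat) : ((k%:R : 'Z_q) == 0) = (q %| k)%N.
  by rewrite Zp_nat -val_eqE /= Zp_cast// /dvdn.
case: z => k; first by rewrite /= -pmulrn natr_eq0 dvdzE.
by rewrite NegzE mulrNz oppr_eq0 -pmulrn natr_eq0 dvdzE abszN.
Qed.

Lemma intr_val_Zp q (x : 'Z_q) : ((x : nat)%:Z)%:~R = x.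
Proof. by rewrite -pmulrn natr_Zp. Qed.

Definition int_lift q m n (A : 'M['Z_q]_(m, n)) : 'M[int]_(m, n) :=
  map_mx (fun x : 'Z_q => (x : nat)%:Z) A.

Lemma int_liftK q m n (A : 'M['Z_q]_(m, n)) : map_mx intr (int_lift A) = A.
Proof. by apply/matrixP => i j; rewrite !mxE intr_val_Zp. Qed.

Lemma intr_Fp_eq0 p (z : int) : prime p -> ((z%:~R : 'F_p) == 0) = (p%:Z %| z)%Z.
Proof. by move=> p_pr; rewrite -(dvdz_pcharf (pchar_Fp p_pr)). Qed.

Section prime_power_ring.
Variables (p l : nat).
Hypothesis p_pr : prime p.
Local Notation q := (p ^ l.+1)%N.

Let q_gt1 : (1 < q)%N := prime_power_gt1 l p_pr.
Let p_gt0 : (0 < p)%N := prime_gt0 p_pr.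

Lemma ppower_mul_intr_eq0 (e : nat) (z : int) : (e <= l.+1)%N ->
  ((p ^ (l.+1 - e))%:R * z%:~R == 0 :> 'Z_q) = ((p ^ e)%:Z %| z)%Z.
Proof.
move=> e_le; have qE : q = (p ^ (l.+1 - e) * p ^ e)%N by rewrite -expnD subnK.
rewrite (_ : _ * _ = ((p ^ (l.+1 - e))%:Z * z)%:~R); last by rewrite intrM.
by rewrite intr_Zp_eq0// {1}qE PoszM dvdz_mul2l// -lt0n expn_gt0 p_gt0.
Qed.

Lemma card_annihilator_ppower (j : nat) : (j <= l.+1)%N ->
  #|annihilator ((p ^ j)%:R : 'Z_q)| = (p ^ j)%N.
Proof.
move=> j_le; have cofactor_gt0 : (0 < p ^ (l.+1 - j))%N by rewrite expn_gt0 p_gt0.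
have multiple_lt (i : 'I_(p ^ j)) : (p ^ (l.+1 - j) * i < (Zp_trunc q).+2)%N.
  by rewrite Zp_cast// -{2}(subnK j_le) expnD ltn_pmul2l.
pose multiple (i : 'I_(p ^ j)) : 'Z_q := Ordinal (multiple_lt i).
have multiple_inj : injective multiple.
  by move=> i k /(congr1 val)/eqP /=; rewrite eqn_pmul2l// => /eqP/val_inj.
rewrite -[RHS]card_ord -(card_imset _ multiple_inj); apply: eq_card => x; rewrite inE.
have := ppower_mul_intr_eq0 (x : nat)%:Z (leq_subr j l.+1).
rewrite subKn// intr_val_Zp => ->; rewrite dvdzE /=.
apply/dvdnP/imsetP => [[k xE]|[i _ ->]]; last by exists (i : nat); rewrite mulnC.
have k_lt : (k < p ^ j)%N.
  rewrite -(@ltn_pmul2l (p ^ (l.+1 - j)))// mulnC -xE -expnD subnK//.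
  by rewrite -[X in (_ < X)%N](Zp_cast q_gt1) ltn_ord.
by exists (Ordinal k_lt) => //; apply: val_inj; rewrite /= mulnC.
Qed.

Definition red_Zq (x : 'Z_q) : 'F_p := (x : nat)%:R.

Lemma red_Zq_nat (k : nat) : red_Zq k%:R = k%:R.
Proof.
rewrite /red_Zq val_Zp_nat//; apply/eqP; rewrite -val_eqE /= !val_Fp_nat//.
by rewrite modn_dvdm// expnS dvdn_mulr.
Qed.

Lemma red_Zq_is_zmod_morphism : zmod_morphism red_Zq.
Proof.
move=> x y; have y_le : (y <= q)%N by rewrite -[X in (_ <= X)%N](Zp_cast q_gt1) ltnW.
have -> : x - y = ((x : nat) + (q - y))%:R.
  by rewrite natrD natrB// pchar_Zp// sub0r !natr_Zp.
by rewrite red_Zq_nat natrD natrB// natrX pchar_Fp_0// expr0n sub0r.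
Qed.

Lemma red_Zq_is_monoid_morphism : monoid_morphism red_Zq.
Proof.
split; first by rewrite -[1 in LHS]/(1%:R) red_Zq_nat.
by move=> x y; rewrite -[x in LHS]natr_Zp -[y in LHS]natr_Zp -natrM red_Zq_nat natrM.
Qed.

HB.instance Definition _ := GRing.isZmodMorphism.Build 'Z_q 'F_p red_Zq
  red_Zq_is_zmod_morphism.
HB.instance Definition _ := GRing.isMonoidMorphism.Build 'Z_q 'F_p red_Zq
  red_Zq_is_monoid_morphism.

Definition red : {rmorphism 'Z_q -> 'F_p} := red_Zq.

Lemma red_eq0 x : (red x == 0) = ((p ^ l)%:R * x == 0).
Proof.
have := ppower_mul_intr_eq0 (x : nat)%:Z (isT : 1 <= l.+1)%N.
rewrite subn1 intr_val_Zp expn1 => ->.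
by rewrite -intr_Fp_eq0// -[in LHS](intr_val_Zp x) rmorph_int.
Qed.

Lemma red_unit x : (x \is a GRing.unit) = (red x != 0).
Proof.
rewrite -[x in LHS]natr_Zp unitZpE// coprime_pexpl// prime_coprime//.
by rewrite -[x in RHS]intr_val_Zp rmorph_int intr_Fp_eq0.
Qed.

Lemma map_red_intr m n (A : 'M[int]_(m, n)) :
  map_mx red (map_mx intr A) = map_mx intr A :> 'M['F_p]_(m, n).
Proof. by apply/matrixP => i j; rewrite !mxE rmorph_int. Qed.

Definition lift (a : 'F_p) : 'Z_q := (a : nat)%:R.

Lemma liftK : cancel lift red.
Proof. by move=> a; rewrite /lift rmorph_nat natr_Zp. Qed.

Lemma map_liftK m n (A : 'M['F_p]_(m, n)) : map_mx red (map_mx lift A) = A.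
Proof. by apply/matrixP => i j; rewrite !mxE liftK. Qed.

Lemma unitmx_red n (U : 'M['Z_q]_n) : (U \in unitmx) = (map_mx red U \in unitmx).
Proof. by rewrite !unitmxE det_map_mx red_unit unitfE. Qed.

Lemma card_mx_Zq m n : #|{: 'M['Z_q]_(m, n)}| = (q ^ (m * n))%N.
Proof. by rewrite card_mx card_Zq. Qed.

Lemma card_map_red_fiber m n (Z : 'M['F_p]_(m, n)) :
  #|[pred A : 'M['Z_q]_(m, n) | map_mx red A == Z]| = (p ^ (l * (m * n)))%N.
Proof.
have red_surj Z' : exists A, (map_mx red : {additive 'M['Z_q]_(m, n) -> _}) A = Z'.
  by exists (map_mx lift Z'); exact: map_liftK.
have := card_surj_fiber Z red_surj; rewrite card_mx_Zq card_mx card_Fp//.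
rewrite -expnM mulSn addnC expnD => /eqP.
by rewrite eqn_pmul2r ?expn_gt0 ?p_gt0// => /eqP.
Qed.

(* A completion of Y modulo p can be lifted, since invertibility is tested modulo p. *)
Lemma unimodular_completion r m (Y : 'M['Z_q]_(r, r + m)) : row_free (map_mx red Y) ->
  exists2 U : 'M['Z_q]_(r + m), U \in unitmx & Y *m U = row_mx 1%:M 0.
Proof.
set Yp := map_mx red Y => Y_free.
pose Z : 'M['F_p]_(m, r + m) := row_mx 0 1%:M *m row_ebase Yp.
pose V : 'M['Z_q]_(r + m) := col_mx Y (map_mx lift Z).
have V_unit : V \in unitmx.
  rewrite unitmx_red map_col_mx map_liftK -/Yp -[Yp in col_mx Yp _]mulmx_ebase.
  rewrite (eqP Y_free) -mul_col_mx unitmx_mul row_ebase_unit andbT.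
  have -> : col_mx (col_ebase Yp *m pid_mx r) (row_mx 0 1%:M) =
            block_mx (col_ebase Yp) 0 0 1%:M :> 'M['F_p]_(r + m).
    by rewrite pid_mx_row mul_mx_row mulmx1 mulmx0.
  by rewrite unitmxE det_ublock det1 mulr1 -unitmxE col_ebase_unit.
exists (invmx V); first by rewrite unitmx_inv.
have := mulmxV V_unit; rewrite mul_col_mx -[1%:M]vsubmxK => /eq_col_mx[-> _].
by rewrite scalar_mx_block /block_mx col_mxKu.
Qed.

Definition kercard n (M : 'M['Z_q]_n) : nat :=
  #|[set v : 'rV['F_p]_n | v *m map_mx red M == 0]%SET|.

Lemma kercardE n (M : 'M['Z_q]_n) : kercard M = (p ^ (n - \rank (map_mx red M)))%N.
Proof.
rewrite -mxrank_ker -[X in (X ^ _)%N](card_Fp p_pr) -mxabelem.card_rowg.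
by apply: eq_card => v; rewrite !inE (sameP sub_kermxP eqP).
Qed.

Lemma kercard_gt0 n (M : 'M['Z_q]_n) : (0 < kercard M)%N.
Proof. by rewrite kercardE expn_gt0 p_gt0. Qed.

Lemma kercard_congr n (U M : 'M['Z_q]_n) : U \in unitmx ->
  kercard (U *m M *m U^T) = kercard M.
Proof.
rewrite unitmx_red => U_unit; rewrite !kercardE !map_mxM -map_trmx.
rewrite mxrankMfree ?row_free_unit ?unitmx_tr//.
by rewrite (eqmxMfull _ (_ : row_full _)) ?row_full_unit.
Qed.

Lemma kercard_diag m n (A : 'M['Z_q]_m) (D : 'M['Z_q]_n) :
  kercard (block_mx A 0 0 D) = (kercard A * kercard D)%N.
Proof.
rewrite !kercardE map_block_mx !map_mx0 rank_diag_block_mx -expnD.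
have := rank_leq_row (map_mx red A); have := rank_leq_row (map_mx red D).
by move=> rankD rankA; congr (p ^ _)%N; lia.
Qed.

Lemma kercard_unit n (A : 'M['Z_q]_n) : A \in unitmx -> kercard A = 1%N.
Proof. by rewrite unitmx_red kercardE => /mxrank_unit ->; rewrite subnn. Qed.

Lemma kercard_red0 r m (A : 'M['Z_q]_r) (B : 'M['Z_q]_(r, m)) (D : 'M['Z_q]_m) :
  map_mx red A = 0 -> map_mx red B = 0 ->
  kercard (block_mx A B B^T D) = (p ^ r * kercard D)%N.
Proof.
move=> A0 B0; rewrite !kercardE map_block_mx A0 B0 -map_trmx B0 trmx0.
rewrite rank_diag_block_mx mxrank0 -expnD add0n addnBA//; exact: rank_leq_row.
Qed.

(* Schur complement: the corner A can be split off by a congruence. *)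
Lemma kercard_unit_corner r m (A : 'M['Z_q]_r) (B : 'M['Z_q]_(r, m)) (D : 'M['Z_q]_m) :
  A^T = A -> A \in unitmx ->
  kercard (block_mx A B B^T (D + B^T *m invmx A *m B)) = kercard D.
Proof.
move=> symA A_unit; rewrite -[RHS]mul1n -(kercard_unit A_unit) -kercard_diag.
pose P : 'M['Z_q]_(r + m) := block_mx 1%:M 0 (B^T *m invmx A) 1%:M.
have P_unit : P \in unitmx by rewrite unitmxE det_lblock !det1 mulr1 unitr1.
rewrite -[RHS](kercard_congr _ P_unit); congr kercard.
rewrite /P tr_block_mx !trmx1 trmx0 trmx_mul trmxK trmx_inv symA.
rewrite !mulmx_block !mul1mx !mulmx1 !mul0mx !mulmx0 !addr0 !add0r.
by rewrite (mulmxKV A_unit) (mulKVmx A_unit) mulmxA [D + _]addrC.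
Qed.

Lemma kercard_castmx m n (eq_mn : (m = n) * (m = n)) (M : 'M['Z_q]_m) :
  kercard (castmx eq_mn M) = kercard M.
Proof.
case: eq_mn => eq_row eq_col; case: _ / eq_row eq_col => eq_col.
by rewrite (eq_irrelevance eq_col (erefl m)) castmx_id.
Qed.

End prime_power_ring.

(** * Uniform and balanced laws *)

Lemma card_upper_index_double n : (2 * #|upper_index n| = n.+1 * n)%N.
Proof.
have := sum_upper_index_ends (fun _ : 'I_n => 1%N).
by rewrite !sum_nat_const card_ord muln1 mulnC.
Qed.

Lemma card_upper_index_add r m :
  #|upper_index (r + m)| = (#|upper_index r| + r * m + #|upper_index m|)%N.
Proof.
have := card_upper_index_double (r + m); have := card_upper_index_double r.
by have := card_upper_index_double m; lia.
Qed.

Section uniform_law.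
Variables (R : realType) (T : finType) (n : nat).

Definition uniform_law (u : upper_index n) (x : T) : R := #|T|%:R^-1.

Lemma uniform_is_law : (0 < #|T|)%N -> is_law uniform_law.
Proof.
move=> T_gt0; split=> u *; first by rewrite invr_ge0.
by rewrite sumr_constE mulfV// pnatr_eq0 -lt0n.
Qed.

Lemma meanE (h : 'M[T]_n -> R) :
  expect uniform_law h = #|T|%:R ^- #|upper_index n| * \sum_(M | M^T == M) h M.
Proof.
rewrite big_sym_mx mulr_sumr; apply: eq_bigr => a _.
by rewrite /uniform_law prodr_const exprVn.
Qed.

End uniform_law.

Notation mean := (expect (@uniform_law _ _ _)).

Section uniform_mean.
Variables (R : realType) (T : finComUnitRingType).

Lemma mean_congr n (U : 'M[T]_n) (h : 'M[T]_n -> R) : U \in unitmx ->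
  mean h = mean (fun M => h (U *m M *m U^T)).
Proof.
move=> U_unit; have UT_unit : U^T \in unitmx by rewrite unitmx_tr.
have congr_inj : injective (fun M => U *m M *m U^T).
  by move=> M N /(can_inj (mulmxK UT_unit)) /(can_inj (mulKmx U_unit)).
rewrite !meanE (reindex_inj congr_inj); congr (_ * _); apply: eq_bigl => M.
by rewrite !trmx_mul trmxK mulmxA (inj_eq congr_inj).
Qed.

Lemma mean_shift n (N : 'M[T]_n) (h : 'M[T]_n -> R) : N^T = N ->
  mean h = mean (fun M => h (M + N)).
Proof.
move=> symN; rewrite !meanE (reindex_inj (addIr N)); congr (_ * _); apply: eq_bigl => M.
by rewrite linearD /= symN (inj_eq (addIr N)).
Qed.

Lemma sum_sym_block r m (h : 'M[T]_(r + m) -> R) : \sum_(M | M^T == M) h M =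
  \sum_(A : 'M[T]_r | A^T == A) \sum_(B : 'M[T]_(r, m))
    \sum_(D : 'M[T]_m | D^T == D) h (block_mx A B B^T D).
Proof.
pose assemble (t : 'M[T]_r * ('M[T]_(r, m) * 'M[T]_m)) : 'M[T]_(r + m) :=
  block_mx t.1 t.2.1 t.2.1^T t.2.2.
pose blocks (M : 'M[T]_(r + m)) := (ulsubmx M, (ursubmx M, drsubmx M)).
transitivity (\sum_(A : 'M[T]_r | A^T == A)
   \sum_(t : 'M[T]_(r, m) * 'M[T]_m | t.2^T == t.2) h (assemble (A, t))); last first.
  apply: eq_bigr => A _; rewrite (pair_big predT (fun D : 'M[T]_m => D^T == D)
    (fun B D => h (block_mx A B B^T D))) /=.
  by apply: eq_bigl => -[B D].
rewrite (pair_big (fun A : 'M[T]_r => A^T == A)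
   (fun t : 'M[T]_(r, m) * 'M[T]_m => t.2^T == t.2) (fun A t => h (assemble (A, t)))) /=.
rewrite (reindex_onto assemble blocks) /=.
  apply: eq_big => [[A [B D]]|[A [B D]] _] //=.
  rewrite /blocks /assemble /= block_mxKul block_mxKur block_mxKdr eqxx andbT.
  rewrite tr_block_mx trmxK; apply/eqP/andP => [/eq_block_mx[-> _ _ ->]//|].
  by move=> [/eqP -> /eqP ->].
move=> M /eqP symM; rewrite /assemble /blocks /= -[RHS]submxK; congr block_mx.
by rewrite trmx_ursub symM.
Qed.

Lemma mean_block r m (h : 'M[T]_(r + m) -> R) :
  mean h = #|T|%:R ^- (#|upper_index r| + r * m) *
    \sum_(A : 'M[T]_r | A^T == A) \sum_(B : 'M[T]_(r, m))
      mean (fun D => h (block_mx A B B^T D)).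
Proof.
rewrite meanE sum_sym_block card_upper_index_add exprD invfM -mulrA; congr (_ * _).
rewrite mulr_sumr; apply: eq_bigr => A _; rewrite mulr_sumr; apply: eq_bigr => B _.
by rewrite meanE.
Qed.

End uniform_mean.

Section fourier_of_balanced.
Variables (R : realType) (p l : nat).
Hypothesis p_pr : prime p.
Local Notation q := (p ^ l.+1)%N.
Local Notation q_gt1 := (prime_power_gt1 l p_pr).
Local Notation red := (red l p_pr).
Local Notation chi := (chi R q_gt1).

Definition balanced (alpha : R) n (w : upper_index n -> 'Z_q -> R) : Prop :=
  forall u (a : 'F_p), \sum_(x | red x == a) w u x <= 1 - alpha.

Lemma balancedW (alpha beta : R) n (w : upper_index n -> 'Z_q -> R) :
  beta <= alpha -> balanced alpha w -> balanced beta w.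
Proof.
by move=> beta_le w_bal u a; apply: le_trans (w_bal u a) _; rewrite lerD2l lerN2.
Qed.

Lemma card_red_fiber (a : 'F_p) : #|[pred x : 'Z_q | red x == a]| = (p ^ l)%N.
Proof.
have red_surj b : exists x, red x = b by exists (lift l b); rewrite liftK.
apply/eqP; rewrite -(eqn_pmul2r (prime_gt0 p_pr)) -expnSr; apply/eqP.
by have := card_surj_fiber a red_surj; rewrite card_Fp// card_Zq// q_gt1.
Qed.

Lemma uniform_balanced n : balanced (2^-1 : R) (@uniform_law R 'Z_q n).
Proof.
move=> u a; rewrite sumr_constE card_red_fiber /uniform_law (card_Zq q_gt1) expnSr natrM.
have p_ge2 : 2 <= p%:R :> R by rewrite ler_nat prime_gt1.
rewrite invfM mulrA mulfV ?mul1r ?pnatr_eq0 -?lt0n ?expn_gt0 ?prime_gt0//.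
apply: le_trans (_ : 2^-1 <= _); last by lra.
by rewrite lef_pV2 ?posrE//; lra.
Qed.

Lemma Re_chi_lt1 (t : 'Z_q) : t != 0 -> complex.Re (chi t) < 1.
Proof.
rewrite -(chi_eq1 R q_gt1).
have : (complex.Re (chi t)) ^+ 2 + (complex.Im (chi t)) ^+ 2 = 1.
  by apply: complexI; rewrite add_Re2_Im2 norm_chi expr1n.
case: (chi t) => x y /=; rewrite eq_complex /= => xy1; rewrite ltNge.
apply: contra => x_ge1; have y2_ge0 : 0 <= y ^+ 2 by rewrite sqr_ge0.
have x1 : x = 1 by nra.
by move: xy1; rewrite x1 expr1n => /eqP; rewrite -subr_eq0 addrAC subrr add0r sqrf_eq0 eqxx.
Qed.

Lemma chi_gap : exists2 kappa : R, 0 < kappa <= 1 &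
  forall t : 'Z_q, t != 0 -> complex.Re (chi t) <= 1 - kappa.
Proof.
exists (\big[Num.min/1]_(t : 'Z_q | t != 0) (1 - complex.Re (chi t))).
  rewrite bigmin_le_id andbT; apply: (big_ind (fun x => 0 < x)) => //= [x y x0 y0|t t0].
    by rewrite lt_min x0.
  by rewrite subr_gt0 Re_chi_lt1.
by move=> t t0; rewrite lerBrDl -lerBrDr; exact: bigmin_le_cond.
Qed.

Lemma normsq_fourier n (w : upper_index n -> 'Z_q -> R) u t :
  `|fourier q_gt1 w u t| ^+ 2 =
  (\sum_y \sum_x w u x * w u y * complex.Re (chi ((x - y) * t)))%:C%C.
Proof.
have Re_sum (I : finType) (F : I -> R[i]) :
    complex.Re (\sum_i F i) = \sum_i complex.Re (F i).
  by apply: (big_morph (@complex.Re R)) => // -[a b] [c d].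
set f := fourier q_gt1 w u t.
have -> : `|f| ^+ 2 = (complex.Re (f * f^*))%:C%C.
  by rewrite -normCK RRe_real// realX// normr_real.
congr (_%:C%C).
have -> : f * f^* = \sum_y \sum_x (w u x * w u y)%:C%C * chi ((x - y) * t).
  rewrite /f /fourier rmorph_sum /= mulr_sumr; apply: eq_bigr => y _.
  rewrite mulr_suml; apply: eq_bigr => x _.
  rewrite rmorphM /= conj_chi mulrBl chiD rmorphM /= conj_Creal; last first.
    by apply/complex_realP; exists (w u y).
  by rewrite mulrACA.
rewrite Re_sum; apply: eq_bigr => y _; rewrite Re_sum; apply: eq_bigr => x _.
by case: (chi _) => a b /=; rewrite mul0r subr0.
Qed.

Lemma balanced_mass_le (alpha : R) n (w : upper_index n -> 'Z_q -> R) u y t :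
  is_law w -> balanced alpha w -> t != 0 ->
  alpha <= \sum_(x | (x - y) * t != 0) w u x.
Proof.
move=> [w_ge0 w_sum1] w_bal t_neq0.
have : \sum_(x | ~~ ((x - y) * t != 0)) w u x <= 1 - alpha.
  apply: le_trans (w_bal u (red y)).
  rewrite [leRHS](bigID (fun x => ~~ ((x - y) * t != 0))) /=.
  rewrite -[leLHS]addr0; apply: lerD; last exact: sumr_ge0.
  rewrite [leRHS](eq_bigl (fun x => ~~ ((x - y) * t != 0)))// => x.
  rewrite andb_idl// negbK => /eqP xy0; rewrite -subr_eq0 -rmorphB.
  apply: contraNT t_neq0; rewrite -red_unit => xy_unit.
  by apply/eqP/(mulrI xy_unit); rewrite xy0 mulr0.
by have := w_sum1 u; rewrite (bigID (fun x => (x - y) * t != 0)) /=; lra.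
Qed.

Lemma balanced_normsq_fourier_le (alpha kappa : R) n (w : upper_index n -> 'Z_q -> R) u t :
  is_law w -> balanced alpha w -> t != 0 -> 0 <= kappa ->
  (forall t' : 'Z_q, t' != 0 -> complex.Re (chi t') <= 1 - kappa) ->
  `|fourier q_gt1 w u t| ^+ 2 <= (1 - kappa * alpha)%:C%C.
Proof.
move=> w_law w_bal t_neq0 kappa_ge0 gap; have [w_ge0 w_sum1] := w_law.
rewrite normsq_fourier lecR.
have -> : 1 - kappa * alpha = \sum_y w u y * (1 - kappa * alpha).
  by rewrite -mulr_suml w_sum1 mul1r.
apply: ler_sum => y _.
apply: le_trans (_ : \sum_x (w u x * w u y -
  (if (x - y) * t != 0 then kappa * (w u x * w u y) else 0)) <= _).
  apply: ler_sum => x _; have ww_ge0 : 0 <= w u x * w u y by rewrite mulr_ge0.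
  case: ifP => [xy|/negbFE/eqP ->]; last by rewrite chi0 /= mulr1 subr0.
  by apply: le_trans (ler_wpM2l ww_ge0 (gap _ xy)) _; rewrite mulrBr mulr1 [kappa * _]mulrC.
rewrite sumrB -mulr_suml w_sum1 mul1r mulrBr mulr1 lerD2l lerN2 -big_mkcond /=.
rewrite -mulr_sumr -mulr_suml mulrCA; apply: ler_wpM2l => //.
by rewrite mulrC; apply: ler_wpM2r => //; exact: balanced_mass_le.
Qed.

Lemma balanced_fourier_le (alpha : R) : 0 < alpha <= 1 ->
  exists2 rho : R, 0 < rho < 1 & forall n (w : upper_index n -> 'Z_q -> R),
    is_law w -> balanced alpha w -> fourier_le q_gt1 rho w.
Proof.
move=> /andP[alpha_gt0 alpha_le1]; have [kappa /andP[kappa_gt0 kappa_le1] gap] := chi_gap.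
have ka_gt0 : 0 < kappa * alpha by rewrite mulr_gt0.
have ka_le1 : kappa * alpha <= 1 by rewrite -[leRHS]mulr1 ler_pM// ltW.
exists (1 - kappa * alpha / 2); first by lra.
move=> n w w_law w_bal u t t_neq0; have rho_ge0 : 0 <= 1 - kappa * alpha / 2 by lra.
rewrite -ler_sqr ?nnegrE ?normr_ge0 ?ler0c//.
apply: le_trans (balanced_normsq_fourier_le u w_law w_bal t_neq0 (ltW kappa_gt0) gap) _.
by rewrite -rmorphXn lecR; nra.
Qed.

Theorem balanced_universality r (Q : congruence_system q r) (alpha : R)
    (w : forall n, upper_index n -> 'Z_q -> R) (c : forall n, 'M['Z_q]_(r, n) -> R) :
  0 < alpha -> (forall n, is_law (w n)) -> (forall n, balanced alpha (w n)) ->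
  (forall n Y, `|c n Y| <= 1) ->
  (expect (w n) (weighted_solutions Q (c n)) - mean (weighted_solutions Q (c n))) /
    (annihilator_count Q)%:R ^+ n @[n --> \oo] --> 0.
Proof.
move=> alpha_gt0 w_law w_bal c_le1; pose beta := Num.min alpha 2^-1.
have beta01 : 0 < beta <= 1.
  by rewrite lt_min alpha_gt0 invr_gt0 ltr0n /= ge_min orbC invf_le1 ?ler1n.
have [rho rho01 fourier_bound] := balanced_fourier_le beta01.
have unif_law n : is_law (@uniform_law R 'Z_q n).
  by apply: uniform_is_law; apply/card_gt0P; exists 0.
have w_le n : fourier_le q_gt1 rho (w n).
  by apply: fourier_bound => //; apply: balancedW (w_bal n); rewrite ge_min lexx.
have unif_le n : fourier_le q_gt1 rho (@uniform_law R 'Z_q n).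
  apply: fourier_bound => //; apply: balancedW (@uniform_balanced n).
  by rewrite ge_min lexx orbT.
exact: universality rho01 w_law unif_law w_le unif_le c_le1.
Qed.

End fourier_of_balanced.

(** * The kernel modulo p of a uniform symmetric matrix *)

Section kernel_of_uniform.
Variables (R : realType) (p l : nat).
Hypothesis p_pr : prime p.
Local Notation q := (p ^ l.+1)%N.
Local Notation q_gt1 := (prime_power_gt1 l p_pr).
Local Notation red := (red l p_pr).
Local Notation kercard := (kercard (l := l) p_pr).
Implicit Types (g : nat -> R).

Definition mean_ker n g : R := mean (fun M : 'M['Z_q]_n => g (kercard M)).

Let natr_p_gt0 : 0 < p%:R :> R. Proof. by rewrite ltr0n prime_gt0. Qed.
Let natr_p_neq0 : p%:R != 0 :> R. Proof. by rewrite gt_eqF. Qed.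

Lemma mx1_sym (T : Type) (A : 'M[T]_1) : A^T = A.
Proof. by apply/matrixP => i j; rewrite mxE !ord1. Qed.

Lemma mean_ker_ge0 n g : (forall k, 0 <= g k) -> 0 <= mean_ker n g.
Proof.
by move=> g_ge0; rewrite /mean_ker meanE mulr_ge0 ?sumr_ge0.
Qed.

Lemma mean_kerZ n (c : R) g : mean_ker n (fun k => c * g k) = c * mean_ker n g.
Proof. exact: expectZ. Qed.

Lemma eq_mean_ker n g g' : (forall k, (0 < k)%N -> g k = g' k) ->
  mean_ker n g = mean_ker n g'.
Proof. by move=> eq_g; apply: eq_expect => M _; apply: eq_g; exact: kercard_gt0. Qed.

Lemma mean_ker_unit_corner r m g (A : 'M['Z_q]_r) (B : 'M['Z_q]_(r, m)) :
  A^T = A -> A \in unitmx ->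
  mean (fun D => g (kercard (block_mx A B B^T D))) = mean_ker m g.
Proof.
move=> symA A_unit; pose N := B^T *m invmx A *m B.
have symN : N^T = N by rewrite /N !trmx_mul trmxK trmx_inv symA mulmxA.
by rewrite (mean_shift _ symN); apply: eq_expect => D _; rewrite kercard_unit_corner.
Qed.

(* The 2 x 2 corner (a 1; 1 b) of the matrix is invertible modulo p. *)
Lemma mean_ker_standard_row m g (a b : 'M['Z_q]_1) (w : 'M['Z_q]_(1, m)) :
  map_mx red a = 0 ->
  mean (fun D => g (kercard (block_mx a (row_mx 1%:M 0) (row_mx 1%:M 0)^T
    (block_mx b w w^T D)))) = mean_ker m g.
Proof.
move=> a0; pose A : 'M['Z_q]_(1 + 1) := block_mx a 1%:M 1%:M b.
have symA : A^T = A by rewrite /A tr_block_mx !trmx1 !mx1_sym.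
have A_unit : A \in unitmx.
  rewrite (unitmx_red p_pr) map_block_mx a0 !map_mx1.
  suff /mulmx1_unit[] : block_mx 0 1%:M 1%:M (map_mx red b) *m
      block_mx (- map_mx red b) 1%:M 1%:M 0 = 1%:M by [].
  rewrite mulmx_block !mul0mx !mulmx0 !mul1mx !mulmx1 !addr0 !add0r addNr.
  by rewrite -scalar_mx_block.
rewrite -(mean_ker_unit_corner g (col_mx 0 w) symA A_unit); apply: eq_expect => D _.
by rewrite tr_row_mx trmx1 trmx0 block_mxA kercard_castmx tr_col_mx trmx0.
Qed.

Lemma mean_ker_nonzero_row m g (a : 'M['Z_q]_1) (v : 'M['Z_q]_(1, 1 + m)) :
  map_mx red a = 0 -> map_mx red v != 0 ->
  mean (fun D => g (kercard (block_mx a v v^T D))) = mean_ker m g.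
Proof.
move=> a0 v_neq0.
have [|U U_unit vU] := unimodular_completion (r := 1) (m := m) (Y := v) (p_pr := p_pr).
  by rewrite /row_free eqn_leq rank_leq_row lt0n mxrank_eq0.
have V_unit : (invmx U)^T \in unitmx by rewrite unitmx_tr unitmx_inv.
rewrite (mean_congr _ V_unit).
transitivity (mean (fun D : 'M['Z_q]_(1 + m) =>
    g (kercard (block_mx a (row_mx 1%:M 0) (row_mx 1%:M 0)^T D)))).
  apply: eq_expect => D _; pose P : 'M['Z_q]_(1 + (1 + m)) := block_mx 1%:M 0 0 U^T.
  have P_unit : P \in unitmx.
    by rewrite unitmxE det_ublock det1 mul1r -unitmxE unitmx_tr.
  rewrite -[in LHS](kercard_congr p_pr _ P_unit); congr (g (kercard _)).
  rewrite /P tr_block_mx !trmx1 !trmx0 trmxK.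
  rewrite !mulmx_block !mul1mx !mulmx1 !mul0mx !mulmx0 !addr0 !add0r.
  rewrite vU -trmx_mul vU trmxK -!mulmxA mulVmx// mulmx1 mulmxA -trmx_mul mulVmx//.
  by rewrite trmx1 mul1mx.
rewrite (mean_block (r := 1)) (card_Zq q_gt1).
under eq_bigr => b _ do under eq_bigr => w _ do rewrite mean_ker_standard_row//.
rewrite (eq_bigl predT) => [|b]; last by rewrite mx1_sym eqxx.
rewrite !sumr_constE !(card_mx_Zq l p_pr) [X in _ * X]mulrA -natrM -expnD.
have -> : #|upper_index 1| = 1%N by have := card_upper_index_double 1; lia.
by rewrite -natrX !mul1n mulKf// pnatr_eq0 -lt0n !expn_gt0 prime_gt0.
Qed.

Lemma unitmx1 (a : 'M['Z_q]_1) : (a \in unitmx) = (map_mx red a != 0).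
Proof.
rewrite (unitmx_red p_pr) unitmxE det_mx11 unitfE; congr (~~ _).
apply/eqP/eqP => [a0|->]; last by rewrite mxE.
by apply/matrixP => i j; rewrite !ord1 a0 mxE.
Qed.

Lemma card_mx1_nonunit : #|[pred a : 'M['Z_q]_1 | a \notin unitmx]| = (p ^ l)%N.
Proof.
have := card_map_red_fiber l p_pr (0 : 'rV_1); rewrite !muln1 => <-.
by apply: eq_card => a; rewrite !inE unitmx1 negbK.
Qed.

Lemma card_mx1_unit : #|[pred a : 'M['Z_q]_1 | a \in unitmx]| = (q - p ^ l)%N.
Proof.
have nonunitE : #|[predC [pred a : 'M['Z_q]_1 | a \in unitmx]]| = (p ^ l)%N.
  by rewrite -card_mx1_nonunit; apply: eq_card => a; rewrite !inE.
have := cardC [pred a : 'M['Z_q]_1 | a \in unitmx].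
rewrite (card_mx_Zq l p_pr) muln1 expn1 nonunitE => total.
by rewrite -[LHS](addnK (p ^ l)) total.
Qed.

Lemma card_nonzero_rows m : #|[pred v : 'M['Z_q]_(1, m) | map_mx red v != 0]| =
  (q ^ m - p ^ (l * m))%N.
Proof.
have := card_map_red_fiber l p_pr (0 : 'rV_m); rewrite mul1n => <-.
have := card_mx_Zq l p_pr 1 m; rewrite mul1n => <-.
rewrite -(cardC [pred v : 'M['Z_q]_(1, m) | map_mx red v == 0]) addKn.
by apply: eq_card => v; rewrite !inE.
Qed.

Lemma mean_ker_split m g : mean_ker (1 + m) g = q%:R ^- (1 + m) *
  ((q - p ^ l)%:R * (q ^ m)%:R * mean_ker m g +
   \sum_(a : 'M['Z_q]_1 | a \notin unitmx)
     ((p ^ (l * m))%:R * mean_ker m (fun k => g (p * k)%N) +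
      \sum_(v : 'M['Z_q]_(1, m) | map_mx red v != 0)
        mean (fun D => g (kercard (block_mx a v v^T D))))).
Proof.
rewrite /mean_ker mean_block (card_Zq q_gt1) (_ : (_ + _ = 1 + m)%N); last first.
  by rewrite mul1n; congr addn; have := card_upper_index_double 1; lia.
rewrite (eq_bigl predT) => [|a]; last by rewrite mx1_sym eqxx.
congr (_ * _); rewrite (bigID (fun a : 'M['Z_q]_1 => a \in unitmx)) /=; congr (_ + _).
  under eq_bigr => a a_unit do
    under eq_bigr => v _ do rewrite (mean_ker_unit_corner _ _ (mx1_sym a) a_unit).
  under eq_bigr do rewrite sumr_constE (card_mx_Zq l p_pr) mul1n.
  by rewrite sumr_constE card_mx1_unit mulrA.
apply: eq_bigr => a; rewrite unitmx1 negbK => /eqP a0.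
rewrite (bigID (fun v : 'M['Z_q]_(1, m) => map_mx red v == 0)) /=; congr (_ + _).
rewrite (eq_bigr (fun _ => mean_ker m (fun k => g (p * k)%N))) => [|v /eqP v0].
  by rewrite sumr_constE (card_map_red_fiber l p_pr) mul1n.
by apply: eq_expect => D _; rewrite kercard_red0// expn1.
Qed.

Lemma mean_ker0 g : mean_ker 0 g = g 1%N.
Proof.
have unit0 (M : 'M['Z_q]_0) : M \in unitmx by rewrite unitmxE det_mx00 unitr1.
have unif_law : is_law (@uniform_law R 'Z_q 0).
  by apply: uniform_is_law; apply/card_gt0P; exists 0.
rewrite /mean_ker (eq_expect _ (h' := fun=> g 1%N)) => [|M _]; first exact: expect_cst.
by rewrite kercard_unit.
Qed.

Lemma mean_ker1 g : mean_ker 1 g = (1 - p%:R^-1) * g 1%N + p%:R^-1 * g p.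
Proof.
rewrite (mean_ker_split 0) !mean_ker0 (eq_bigr (fun=> g p)) => [|a _]; last first.
  rewrite muln0 expn0 mul1r muln1 big_pred0 ?addr0// => v.
  by apply/negbF/eqP; exact: thinmx0.
rewrite sumr_constE card_mx1_nonunit natrB ?leq_exp2l ?prime_gt1//.
rewrite expn0 mulr1 addn0 expr1 !natrX exprS.
have pl_neq0 : (p%:R : R) ^+ l != 0 by rewrite expf_neq0.
by field; rewrite pl_neq0 natr_p_neq0.
Qed.

Lemma mean_ker_rec m g : mean_ker m.+2 g =
  (1 - p%:R^-1) * mean_ker m.+1 g +
  p%:R ^- m.+2 * mean_ker m.+1 (fun k => g (p * k)%N) +
  p%:R^-1 * (1 - p%:R ^- m.+1) * mean_ker m g.
Proof.
rewrite -[m.+2]/(1 + (1 + m))%N mean_ker_split.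
rewrite (eq_bigr (fun=> (p ^ (l * (1 + m)))%:R * mean_ker (1 + m) (fun k => g (p * k)%N) +
    (q ^ (1 + m) - p ^ (l * (1 + m)))%:R * mean_ker m g)) => [|a]; last first.
  rewrite unitmx1 negbK => /eqP a0; congr (_ + _); rewrite -card_nonzero_rows -sumr_constE.
  by apply: eq_bigr => v v_neq0; exact: mean_ker_nonzero_row.
rewrite sumr_constE card_mx1_nonunit !natrB; last 2 first.
- by rewrite -expnM leq_exp2l ?prime_gt1// leq_mul2r leqnSn orbT.
- by rewrite leq_exp2l ?prime_gt1.
have pl_neq0 : (p%:R : R) ^+ l != 0 by rewrite expf_neq0.
have plm_neq0 : ((p%:R : R) ^+ l) ^+ m != 0 by rewrite expf_neq0.
have pm_neq0 : (p%:R : R) ^+ m != 0 by rewrite expf_neq0.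
rewrite !add1n !natrX [p%:R ^+ l.+1]exprS ![(p%:R * p%:R ^+ l) ^+ _]exprMn mulnS exprD exprM.
rewrite ![_ ^+ m.+2]exprS ![_ ^+ m.+1]exprS.
by field; rewrite ?pl_neq0 ?plm_neq0 ?pm_neq0 ?natr_p_neq0.
Qed.

Definition odd_power_partial m : R :=
  \prod_(1 <= k < m.+1) (1 - p%:R ^ (1 - 2 * k%:Z)).

Lemma odd_power_partial0 : odd_power_partial 0 = 1.
Proof. by rewrite /odd_power_partial big_geq. Qed.

Lemma odd_power_partialS m :
  odd_power_partial m.+1 = odd_power_partial m * (1 - p%:R ^- m.*2.+1).
Proof.
rewrite /odd_power_partial big_nat_recr//=; congr (_ * (1 - _)).
have -> : 1 - 2 * m.+1%:Z = - (m.*2.+1)%:Z by lia.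
by rewrite -exprnN.
Qed.

Lemma mean_ker_nonsingular n :
  mean_ker n (fun k => (k == 1)%N%:R) = odd_power_partial (uphalf n).
Proof.
pose s n : R := mean_ker n (fun k => (k == 1)%N%:R); rewrite -[LHS]/(s n).
have mul_p_neq1 m : mean_ker m (fun k => (p * k == 1)%N%:R) = 0.
  rewrite (@eq_mean_ker m _ (fun k => 0 * 0)) ?mean_kerZ ?mul0r// => k _.
  by rewrite muln_eq1 gtn_eqF ?prime_gt1// mulr0.
have s_rec m : s m.+2 = (1 - p%:R^-1) * s m.+1 + p%:R^-1 * (1 - p%:R ^- m.+1) * s m.
  by rewrite /s mean_ker_rec mul_p_neq1 mulr0 addr0.
have s0 : s 0%N = 1 by rewrite /s mean_ker0 eqxx.
have s1 : s 1%N = 1 - p%:R^-1.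
  by rewrite /s mean_ker1 eqxx mulr1 gtn_eqF ?prime_gt1// mulr0 addr0.
suff s_pair m : s m.*2 = odd_power_partial m /\ s m.*2.+1 = odd_power_partial m.+1.
  have [s_even s_odd] := s_pair n./2; rewrite -[n in LHS]odd_double_half uphalf_half.
  by case: (odd n); rewrite ?add0n ?add1n.
elim: m => [|m [IHeven IHodd]].
  by rewrite odd_power_partialS odd_power_partial0 s0 s1 mul1r expr1.
have s_even : s m.+1.*2 = odd_power_partial m.+1.
  by rewrite doubleS s_rec IHeven IHodd !odd_power_partialS; field; rewrite expf_neq0.
split=> //; rewrite doubleS s_rec -doubleS s_even IHodd [RHS]odd_power_partialS.
rewrite doubleS ![p%:R ^+ _.+3]exprS ![p%:R ^+ _.+2]exprS; field.
by rewrite !expf_neq0 ?natr_p_neq0.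
Qed.

Let natr_p_ge1 : 1 <= p%:R :> R. Proof. by rewrite ler1n prime_gt0. Qed.

Definition moment_product k n : R := \prod_(1 <= i < n.+1) (1 + p%:R ^+ k / p%:R ^+ i).

Lemma moment_productS k n :
  moment_product k n.+1 = moment_product k n * (1 + p%:R ^+ k / p%:R ^+ n.+1).
Proof. by rewrite /moment_product big_nat_recr. Qed.

Lemma moment_product_ge0 k n : 0 <= moment_product k n.
Proof. by apply: prodr_ge0 => i _; rewrite addr_ge0// divr_ge0. Qed.

Lemma moment_product_leS k n : moment_product k n <= moment_product k n.+1.
Proof.
by rewrite moment_productS ler_peMr ?moment_product_ge0// lerDl divr_ge0.
Qed.

Lemma mean_ker_moment_le k n : mean_ker n (fun t => t%:R ^+ k) <= moment_product k n.
Proof.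
have pV_le1 : (p%:R : R)^-1 <= 1 by rewrite invf_le1.
suff both m : mean_ker m (fun t => t%:R ^+ k) <= moment_product k m /\
    mean_ker m.+1 (fun t => t%:R ^+ k) <= moment_product k m.+1 by case: (both n).
elim: m => [|m [IHm IHm1]]; first split.
- by rewrite mean_ker0 /moment_product big_geq// expr1n.
- rewrite moment_productS /moment_product big_geq// mul1r mean_ker1 expr1n mulr1 expr1.
  by rewrite [p%:R ^+ k / p%:R]mulrC lerD2r lerBlDr lerDl invr_ge0 ltW.
split=> //; rewrite mean_ker_rec moment_productS.
have -> : mean_ker m.+1 (fun t => (p * t)%N%:R ^+ k) =
    p%:R ^+ k * mean_ker m.+1 (fun t => t%:R ^+ k).
  by rewrite -mean_kerZ; apply: eq_mean_ker => t _; rewrite natrM exprMn.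
set x := mean_ker m.+1 _ in IHm1 *; set y := mean_ker m _ in IHm *.
set b := moment_product k m.+1 in IHm1 *.
have term1 : (1 - p%:R^-1) * x <= (1 - p%:R^-1) * b by rewrite ler_wpM2l// subr_ge0.
have term2 : p%:R ^- m.+2 * (p%:R ^+ k * x) <= p%:R ^- m.+2 * (p%:R ^+ k * b).
  by rewrite !ler_wpM2l ?invr_ge0.
have term3 : p%:R^-1 * (1 - p%:R ^- m.+1) * y <= p%:R^-1 * b.
  rewrite -mulrA ler_wpM2l ?invr_ge0//.
  have y_ge0 : 0 <= y by apply: mean_ker_ge0 => t; rewrite exprn_ge0.
  apply: le_trans (le_trans IHm (moment_product_leS k m)).
  by rewrite ler_piMl// lerBlDr lerDl invr_ge0.
apply: le_trans (lerD (lerD term1 term2) term3) _.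
by rewrite le_eqVlt; apply/orP; left; apply/eqP; ring.
Qed.

Lemma prod_1Dexpr_inv_le n : \prod_(1 <= i < n.+1) (1 + (p%:R ^+ i)^-1) <= 3 :> R.
Proof.
have le_half i : ((p%:R : R) ^+ i)^-1 <= 2^-1 ^+ i.
  rewrite -exprVn; apply: lerXn2r; rewrite ?nnegrE ?invr_ge0//.
  by rewrite lef_pV2 ?posrE// ler_nat prime_gt1.
case: n => [|n]; first by rewrite big_geq//; lra.
suff : \prod_(1 <= i < n.+2) (1 + (p%:R ^+ i)^-1) <= 3 * (1 - 2^-1 ^+ n.+1) :> R.
  move/le_trans; apply; have : 0 <= (2^-1 : R) ^+ n.+1 by rewrite exprn_ge0.
  by lra.
elim: n => [|n IHn]; first by rewrite big_nat1; have := le_half 1%N; rewrite !expr1; lra.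
rewrite big_nat_recr//=.
apply: le_trans (ler_pM _ _ IHn (lerD (lexx 1) (le_half n.+2))) _.
- by rewrite prodr_ge0// => i _; rewrite addr_ge0// invr_ge0.
- by rewrite addr_ge0// invr_ge0.
rewrite [2^-1 ^+ n.+2]exprS; set y := 2^-1 ^+ n.+1.
have y_ge0 : 0 <= y by rewrite exprn_ge0.
have yy_ge0 : 0 <= y * y by rewrite mulr_ge0.
have -> : 3 * (1 - y) * (1 + 2^-1 * y) = 3 * (1 - 2^-1 * y) - 3 * 2^-1 * (y * y).
  by field.
by lra.
Qed.

Lemma moment_product_split k n : moment_product k (k + n) =
  \prod_(0 <= i < k) (1 + p%:R ^+ i) * \prod_(1 <= i < n.+1) (1 + (p%:R ^+ i)^-1).
Proof.
rewrite /moment_product (@big_cat_nat _ _ _ k.+1 1 (k + n).+1)//=; last by rewrite ltnS leq_addr.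
congr (_ * _).
  rewrite big_nat_rev /= big_add1 /=; apply: eq_big_nat => i /andP[_ ik].
  congr (1 + _); set d := (1 + k.+1 - i.+2)%N.
  have {1}-> : (k = i + d)%N by rewrite /d; lia.
  by rewrite exprD mulfK// expf_neq0.
rewrite -[k.+1]add1n -[(k + n).+1]addnS [(k + n.+1)%N]addnC big_addn addnK.
by apply: eq_big_nat => i _; rewrite exprD invfM mulrCA mulfV ?mulr1 // expf_neq0.
Qed.

Lemma mean_ker_moment_bound k n : mean_ker n (fun t => t%:R ^+ k.+1) <=
  6 * \prod_(1 <= i < k.+1) (1 + p%:R ^+ i).
Proof.
have mono : {homo moment_product k.+1 : i j / (i <= j)%N >-> i <= j}.
  by apply: homo_leq => // [x y z|i]; [exact: le_trans|exact: moment_product_leS].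
apply: le_trans (le_trans (mean_ker_moment_le _ _) (mono _ _ (leq_addl k.+1 n))) _.
rewrite moment_product_split big_nat_recl//= expr0 [X in _ <= 6 * X]big_add1 /=.
set z := \prod_(0 <= i < k) _; set t := \prod_(1 <= i < n.+1) _.
have z_ge0 : 0 <= z by apply: prodr_ge0 => i _; rewrite addr_ge0.
have -> : 6 * z = (1 + 1) * z * 3 by ring.
by apply: ler_wpM2l (prod_1Dexpr_inv_le n); rewrite mulr_ge0.
Qed.

End kernel_of_uniform.

(** * Mean number of solutions *)

Section solution_counts.
Variables (R : realType) (p l : nat).
Hypothesis p_pr : prime p.
Local Notation q := (p ^ l.+1)%N.
Local Notation q_gt1 := (prime_power_gt1 l p_pr).
Local Notation red := (red l p_pr).
Local Notation kercard := (kercard (l := l) p_pr).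
Local Notation mean_ker := (mean_ker (R := R) l p_pr).

Let natr_q_neq0 : q%:R != 0 :> R. Proof. by rewrite pnatr_eq0 -lt0n ltnW ?q_gt1. Qed.

Definition full_rank_count r n : nat :=
  #|[pred Y : 'M['Z_q]_(r, n) | row_free (map_mx red Y)]|.

Lemma full_rank_count_le r n : (full_rank_count r n <= q ^ (r * n))%N.
Proof. by rewrite -(card_mx_Zq l p_pr); exact: max_card. Qed.

Definition killed_by r n (v : 'rV['F_p]_r) : {set 'M['Z_q]_(r, n)} :=
  [set Y | v *m map_mx red Y == 0]%SET.

Lemma card_killed_by r n (v : 'rV['F_p]_r) : v != 0 ->
  (#|killed_by n v| * p ^ n = q ^ (r * n))%N.
Proof.
move=> v_neq0; pose f (Y : 'M['Z_q]_(r, n)) : 'rV['F_p]_n := v *m map_mx red Y.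
have f_zmod : zmod_morphism f by move=> Y Y'; rewrite /f map_mxB mulmxBr.
pose fA : {additive _ -> _} := HB.pack f (GRing.isZmodMorphism.Build _ _ f f_zmod).
have f_surj z : exists Y, fA Y = z.
  have /row_freeP[w vw] : row_free v.
    by rewrite /row_free eqn_leq rank_leq_row lt0n mxrank_eq0.
  exists (map_mx (lift l) (w *m z)).
  by rewrite /= /f map_liftK mulmxA vw mul1mx.
have := card_surj_fiber 0 f_surj; rewrite card_mx_Zq// card_mx card_Fp// mul1n => <-.
by congr (_ * _)%N; apply: eq_card => Y; rewrite !inE.
Qed.

(* A matrix which is not of full rank mod p is killed by one of the p^r - 1 nonzero
   vectors. *)
Lemma full_rank_count_ge r n :
  (q ^ (r * n) * p ^ n <= full_rank_count r n * p ^ n + p ^ r * q ^ (r * n))%N.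
Proof.
pose full := [pred Y : 'M['Z_q]_(r, n) | row_free (map_mx red Y)].
have deficient_killed Y : ~~ full Y -> Y \in \bigcup_(v : 'rV['F_p]_r | v != 0) killed_by n v.
  move=> deficient; apply/bigcupP/exists_inP; apply: contraR deficient.
  rewrite negb_exists_in => /forall_inP none; apply: inj_row_free => v v0.
  apply/eqP; apply: contraT => /none.
  by rewrite inE v0 eqxx.
have deficient_le : (#|[predC full]| <= \sum_(v : 'rV['F_p]_r | v != 0%R) #|killed_by n v|)%N.
  apply: (@leq_trans #|\bigcup_(v : 'rV['F_p]_r | v != 0%R) killed_by n v|).
    by apply: subset_leq_card; apply/fintype.subsetP => Y; rewrite inE => /deficient_killed.
  elim/big_rec2: _ => [|v s A _ IH]; first by rewrite cards0.
  by apply: leq_trans (leq_card_setU _ _) _; rewrite leq_add2l.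
rewrite -[X in (X * p ^ n <= _)%N](card_mx_Zq l p_pr) -(cardC full) mulnDl leq_add2l.
apply: leq_trans (leq_mul deficient_le (leqnn _)) _; rewrite big_distrl /=.
rewrite (eq_bigr (fun=> q ^ (r * n))%N) => [|v v_neq0]; last exact: card_killed_by.
rewrite sum_nat_cond_const leq_mul2r; apply/orP; right.
by apply: leq_trans (max_card _) _; rewrite card_mx card_Fp// mul1n.
Qed.

Section fixed_system.
Variables (r : nat) (Q : congruence_system q r).

Let D : 'M['Z_q]_r := diag_mx (\row_s row_weight Q s).

Lemma solvesE n (Y : 'M['Z_q]_(r, n)) M : solves Q Y M =
  (D *m (Y *m M) == 0) &&
  [forall st, gram_weight Q st.1 st.2 *
    ((Y *m M *m Y^T) st.1 st.2 - gram_target Q st.1 st.2) == 0].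
Proof.
rewrite /solves; congr (_ && _); apply/forallP/eqP => [rows0|/matrixP rows0 i].
  apply/matrixP => s i; rewrite mul_diag_mx !mxE.
  by have /forallP/(_ s)/eqP := rows0 i; rewrite !mxE.
by apply/forallP => s; have := rows0 s i; rewrite mul_diag_mx !mxE => ->.
Qed.

Lemma solves_congr n (Y : 'M['Z_q]_(r, n)) (U M : 'M['Z_q]_n) : U \in unitmx ->
  solves Q Y (U *m M *m U^T) = solves Q (Y *m U) M.
Proof.
move=> U_unit; rewrite !solvesE trmx_mul !mulmxA; congr (_ && _).
have UT_unit : U^T \in unitmx by rewrite unitmx_tr.
apply/eqP/eqP => [DYM|->]; last by rewrite mul0mx.
by rewrite -[LHS](mulmxK UT_unit) DYM mul0mx.
Qed.

Lemma solves_block m A (B : 'M['Z_q]_(r, m)) B' D' :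
  solves Q (row_mx 1%:M 0) (block_mx A B B' D') = solves Q 1%:M A && (D *m B == 0).
Proof.
rewrite !solvesE mul_row_block !mul1mx !mul0mx !addr0 tr_row_mx mul_row_col.
rewrite trmx1 trmx0 !mulmx1 mulmx0 addr0 mul_mx_row -row_mx0 andbAC; congr (_ && _).
by apply/eqP/andP => [/eq_row_mx[-> ->]|[/eqP -> /eqP ->]].
Qed.

Definition corner_count : nat := #|[pred A : 'M['Z_q]_r | (A^T == A) && solves Q 1%:M A]|.

Lemma card_mul_diag_eq0 m :
  #|[pred B : 'M['Z_q]_(r, m) | D *m B == 0]| = (annihilator_count Q ^ m)%N.
Proof.
have := @card_mx_family 'Z_q r m (fun s _ => annihilator (row_weight Q s)).
under [RHS]eq_bigr do rewrite prod_nat_const card_ord.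
rewrite -(big_morph (expn^~ m) (fun x y => expnMn x y m) (exp1n m)) => <-.
apply: eq_card => B; rewrite !inE; apply/eqP/forallP => [/matrixP DB0 s|B_ann].
  apply/forallP => i; have := DB0 s i.
  by rewrite mul_diag_mx !mxE inE => /eqP.
apply/matrixP => s i; rewrite mul_diag_mx !mxE.
by have /forallP/(_ i) := B_ann s; rewrite inE => /eqP.
Qed.

Definition row_weights_reduce : Prop := forall s x, row_weight Q s * x = 0 -> red x = 0.

Hypothesis weights_reduce : row_weights_reduce.

Lemma mul_diag_eq0_red m (B : 'M['Z_q]_(r, m)) : D *m B = 0 -> map_mx red B = 0.
Proof.
move=> /matrixP DB0; apply/matrixP => s i; have := DB0 s i.
by rewrite mul_diag_mx !mxE; exact: weights_reduce.
Qed.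

Lemma mean_solves m (Y : 'M['Z_q]_(r, r + m)) (g : nat -> R) : row_free (map_mx red Y) ->
  mean (fun M => (solves Q Y M)%:R * g (kercard M)) =
  q%:R ^- (#|upper_index r| + r * m) * (corner_count%:R * (annihilator_count Q)%:R ^+ m) *
    mean_ker m (fun k => g (p ^ r * k)%N).
Proof.
move=> /unimodular_completion[U U_unit YU]; rewrite (mean_congr _ U_unit).
under eq_expect => M _ do rewrite solves_congr// YU kercard_congr//.
rewrite mean_block (card_Zq q_gt1) -mulrA; congr (_ * _).
transitivity (\sum_(A : 'M['Z_q]_r | A^T == A) (solves Q 1%:M A)%:R *
   \sum_(B : 'M['Z_q]_(r, m)) (D *m B == 0)%:R * mean_ker m (fun k => g (p ^ r * k)%N)).
  apply: eq_bigr => A _; rewrite mulr_sumr; apply: eq_bigr => B _.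
  rewrite mulrA -expectZ; apply: eq_expect => D' _; rewrite solves_block.
  case: (boolP (solves Q 1%:M A)) => [|_]; last by rewrite !mul0r.
  rewrite solvesE mul1mx => /andP[/eqP/mul_diag_eq0_red A0 _].
  case: eqP => [/mul_diag_eq0_red B0|_]; last by rewrite mulr0 !mul0r.
  by rewrite /= mulr1 !mul1r kercard_red0.
have sum_indicator (I : finType) (S S' : pred I) :
    \sum_(i | S i) (S' i)%:R = #|[pred i | S i && S' i]|%:R :> R.
  rewrite -[RHS]mulr1 -sumr_constE [RHS]big_mkcondr; apply: eq_bigr => i _.
  by case: (S' i).
rewrite -mulr_suml sum_indicator -mulrA; congr (_ * _).
by rewrite -mulr_suml sum_indicator card_mul_diag_eq0 natrX.
Qed.

Definition forces_row_free : Prop := forall n (Y : 'M['Z_q]_(r, n)) M,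
  M^T = M -> solves Q Y M -> row_free (map_mx red Y).

Hypothesis solutions_free : forces_row_free.

Lemma mean_solution_count m (g : nat -> R) :
  mean (fun M : 'M['Z_q]_(r + m) => (solution_count Q M)%:R * g (kercard M)) =
  (full_rank_count r (r + m))%:R * (q%:R ^- (#|upper_index r| + r * m) *
    (corner_count%:R * (annihilator_count Q)%:R ^+ m) *
    mean_ker m (fun k => g (p ^ r * k)%N)).
Proof.
transitivity (\sum_Y mean (fun M : 'M['Z_q]_(r + m) =>
    (solves Q Y M)%:R * g (kercard M))).
  rewrite -expect_sum; apply: eq_expect => M _; rewrite -mulr_suml; congr (_ * _).
  by rewrite -weighted_solutions1; apply: eq_bigr => Y _; rewrite mul1r.
rewrite (bigID (fun Y : 'M['Z_q]_(r, r + m) => row_free (map_mx red Y))) /=.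
under eq_bigr => Y Y_free do rewrite mean_solves//.
rewrite sumr_constE [X in _ + X]big1 ?addr0// => Y Y_deficient.
rewrite (eq_expect _ (h' := fun=> 0 * 0)) ?expectZ ?mul0r// => M symM.
case: (boolP (solves Q Y M)) => [/(solutions_free symM)|_]; last by rewrite !mul0r.
by rewrite (negbTE Y_deficient).
Qed.

Definition solution_density : R :=
  (q ^ (r * r) * corner_count)%:R / (q ^ #|upper_index r| * annihilator_count Q ^ r)%:R.

Lemma mean_solution_count_density n (g : nat -> R) : (r <= n)%N ->
  mean (fun M : 'M['Z_q]_n => (solution_count Q M)%:R * g (kercard M)) /
    (annihilator_count Q)%:R ^+ n =
  (full_rank_count r n)%:R / (q ^ (r * n))%:R * solution_density *
    mean_ker (n - r) (fun k => g (p ^ r * k)%N).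
Proof.
move=> r_le_n; rewrite -(subnKC r_le_n) addKn; move: (n - r)%N => m.
rewrite mean_solution_count /solution_density.
have A_neq0 : (annihilator_count Q)%:R != 0 :> R.
  by rewrite pnatr_eq0 -lt0n annihilator_count_gt0.
move: natr_q_neq0; rewrite mulnDr !natrM !natrX !exprD; set b := p%:R ^+ l.+1 => b_neq0.
by field; apply/and5P; split; apply: expf_neq0.
Qed.

End fixed_system.

Section extra_rows.
Variables (r k : nat) (Q : congruence_system q r).

Definition extended_gram (f : 'I_r -> 'I_r -> 'Z_q) (s t : 'I_(r + k)) : 'Z_q :=
  match fintype.split s, fintype.split t with inl a, inl b => f a b | _, _ => 0 end.

(* k further rows, required to lie in the kernel of M modulo p. *)
Definition extend : congruence_system q (r + k) := {|
  row_weight s := match fintype.split s with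
                  | inl a => row_weight Q a
                  | inr _ => (p ^ l)%:R
                  end;
  gram_weight := extended_gram (gram_weight Q);
  gram_target := extended_gram (gram_target Q) |}.

Lemma annihilator_count_extend :
  annihilator_count extend = (annihilator_count Q * (p ^ l) ^ k)%N.
Proof.
rewrite /annihilator_count big_split_ord; congr (_ * _)%N.
  by apply: eq_bigr => s _; rewrite /= (unsplitK (inl s)).
rewrite -[X in (_ = _ ^ X)%N]card_ord -prod_nat_const; apply: eq_bigr => s _.
by rewrite /= (unsplitK (inr s)) card_annihilator_ppower.
Qed.

Lemma red_mulmx_eq0 n (F : 'M['Z_q]_(k, n)) (M : 'M['Z_q]_n) :
  (map_mx red F *m map_mx red M == 0) =
  [forall i, forall j, (p ^ l)%:R * (F *m M) j i == 0].
Proof.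
rewrite -map_mxM; apply/eqP/forallP => [/matrixP FM0 i|FM0].
  by apply/forallP => j; rewrite -red_eq0; have := FM0 j i; rewrite mxE [RHS]mxE => ->.
apply/matrixP => j i; have /forallP/(_ j) := FM0 i.
by rewrite -red_eq0 => /eqP; rewrite !mxE.
Qed.

Lemma solves_extend n (Y : 'M['Z_q]_(r, n)) (F : 'M['Z_q]_(k, n)) M :
  solves extend (col_mx Y F) M = solves Q Y M && (map_mx red F *m map_mx red M == 0).
Proof.
rewrite /solves mul_col_mx tr_col_mx mul_col_row red_mulmx_eq0 [RHS]andbAC.
congr (_ && _).
  apply/forallP/andP => [rows0|[/forallP rowsY /forallP rowsF] i].
    split; apply/forallP => i; apply/forallP => s; have /forallP := rows0 i.
      by move=> /(_ (lshift k s)); rewrite /= (unsplitK (inl s)) col_mxEu.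
    by move=> /(_ (rshift r s)); rewrite /= (unsplitK (inr s)) col_mxEd.
  apply/forallP => s; rewrite -[s]splitK /= unsplitK.
  case: (fintype.split s) => a /=; rewrite ?col_mxEu ?col_mxEd.
    by have /forallP := rowsY i.
  by have /forallP := rowsF i.
apply/forallP/forallP => gram0 [s t] /=.
  have := gram0 (lshift k s, lshift k t); rewrite /= /extended_gram !(unsplitK (inl _)).
  by rewrite block_mxEul.
rewrite -[s]splitK -[t]splitK /extended_gram !unsplitK.
case: (fintype.split s) => a; case: (fintype.split t) => b /=; rewrite ?mul0r//.
by rewrite block_mxEul; exact: (gram0 (a, b)).
Qed.

Lemma card_red_ker n (M : 'M['Z_q]_n) :
  #|[set v : 'rV['Z_q]_n | map_mx red v *m map_mx red M == 0]%SET| =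
  (p ^ (l * n) * kercard M)%N.
Proof.
rewrite -sum1_card (partition_big (fun v : 'rV['Z_q]_n => map_mx red v)
  (mem [set z : 'rV['F_p]_n | z *m map_mx red M == 0]%SET)) /= => [|v]; last by rewrite !inE.
rewrite mulnC -sum_nat_const; apply: eq_bigr => z; rewrite inE => z_ker.
have := card_map_red_fiber l p_pr z; rewrite mul1n sum1_card => <-; apply: eq_card => v.
by rewrite unfold_in !inE andb_idl// => /eqP ->.
Qed.

Lemma card_red_ker_rows n (M : 'M['Z_q]_n) :
  #|[pred F : 'M['Z_q]_(k, n) | map_mx red F *m map_mx red M == 0]| =
  ((p ^ (l * n) * kercard M) ^ k)%N.
Proof.
rewrite -card_red_ker -card_mx_rows; apply: eq_card => F; rewrite !inE.
apply/eqP/forallP => [FM0 j|rows0].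
  by rewrite inE map_row -row_mul FM0 row0.
apply/row_matrixP => j; rewrite row_mul row0 -map_row.
by have := rows0 j; rewrite inE => /eqP.
Qed.

Lemma solution_count_extend n (M : 'M['Z_q]_n) : solution_count extend M =
  (solution_count Q M * (p ^ (l * n) * kercard M) ^ k)%N.
Proof.
pose stack (t : 'M['Z_q]_(r, n) * 'M['Z_q]_(k, n)) := col_mx t.1 t.2.
have stack_inj : injective stack by move=> [Y F] [Y' F'] /eq_col_mx[/= -> ->].
rewrite -card_red_ker_rows -cardX -(card_imset _ stack_inj).
apply: eq_card => Y; rewrite !inE -[Y]vsubmxK solves_extend.
apply/idP/imsetP => [ok|[[Y1 F1] + /eq_col_mx[-> ->]]]; last by rewrite inE.
by exists (usubmx Y, dsubmx Y).
Qed.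

End extra_rows.
End solution_counts.

(** * Limits of expected solution counts *)

Lemma cvg0_of_approximations (R : realType) (x : R^nat) (y : nat -> R^nat) (err : R^nat) :
  (forall j, y j @ \oo --> 0) -> err @ \oo --> 0 ->
  (forall j, \forall n \near \oo, `|x n| <= y j n + err j) -> x @ \oo --> 0.
Proof.
move=> y_cvg0 err_cvg0 x_le; apply/cvgrPdist_le => eps eps_gt0.
have eps2_gt0 : 0 < eps / 2 by rewrite divr_gt0.
have /cvgrPdist_le/(_ _ eps2_gt0)[j _ /(_ j (leqnn j))/= err_small] := err_cvg0.
have /cvgrPdist_le/(_ _ eps2_gt0) := y_cvg0 j.
apply: filterS2 (x_le j) => n xn_le; rewrite !sub0r !normrN => yn_small.
rewrite sub0r normrN in err_small; apply: le_trans xn_le _; rewrite [leRHS](splitr eps).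
by apply: lerD; [apply: le_trans yn_small|apply: le_trans err_small]; exact: ler_norm.
Qed.

Section truncation.
Variables (R : realType) (p r : nat).
Hypothesis p_pr : prime p.

Let P : R := p%:R.
Let P_gt0 : 0 < P. Proof. by rewrite ltr0n prime_gt0. Qed.
Let P_gt1 : 1 < P. Proof. by rewrite ltr1n prime_gt1. Qed.
Let P_neq0 : P != 0. Proof. by rewrite gt_eqF. Qed.
Let expr_P_ge0 k : 0 <= P ^+ k. Proof. by rewrite exprn_ge0// ltW. Qed.

(* Takes the value 1 at p^r, vanishes at p^(r + s) for 1 <= s <= j, and is
   dominated by a high power beyond. *)
Definition trunc_poly j : {poly R} :=
  \prod_(1 <= i < j.+1) ((P ^+ i)%:P - P ^- r *: 'X) *
    ((\prod_(1 <= i < j.+1) (P ^+ i - 1))^-1)%:P.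

Definition trunc_const j : R := (P ^+ j.+1 * \prod_(1 <= i < j.+1) (P ^+ i - 1))^-1.

Lemma trunc_denom_gt0 j : 0 < \prod_(1 <= i < j.+1) (P ^+ i - 1).
Proof.
rewrite big_nat; apply: prodr_gt0 => i /andP[i_gt0 _].
by rewrite subr_gt0 exprn_egt1// -lt0n.
Qed.

Lemma trunc_const_ge0 j : 0 <= trunc_const j.
Proof. by rewrite invr_ge0 mulr_ge0// ltW// trunc_denom_gt0. Qed.

Lemma trunc_polyE j s : (trunc_poly j).[P ^+ (r + s)] =
  \prod_(1 <= i < j.+1) (P ^+ i - P ^+ s) / \prod_(1 <= i < j.+1) (P ^+ i - 1).
Proof.
rewrite /trunc_poly hornerM hornerC horner_prod; congr (_ / _).
by apply: eq_bigr => i _; rewrite !hornerE exprD mulKf// expf_neq0.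
Qed.

Lemma trunc_poly_eq1 j : (trunc_poly j).[P ^+ (r + 0)] = 1.
Proof. by rewrite trunc_polyE expr0 mulfV// gt_eqF// trunc_denom_gt0. Qed.

Lemma trunc_poly_eq0 j s : (0 < s <= j)%N -> (trunc_poly j).[P ^+ (r + s)] = 0.
Proof.
move=> /andP[s_gt0 sj]; rewrite trunc_polyE (big_cat_nat _ (n := s))//=; last by rewrite ltnW.
by rewrite [X in _ * X / _]big_ltn ?ltnS// subrr mul0r mulr0 mul0r.
Qed.

Lemma trunc_poly_le j s : (j < s)%N ->
  `|(trunc_poly j).[P ^+ (r + s)]| <= trunc_const j * (P ^+ s) ^+ j.+1.
Proof.
move=> js; have denom_gt0 := trunc_denom_gt0 j; rewrite trunc_polyE normrM normfV.
rewrite (gtr0_norm denom_gt0) /trunc_const invfM mulrAC ler_wpM2r ?invr_ge0 ?(ltW denom_gt0)//.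
apply: le_trans (_ : (P ^+ s) ^+ j <= _).
  rewrite normr_prod (_ : (P ^+ s) ^+ j = \prod_(1 <= i < j.+1) P ^+ s); last first.
    by rewrite prodr_const_nat subn1.
  rewrite !big_nat; apply: ler_prod => i /andP[_ ij]; rewrite normr_ge0 /=.
  rewrite distrC ger0_norm ?subr_ge0; last by rewrite ler_weXn2l ?(ltW P_gt1)//; lia.
  by rewrite lerBlDr lerDl.
rewrite mulrC ler_pdivlMr ?exprn_gt0// -!exprM -exprD ler_weXn2l ?(ltW P_gt1)//.
by rewrite mulnS addnC leq_add2r.
Qed.

Lemma trunc_poly_approx j s :
  `|(s == 0%N)%:R - (trunc_poly j).[P ^+ (r + s)]| <= trunc_const j * (P ^+ s) ^+ j.+1.
Proof.
have bound_ge0 : 0 <= trunc_const j * (P ^+ s) ^+ j.+1.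
  by rewrite mulr_ge0 ?trunc_const_ge0// exprn_ge0.
have [s0|s_gt0] := posnP s.
  by rewrite {1}s0 trunc_poly_eq1 subrr normr0.
rewrite sub0r normrN; have [sj|js] := leqP s j; last exact: trunc_poly_le.
by rewrite trunc_poly_eq0 ?s_gt0// normr0.
Qed.

Definition trunc_tail j : R := trunc_const j * \prod_(1 <= i < j.+1) (1 + P ^+ i).

Lemma trunc_tail_ge0 j : 0 <= trunc_tail j.
Proof. by rewrite mulr_ge0 ?trunc_const_ge0// prodr_ge0// => i _; rewrite addr_ge0. Qed.

Lemma trunc_tailS j :
  trunc_tail j.+1 = trunc_tail j * ((1 + P ^+ j.+1) / (P * (P ^+ j.+1 - 1))).
Proof.
have denom_neq0 : \prod_(1 <= i < j.+1) (P ^+ i - 1) != 0 by rewrite gt_eqF ?trunc_denom_gt0.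
have expr_neq1 : P ^+ j.+1 - 1 != 0 by rewrite gt_eqF// subr_gt0 exprn_egt1.
have expr_neq0 : P ^+ j.+1 != 0 by rewrite expf_neq0.
rewrite /trunc_tail /trunc_const ![\prod_(1 <= i < j.+2) _]big_nat_recr//= [P ^+ j.+2]exprS.
by field; rewrite P_neq0 denom_neq0 expr_neq0 expr_neq1.
Qed.

Lemma trunc_tail_le j : trunc_tail j.+1 <= (5 / 6) ^+ j.
Proof.
have P_ge2 : 2 <= P by rewrite ler_nat prime_gt1.
elim: j => [|j IHj].
  have tail0 : trunc_tail 0 = P^-1 by rewrite /trunc_tail /trunc_const !big_geq// expr1 !mulr1.
  rewrite trunc_tailS tail0 !expr1 expr0 mulrA ler_pdivrMr ?mulr_gt0 ?subr_gt0// mul1r.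
  by rewrite mulrC ler_pdivrMr//; nra.
rewrite trunc_tailS [leRHS]exprSr; have P2_ge4 : 4 <= P ^+ j.+2.
  have : 2 ^+ j.+2 <= P ^+ j.+2 by apply: lerXn2r; rewrite ?nnegrE ?(ltW P_gt0).
  have : 1 <= (2 : R) ^+ j by rewrite exprn_ege1//; lra.
  by rewrite !exprS mulrA; lra.
apply: ler_pM => //; first exact: trunc_tail_ge0.
  by apply: divr_ge0; [rewrite addr_ge0|rewrite mulr_ge0 ?(ltW P_gt0)//; lra].
rewrite ler_pdivrMr; last by rewrite mulr_gt0// subr_gt0; lra.
apply: le_trans (_ : 5 / 6 * (2 * (P ^+ j.+2 - 1)) <= _); first lra.
by rewrite ler_wpM2l// ler_wpM2r//; lra.
Qed.

Lemma trunc_tail_cvg0 : trunc_tail @ \oo --> 0.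
Proof.
rewrite -cvg_shiftS; apply: (@squeeze_cvgr _ _ _ _ (fun=> 0) (fun j => (5 / 6) ^+ j)).
- by near=> j; rewrite trunc_tail_ge0 trunc_tail_le.
- exact: cvg_cst.
- by apply: cvg_expr; rewrite ger0_norm; lra.
Unshelve. all: by end_near. Qed.

End truncation.

Section limit.
Variables (R : realType) (p l : nat).
Hypothesis p_pr : prime p.
Local Notation q := (p ^ l.+1)%N.
Local Notation red := (red l p_pr).
Local Notation kercard := (kercard (l := l) p_pr).
Variables (r : nat) (Q : congruence_system q r).

Local Notation A := (annihilator_count Q).
Local Notation P := (p%:R : R).

Let P_gt0 : 0 < P. Proof. by rewrite ltr0n prime_gt0. Qed.

Let expr_A_gt0 n : 0 < A%:R ^+ n :> R.
Proof. by rewrite exprn_gt0// ltr0n annihilator_count_gt0. Qed.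

Definition weighted_count (g : nat -> R) n (M : 'M['Z_q]_n) : R :=
  (solution_count Q M)%:R * g (kercard M).

Section deviation.
Variables (alpha : R) (w : forall n, upper_index n -> 'Z_q -> R).
Arguments w : clear implicits.
Hypotheses (alpha_gt0 : 0 < alpha) (w_law : forall n, is_law (w n)).
Hypothesis w_bal : forall n, balanced p_pr alpha (w n).

Definition deviation (g : nat -> R) n : R :=
  (expect (w n) (weighted_count g (n:=n)) - mean (weighted_count g (n:=n))) / A%:R ^+ n.

Lemma deviation_sum (I : finType) (c : I -> R) (g : I -> nat -> R) n :
  deviation (fun k => \sum_i c i * g i k) n = \sum_i c i * deviation (g i) n.
Proof.
have lin (v : upper_index n -> 'Z_q -> R) :
    expect v (weighted_count (fun k => \sum_i c i * g i k) (n:=n)) =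
    \sum_i c i * expect v (weighted_count (g i) (n:=n)).
  under [RHS]eq_bigr do rewrite -expectZ.
  rewrite -expect_sum; apply: eq_expect => M _; rewrite /weighted_count mulr_sumr.
  by apply: eq_bigr => i _; rewrite mulrCA.
rewrite /deviation !lin -sumrB mulr_suml; apply: eq_bigr => i _.
by rewrite -mulrBr mulrA.
Qed.

Lemma moment_deviation_cvg0 k : deviation (fun t => t%:R ^+ k) @ \oo --> 0.
Proof.
have norm1_le n (Y : 'M['Z_q]_(r + k, n)) : `|1| <= 1 :> R by rewrite normr1.
apply: cvg_trans (balanced_universality (extend k Q) alpha_gt0 w_law w_bal norm1_le).
apply: near_eq_cvg; apply: nearW => n /=.
pose c : R := (p ^ (l * n))%:R ^+ k.
have c_neq0 : c != 0 by rewrite expf_neq0// pnatr_eq0 -lt0n expn_gt0 prime_gt0.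
have extE (v : upper_index n -> 'Z_q -> R) :
    expect v (weighted_solutions (extend k Q) (fun=> 1)) =
    c * expect v (weighted_count (fun t => t%:R ^+ k) (n:=n)).
  rewrite -expectZ; apply: eq_expect => M _; rewrite weighted_solutions1.
  by rewrite solution_count_extend natrM natrX natrM exprMn mulrCA.
rewrite !extE -mulrBr annihilator_count_extend// natrM exprMn.
have -> : ((p ^ l) ^ k)%:R ^+ n = c.
  by rewrite /c -!natrX -!expnM [(k * n)%N]mulnC mulnA.
by rewrite /deviation invfM [c * _]mulrC mulrACA mulfV ?mulr1.
Qed.

Lemma poly_deviation_cvg0 (f : {poly R}) :
  deviation (fun t => f.[t%:R]) @ \oo --> 0.
Proof.
rewrite (_ : deviation _ = fun n => \sum_(i < size f) f`_i * deviation (fun t => t%:R ^+ i) n).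
  rewrite -[X in _ --> X](_ : \sum_(i < size f) f`_i * 0 = 0 :> R); last first.
    by rewrite big1// => i _; rewrite mulr0.
  apply: cvg_big => [|i _]; first exact: add_continuous.
  by apply: cvgM; [exact: cvg_cst|exact: moment_deviation_cvg0].
apply/funext => n; rewrite -deviation_sum; congr deviation.
by apply/funext => t; rewrite horner_coef.
Qed.

End deviation.

Hypothesis weights_reduce : row_weights_reduce p_pr Q.
Hypothesis solutions_free : forces_row_free p_pr Q.

Lemma solves_kercard n (Y : 'M['Z_q]_(r, n)) M : M^T = M -> solves Q Y M ->
  exists s, kercard M = (p ^ (r + s))%N.
Proof.
move=> symM YM_solves; have /eqP Y_free := solutions_free symM YM_solves.
have YM0 : map_mx red Y *m map_mx red M = 0.
  rewrite -map_mxM; move: YM_solves; rewrite solvesE => /andP[/eqP/mul_diag_eq0_red + _].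
  exact.
have := mulmx0_rank_max YM0; rewrite Y_free => r_le.
by exists (n - \rank (map_mx red M) - r)%N; rewrite kercardE subnKC//; lia.
Qed.

Definition corank_indicator (k : nat) : R := (k == p ^ r)%N%:R.

Lemma weighted_count_trunc_le j n (M : 'M['Z_q]_n) : M^T = M ->
  `|weighted_count corank_indicator M -
    weighted_count (fun t => (trunc_poly R p r j).[t%:R]) M| <=
  trunc_const R p j / P ^+ (r * j.+1) * weighted_count (fun t => t%:R ^+ j.+1) M.
Proof.
move=> symM; rewrite /weighted_count -mulrBr normrM normr_nat mulrCA.
have [count0|] := posnP (solution_count Q M); first by rewrite count0 !mul0r.
move=> /card_gt0P[Y YM_solves]; apply: ler_wpM2l => //.
have [s ->] := solves_kercard symM YM_solves.
have -> : corank_indicator (p ^ (r + s)) = (s == 0%N)%:R.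
  by rewrite /corank_indicator eqn_exp2l ?prime_gt1// -{2}(addn0 r) eqn_add2l.
rewrite natrX; apply: le_trans (trunc_poly_approx R r p_pr j s) _.
by rewrite exprD exprMn -[(P ^+ r) ^+ _]exprM -mulrA mulKf// expf_neq0// gt_eqF.
Qed.

Lemma expect_trunc_le j n (w : upper_index n -> 'Z_q -> R) : is_law w ->
  `|expect w (weighted_count corank_indicator (n:=n)) -
    expect w (weighted_count (fun t => (trunc_poly R p r j).[t%:R]) (n:=n))| <=
  trunc_const R p j / P ^+ (r * j.+1) *
    expect w (weighted_count (fun t => t%:R ^+ j.+1) (n:=n)).
Proof.
move=> w_law; rewrite -expectB -expectZ; apply: norm_expect_le => // M symM.
exact: weighted_count_trunc_le.
Qed.

Local Notation density := (solution_density R Q).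

Lemma solution_density_ge0 : 0 <= density.
Proof. exact: divr_ge0. Qed.

Lemma mean_moment_le j n : (r <= n)%N ->
  mean (weighted_count (fun t => t%:R ^+ j.+1) (n:=n)) / A%:R ^+ n <=
  P ^+ (r * j.+1) * (density * (6 * \prod_(1 <= i < j.+1) (1 + P ^+ i))).
Proof.
move=> r_le_n.
rewrite (mean_solution_count_density weights_reduce solutions_free (fun t => t%:R ^+ j.+1) r_le_n).
rewrite (_ : mean_ker _ _ _ _ =
   P ^+ (r * j.+1) * mean_ker l p_pr (n - r) (fun t => t%:R ^+ j.+1)); last first.
  rewrite -mean_kerZ; apply: eq_mean_ker => t _.
  by rewrite natrM natrX exprMn exprM.
rewrite mulrCA; apply: ler_wpM2l; first by rewrite exprn_ge0// ltW.
apply: ler_pM.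
- by rewrite mulr_ge0 ?divr_ge0// solution_density_ge0.
- by apply: mean_ker_ge0 => t; rewrite exprn_ge0.
- rewrite ler_piMl ?solution_density_ge0// ler_pdivrMr ?mul1r ?ler_nat ?full_rank_count_le//.
  by rewrite ltr0n !expn_gt0 prime_gt0.
- exact: mean_ker_moment_bound.
Qed.

Lemma full_rank_fraction_cvg1 :
  (full_rank_count l p_pr r n)%:R / (q ^ (r * n))%:R @[n --> \oo] --> (1 : R).
Proof.
apply/cvgrPdist_le => eps eps_gt0.
have PV01 : 0 <= P^-1 < 1 by rewrite invr_ge0 (ltW P_gt0) invf_lt1// ltr1n prime_gt1.
have bound_gt0 : 0 < eps / P ^+ r by rewrite divr_gt0// exprn_gt0.
apply: filterS (near_expr_le PV01 bound_gt0) => n small.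
have total_gt0 : 0 < (q ^ (r * n))%:R :> R by rewrite ltr0n !expn_gt0 prime_gt0.
have Pn_gt0 : 0 < P ^+ n by rewrite exprn_gt0.
rewrite ger0_norm; last first.
  by rewrite subr_ge0 ler_pdivrMr// mul1r ler_nat full_rank_count_le.
have := full_rank_count_ge l p_pr r n.
rewrite -(ler_nat R) natrD !natrM [(p ^ n)%:R]natrX [(p ^ r)%:R]natrX.
set x := (full_rank_count _ _ _ _)%:R; set y := (q ^ (r * n))%:R in total_gt0 * => count_ge.
rewrite lerBlDr -lerBlDl ler_pdivlMr// mulrBl mul1r lerBlDr -(ler_pM2r Pn_gt0).
apply: le_trans count_ge _; rewrite mulrDl lerD2l mulrAC ler_wpM2r ?(ltW total_gt0)//.
by move: small; rewrite exprVn -[_^-1]mul1r ler_pdivrMr// mulrAC ler_pdivlMr ?exprn_gt0// mul1r.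
Qed.

Lemma mean_corank_cvg :
  mean (weighted_count corank_indicator (n:=n)) / A%:R ^+ n @[n --> \oo] -->
  density * odd_power_product R p.
Proof.
have partial_cvg : odd_power_partial R p (uphalf (n - r)) @[n --> \oo] -->
    odd_power_product R p.
  have partial_cvg : odd_power_partial R p @ \oo --> odd_power_product R p.
    by apply: is_cvg_odd_power_product; rewrite prime_gt0.
  apply: (@cvg_comp _ _ _ (fun n => uphalf (n - r)) (odd_power_partial R p) \oo \oo) => //.
  move=> B [k _ kB]; exists (r + k.*2)%N => // n /= n_ge; apply: kB => /=.
  by rewrite uphalf_half; lia.
rewrite -[density]mul1r.
have : (full_rank_count l p_pr r n)%:R / (q ^ (r * n))%:R * density *
    odd_power_partial R p (uphalf (n - r)) @[n --> \oo] --> 1 * density * odd_power_product R p.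
  by apply: cvgM partial_cvg; apply: cvgM full_rank_fraction_cvg1 _; exact: cvg_cst.
apply: cvg_trans; apply: near_eq_cvg; exists r => // n /= r_le_n.
rewrite (mean_solution_count_density weights_reduce solutions_free corank_indicator r_le_n).
congr (_ * _); rewrite -(mean_ker_nonsingular R l p_pr); apply: eq_mean_ker => k _.
by rewrite /corank_indicator -[X in _ = (_ == X)%:R]muln1 eqn_pmul2l ?expn_gt0 ?prime_gt0.
Qed.

Section balanced_limit.
Variables (alpha : R) (w : forall n, upper_index n -> 'Z_q -> R).
Arguments w : clear implicits.
Hypotheses (alpha_gt0 : 0 < alpha) (w_law : forall n, is_law (w n)).
Hypothesis w_bal : forall n, balanced p_pr alpha (w n).

Lemma corank_deviation_le j n : (r <= n)%N ->
  `|deviation w corank_indicator n| <=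
  `|deviation w (fun t => (trunc_poly R p r j).[t%:R]) n| +
    trunc_const R p j / P ^+ (r * j.+1) * `|deviation w (fun t => t%:R ^+ j.+1) n| +
    12 * density * trunc_tail R p j.
Proof.
move=> r_le_n; have unif_law : is_law (@uniform_law R 'Z_q n).
  by apply: uniform_is_law; apply/card_gt0P; exists 0.
have w_trunc := expect_trunc_le j (w_law n); have unif_trunc := expect_trunc_le j unif_law.
have := mean_moment_le j r_le_n; rewrite ler_pdivrMr// => moment_le.
set tc := trunc_const R p j / _ in w_trunc unif_trunc *.
have tc_ge0 : 0 <= tc by rewrite divr_ge0 ?trunc_const_ge0// exprn_ge0// ltW.
have moment_term : tc * mean (weighted_count (fun t => t%:R ^+ j.+1) (n:=n)) <=
    6 * density * trunc_tail R p j * A%:R ^+ n.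
  apply: le_trans (ler_wpM2l tc_ge0 moment_le) _.
  rewrite /tc /trunc_tail le_eqVlt; apply/orP; left; apply/eqP.
  by field; rewrite expf_neq0// gt_eqF.
rewrite /deviation !normrM !normfV !(gtr0_norm (expr_A_gt0 n)).
rewrite ler_pdivrMr// mulrDl mulrDl divfK ?gt_eqF// -[tc * _ * _]mulrA divfK ?gt_eqF//.
move: w_trunc unif_trunc moment_term; set ind := weighted_count corank_indicator (n:=n).
set trunc := weighted_count (fun t => (trunc_poly R p r j).[t%:R]) (n:=n).
set power := weighted_count (fun t => t%:R ^+ j.+1) (n:=n).
set x := expect (w n) ind; set y := expect (w n) trunc; set z := expect (w n) power.
set x' := mean ind; set y' := mean trunc; set z' := mean power => w_trunc unif_trunc moment_term.
have z_le : tc * z <= tc * `|z - z'| + tc * z'.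
  by rewrite -mulrDr ler_wpM2l// -lerBlDr ler_norm.
have -> : x - x' = (x - y) + (y - y') + - (x' - y') by ring.
apply: le_trans (ler_normD _ _) _; rewrite normrN.
apply: le_trans (lerD (ler_normD _ _) (lexx _)) _.
by lra.
Qed.

Theorem expect_corank_cvg :
  expect (w n) (weighted_count corank_indicator (n:=n)) / A%:R ^+ n @[n --> \oo] -->
  density * odd_power_product R p.
Proof.
have deviation_cvg0 : deviation w corank_indicator @ \oo --> 0.
  pose main j n := `|deviation w (fun t => (trunc_poly R p r j).[t%:R]) n| +
    trunc_const R p j / P ^+ (r * j.+1) * `|deviation w (fun t => t%:R ^+ j.+1) n|.
  apply: (@cvg0_of_approximations _ _ main (fun j => 12 * density * trunc_tail R p j)).
  - move=> j; rewrite -[X in _ --> X]addr0 -{1}(normr0 R).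
    apply: cvgD; first exact: cvg_norm (poly_deviation_cvg0 alpha_gt0 w_law w_bal _).
    rewrite -[X in _ --> X](mulr0 (trunc_const R p j / P ^+ (r * j.+1))).
    apply: cvgM; first exact: cvg_cst.
    by rewrite -(normr0 R); exact: cvg_norm (moment_deviation_cvg0 alpha_gt0 w_law w_bal _).
  - rewrite -[X in _ --> X](mulr0 (12 * density)).
    by apply: cvgM; [exact: cvg_cst|exact: trunc_tail_cvg0].
  - by move=> j; exists r => // n /= r_le_n; exact: corank_deviation_le.
rewrite -[X in _ --> X]add0r; apply: cvg_trans (cvgD deviation_cvg0 mean_corank_cvg).
apply: near_eq_cvg; apply: nearW => n /=.
by rewrite /deviation -mulrDl subrK.
Qed.

End balanced_limit.
End limit.

(** * Finite abelian p-groups and Q/Z *)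

Section cyclic_decomposition.
Variables (G : finZmodType) (r : nat) (g : 'I_r -> G).
Hypothesis decomposition : \big[dprod/1%g]_(a < r) <[g a]>%g = [set: G]%SET.

Let mulrz_in_cycle a (c : int) : g a *~ c \in <[g a]>%g.
Proof.
case: c => m; first by rewrite -[g a *~ _]/((g a ^+ m)%g) mem_cycle.
by rewrite -[g a *~ _]/((g a ^- m.+1)%g) groupV mem_cycle.
Qed.

Lemma mulrz_eq0_order (x : G) (c : int) : (x *~ c == 0) = (#[x]%g%:Z %| c)%Z.
Proof.
have natr_case m : (x *+ m == 0) = (#[x]%g %| m)%N by rewrite order_dvdn.
case: c => m; first by rewrite dvdzE /= -natr_case.
by rewrite NegzE mulrNz oppr_eq0 dvdzE abszN /= -natr_case.
Qed.

Lemma cyclic_decomposition_gen x : exists c : 'I_r -> int, x = \sum_a g a *~ c a.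
Proof.
have [y [y_in xE _]] := mem_bigdprod decomposition (finset.in_setT x).
have /choice[m yE] a : exists m : nat, y a = g a *+ m.
  by have /cycleP[m ->] := y_in a isT; exists m.
by exists (fun a => (m a)%:Z); rewrite xE; apply: eq_bigr => a _; exact: yE.
Qed.

Lemma cyclic_decomposition_rel (c : 'I_r -> int) :
  \sum_a g a *~ c a = 0 <-> forall a, (#[g a]%g%:Z %| c a)%Z.
Proof.
split=> [sum0 a|c_dvd]; last first.
  by rewrite big1// => a _; apply/eqP; rewrite mulrz_eq0_order.
have [y [_ _ y_uniq]] := mem_bigdprod decomposition (finset.in_setT (0 : G)).
have ->: (#[g a]%g%:Z %| c a)%Z = (g a *~ c a == 0) by rewrite mulrz_eq0_order.
have yE := y_uniq (fun a => g a *~ c a) (fun a _ => mulrz_in_cycle a _) (esym sum0) a isT.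
have y0 := y_uniq (fun a => 0) (fun a _ => group1 _) _ a isT.
by rewrite yE -y0// big1_eq.
Qed.

Lemma cyclic_decomposition_card : #|G| = (\prod_a #[g a]%g)%N.
Proof. by rewrite -cardsT -(bigdprod_card decomposition). Qed.

End cyclic_decomposition.

Record ppower_basis (p : nat) (G : finZmodType) (r : nat) (e : 'I_r -> nat)
    (g : 'I_r -> G) : Prop := PpowerBasis {
  basis_exp_gt0 : forall a, (0 < e a)%N;
  basis_gen : forall x, exists c : 'I_r -> int, x = \sum_a g a *~ c a;
  basis_rel : forall c : 'I_r -> int,
    \sum_a g a *~ c a = 0 <-> forall a, ((p ^ e a)%N%:Z %| c a)%Z;
  basis_card : #|G| = (\prod_a p ^ e a)%N
}.

Lemma ppower_basis_exists (G : finZmodType) (p : nat) : (p.-group [set: G]%SET)%g ->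
  exists (r : nat) (e : 'I_r -> nat) (g : 'I_r -> G), ppower_basis p e g.
Proof.
move=> pG; have [b bE ordersE] := abelian_structure (FinRing.Theory.zmod_abelian [set: G]%SET).
pose g (a : 'I_(size b)) : G := tnth (in_tuple b) a.
have gE : \big[dprod/1%g]_(a < size b) <[g a]>%g = [set: G]%SET.
  exact: (etrans (esym (big_tnth _ _ b xpredT (fun x => <[x]>%g))) bE).
have /choice[e eP] a : exists k, (0 < k)%N /\ #[g a]%g = (p ^ k)%N.
  have p_order : p.-nat #[g a]%g by exact: pnat_dvd (order_dvdG (finset.in_setT _)) pG.
  have [k orderE] := p_natP p_order; exists k; split=> //; rewrite lt0n; apply/eqP => k0.
  have : #[g a]%g \in abelian_type [set: G]%SET.
    by rewrite -ordersE; apply: map_f; exact: mem_tnth.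
  by move=> /(allP (abelian_type_gt1 _)); rewrite orderE k0 expn0.
exists (size b), e, g; split=> [a|x|c|].
- by have [] := eP a.
- exact: cyclic_decomposition_gen gE x.
- rewrite (cyclic_decomposition_rel gE c).
  by split=> c_dvd a; have := c_dvd a; have [_ ->] := eP a.
- by rewrite (cyclic_decomposition_card gE); apply: eq_bigr => a _; have [_ ->] := eP a.
Qed.

Lemma qzD (x y : rat) : qz (x + y) = qz x + qz y.
Proof. by rewrite /qz raddfD. Qed.

Lemma qzB (x y : rat) : qz (x - y) = qz x - qz y.
Proof. by rewrite /qz raddfB. Qed.

Lemma qz0 : qz 0 = 0.
Proof. by rewrite /qz raddf0. Qed.

Lemma qz_eq0 (x : rat) : qz x = 0 <-> x \is a Num.int.
Proof. by rewrite -qz0 qzP subr0. Qed.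

Lemma qzMz (x : rat) (m : int) : qz (x *~ m) = qz x *~ m.
Proof. by rewrite /qz raddfMz. Qed.

Lemma qz_sum (I : finType) (F : I -> rat) : qz (\sum_i F i) = \sum_i qz (F i).
Proof. exact: (big_morph qz qzD qz0). Qed.

Lemma qz_surj (t : QmodZ) : exists x, t = qz x.
Proof. by exists (generic_quotient.repr t); rewrite /qz generic_quotient.reprK. Qed.

Lemma int_divr_nat (m : nat) (z : int) : (0 < m)%N ->
  ((z%:~R / m%:R : rat) \is a Num.int) = (m%:Z %| z)%Z.
Proof.
move=> m_gt0; have m_neq0 : m%:R != 0 :> rat by rewrite pnatr_eq0 -lt0n.
apply/intrP/dvdzP => -[x xE]; exists x.
  apply: (@intr_inj rat); rewrite intrM -[X in _ * X]/(m%:R) -xE.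
  by rewrite divfK.
by rewrite xE intrM -[X in _ * X / _]/(m%:R) mulfK.
Qed.

(** * Matrices over fields and over the integers *)

Section field_kernels.
Variables (F : fieldType) (n r : nat) (B : 'M[F]_n) (Y H : 'M[F]_(r, n)).
Hypothesis YB0 : Y *m B = 0.
Hypothesis HY_unit : H *m Y^T \in unitmx.

Let YH_unit : Y *m H^T \in unitmx.
Proof. by rewrite -unitmx_tr trmx_mul trmxK. Qed.

Lemma dual_row_free : row_free Y.
Proof. by apply/row_freeP; exists (H^T *m invmx (Y *m H^T)); rewrite mulmxA mulmxV. Qed.

Lemma corank_row_free : (n - \rank B)%N = r -> row_free (row_mx B H^T).
Proof.
move=> corankB; rewrite -kermx_eq0 -submx0; apply/row_subP => i; rewrite submx0.
have := row_sub i (kermx (row_mx B H^T)); move: (row i _) => u.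
rewrite (sameP sub_kermxP eqP) mul_mx_row -row_mx0 => /eqP/eq_row_mx[/sub_kermxP uB uH].
have Y_sub : (Y <= kermx B)%MS by exact/sub_kermxP.
have : (kermx B <= Y)%MS.
  by rewrite -(geq_leqif (mxrank_leqif_sup Y_sub)) mxrank_ker corankB (eqP dual_row_free).
move=> /(submx_trans uB)/submxP[z uE]; move: uH; rewrite uE -mulmxA => zYH0.
have -> : z = 0 by apply: (can_inj (mulmxK YH_unit)); rewrite zYH0 mul0mx.
by rewrite mul0mx.
Qed.

Lemma row_free_corank : row_free (row_mx B H^T) -> (n - \rank B)%N = r.
Proof.
move=> /eqP full; apply/eqP; rewrite eqn_leq; apply/andP; split.
  have : row_mx B H^T = B *m row_mx 1%:M 0 + H^T *m row_mx 0 1%:M.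
    by rewrite !mul_mx_row !mulmx1 !mulmx0 add_row_mx addr0 add0r.
  move=> /(congr1 mxrank) rankE; rewrite leq_subLR -[X in (X <= _)%N]full rankE.
  apply: leq_trans (mxrank_add _ _) _; apply: leq_add; first exact: mxrankM_maxl.
  exact: leq_trans (mxrankM_maxl _ _) (rank_leq_col _).
rewrite -mxrank_ker -[X in (X <= _)%N](eqP dual_row_free); apply: mxrankS.
exact/sub_kermxP.
Qed.

End field_kernels.

Lemma coprimez_torsion (V : zmodType) (x : V) (m k : int) :
  coprimez m k -> x *~ m = 0 -> x *~ k = 0 -> x = 0.
Proof.
move=> /coprimezP[[u v] /= bezout] xm xk.
by rewrite -[x]mulr1z -bezout mulrzDr [u * m]mulrC [v * k]mulrC !mulrzA xm xk !mul0rz addr0.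
Qed.

Lemma coprimez_ppower (p : nat) (m : int) k : prime p -> ~~ (p%:Z %| m)%Z ->
  coprimez m (p ^ k)%N%:Z.
Proof.
by move=> p_pr p_ndvd; rewrite coprimezE /= coprime_sym coprimeXl// prime_coprime.
Qed.

Lemma dvdz_sum (I : finType) (d : int) (f : I -> int) :
  (forall i, (d %| f i)%Z) -> (d %| \sum_i f i)%Z.
Proof. by move=> d_dvd; apply: rpred_sum => i _; exact: d_dvd. Qed.

Lemma mulrz_scale (V : lmodType int) (v : V) (z : int) : v *~ z = z *: v.
Proof. by rewrite -scaler_int intz. Qed.

Lemma sum_mulrz_single (V : zmodType) (I : finType) (x : I -> V) a (c : int) :
  \sum_b x b *~ (if b == a then c else 0) = x a *~ c.
Proof.
by rewrite (bigD1 a)//= eqxx big1 ?addr0// => b /negbTE ->; rewrite mulr0z.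
Qed.

Lemma col_scalar_int n (z : int) (j : 'I_n) : col j z%:M = delta_mx j 0 *~ z.
Proof. by apply/colP => i; rewrite mulrz_scale !mxE eqxx andbT mulr_natr. Qed.

Lemma mulmxMz m n k (A : 'M[int]_(m, n)) (B : 'M[int]_(n, k)) z :
  A *m (B *~ z) = (A *m B) *~ z.
Proof. exact: (raddfMz (mulmx A)). Qed.

Lemma mulmx_col_choice (R : pzRingType) m n k (A : 'M[R]_(m, n)) (B : 'M[R]_(m, k)) :
  (forall j, exists s : 'cV_n, A *m s = col j B) -> exists S, A *m S = B.
Proof.
move=> /choice[s sE]; exists (\matrix_(i, j) s j i 0); apply/matrixP => i j.
have /matrixP/(_ i 0) := sE j; rewrite !mxE => <-.
by apply: eq_bigr => h _; rewrite !mxE.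
Qed.

Lemma row_free_mod_inverse p n k (A : 'M[int]_(n, k)) : prime p ->
  row_free (map_mx intr A : 'M['F_p]_(n, k)) <->
  exists m (Z : 'M[int]_(k, n)), ~~ (p%:Z %| m)%Z /\ A *m Z = m%:M.
Proof.
move=> p_pr; split=> [/row_freeP[Z AZ1]|[m [Z [p_ndvd AZ]]]]; last first.
  apply/row_freeP; exists ((m%:~R)^-1 *: map_mx intr Z).
  by rewrite -scalemxAr -map_mxM AZ map_scalar_mx /= scale_scalar_mx mulVf// intr_Fp_eq0.
pose B := A *m int_lift Z; exists (\det B), (int_lift Z *m \adj B).
split; last by rewrite mulmxA mul_mx_adj.
by rewrite -intr_Fp_eq0// -det_map_mx map_mxM int_liftK AZ1 det1 oner_eq0.
Qed.

Lemma dotDl n (u v w : 'cV[int]_n) : dot (u + v) w = dot u w + dot v w.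
Proof. by rewrite /dot linearD/= mulmxDl mxE. Qed.

Lemma dotMzl n (u v : 'cV[int]_n) z : dot (u *~ z) v = z * dot u v.
Proof. by rewrite /dot mulrz_scale linearZ/= -scalemxAl mxE. Qed.

Lemma dot_mul_trmx r n (A : 'M[int]_(r, n)) d v :
  dot (A^T *m d) v = \sum_a d a 0 * (A *m v) a 0.
Proof. by rewrite /dot trmx_mul trmxK -mulmxA mxE; apply: eq_bigr => a _; rewrite mxE. Qed.

Lemma mulmx_det_inj n (M : 'M[int]_n) (u v : 'cV[int]_n) : \det M != 0 ->
  M *m u = M *m v -> u = v.
Proof.
move=> det_neq0 Muv; apply/matrixP => i j; have := congr1 (mulmx (\adj M)) Muv.
rewrite !mulmxA mul_adj_mx !mul_scalar_mx => /matrixP/(_ i j); rewrite !mxE.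
exact: mulfI.
Qed.

Lemma mulmx_ppower_coprime (p n : nat) (M : 'M[int]_n) : prime p -> \det M != 0 ->
  exists u (m : int) (W : 'M[int]_n),
    ~~ (p%:Z %| m)%Z /\ M *m W = ((p ^ u)%N%:Z * m)%:M.
Proof.
move=> p_pr det_neq0; have abs_gt0 : (0 < `|\det M|)%N by rewrite absz_gt0.
have [m pm absE] := pfactor_coprime p_pr abs_gt0.
exists (logn p `|\det M|), ((-1) ^+ (\det M < 0)%R * m%:Z), (\adj M); split.
  by rewrite dvdzE abszMsign /= -prime_coprime.
rewrite mul_mx_adj; congr _%:M.
transitivity ((-1) ^+ (\det M < 0)%R * (`|\det M|%N)%:Z); first exact: intEsign.
by rewrite [in LHS]absE PoszM mulrA mulrC.
Qed.

Lemma p_primitive_part (p n : nat) (v : 'rV[int]_n) : prime p -> v != 0 ->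
  exists k (u : 'rV[int]_n), v = (p ^ k)%N%:Z *: u /\ exists i, ~~ (p%:Z %| u ord0 i)%Z.
Proof.
move=> p_pr v_neq0.
have [i vi_neq0] : exists i, v 0 i != 0.
  apply/existsP; apply: contraNT v_neq0; rewrite negb_exists => /forallP v0.
  by apply/eqP/rowP => i; rewrite mxE; apply/eqP; have := v0 i; rewrite negbK.
pose divides k := [forall j, ((p ^ k)%N%:Z %| v ord0 j)%Z].
have divides0 : exists k, divides k.
  by exists 0%N; apply/forallP => j; rewrite expn0 dvd1z.
have divides_le k : divides k -> (k <= logn p `|v 0%R i|)%N.
  by move=> /forallP/(_ i); rewrite dvdzE /= pfactor_dvdn// absz_gt0.
have [k /forallP k_divides k_max] := ex_maxnP divides0 divides_le.
pose u := \row_j (v ord0 j %/ (p ^ k)%N%:Z)%Z.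
have vE j : v 0 j = (p ^ k)%N%:Z * u 0 j by rewrite mxE mulrC divzK.
exists k, u; split; first by apply/rowP => j; rewrite mxE -vE.
apply/existsP; apply: contraT; rewrite negb_exists => /forallP p_divides.
suff /k_max : divides k.+1 by rewrite ltnn.
apply/forallP => j; rewrite vE expnSr PoszM dvdz_mul2l; last first.
  by rewrite -lt0n expn_gt0 prime_gt0.
by have := p_divides j; rewrite negbK.
Qed.

Lemma int_kernel_vector (p n : nat) (M : 'M[int]_n) : prime p -> \det M = 0 ->
  exists2 v : 'rV[int]_n, v *m M = 0 & exists i, ~~ (p%:Z %| v ord0 i)%Z.
Proof.
move=> p_pr /eqP/det0P[v v_neq0 vM0].
have [k [u [vE u_primitive]]] := p_primitive_part p_pr v_neq0; exists u => //.
apply/rowP => j; rewrite [RHS]mxE; apply/eqP; move/rowP/(_ j): vM0.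
rewrite vE -scalemxAl mxE [RHS]mxE => /eqP; rewrite mulf_eq0.
have /negbTE -> // : (p ^ k)%N%:Z != 0 by rewrite -lt0n expn_gt0 prime_gt0.
Qed.

(** * The Sylow subgroup of a cokernel *)

Section sylow_cokernel.
Variables (p n : nat) (M : 'M[int]_n).
Hypothesis p_pr : prime p.

Lemma cok_classD u v : cok_class M (u + v) = cok_class M u + cok_class M v.
Proof. exact: raddfD. Qed.

Lemma cok_class0 : cok_class M 0 = 0.
Proof. exact: raddf0. Qed.

Lemma cok_classMz v m : cok_class M (v *~ m) = cok_class M v *~ m.
Proof. exact: raddfMz. Qed.

Lemma cok_class_eq0 v : cok_class M v = 0 <-> exists s, v = M *m s.
Proof. by rewrite -cok_class0 cok_classP subr0. Qed.

Lemma sylow_of_torsion (v s : 'cV[int]_n) j : M *m s = v *~ (p ^ j)%N%:Z ->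
  exists x : sylow p (cok M), sylow_val x = cok_class M v.
Proof.
move=> MsE; have v_torsion : cok_class M v \in ppower_torsion p (V := cok M).
  apply/asboolP; exists j; rewrite -[_ *+ _]/(cok_class M v *~ (p ^ j)%N%:Z).
  by rewrite -cok_classMz -MsE; apply/cok_class_eq0; exists s.
by exists (Defs.Sylow v_torsion).
Qed.

Lemma sylow_torsion (x : sylow p (cok M)) v : sylow_val x = cok_class M v ->
  exists s j, M *m s = v *~ (p ^ j)%N%:Z.
Proof.
case: x => x0 /asboolP[j x0_torsion] /= xE; rewrite xE in x0_torsion.
have /cok_class_eq0[s vE] : cok_class M (v *~ (p ^ j)%N%:Z) = 0 by rewrite cok_classMz.
by exists s, j.
Qed.

Lemma sylow_lift (x : sylow p (cok M)) : exists v, sylow_val x = cok_class M v.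
Proof.
exists (generic_quotient.repr (sylow_val x)).
by rewrite /cok_class generic_quotient.reprK.
Qed.

Lemma sylow_valMz (x : sylow p (cok M)) m : sylow_val (x *~ m) = sylow_val x *~ m.
Proof. exact: (raddfMz (\val : sylow p (cok M) -> cok M)). Qed.

Lemma sylow_hom_factor (V : zmodType) (h : {additive 'cV[int]_n -> V}) :
  (forall s, h (M *m s) = 0) ->
  exists f : {additive sylow p (cok M) -> V},
    forall x v, sylow_val x = cok_class M v -> f x = h v.
Proof.
move=> hM0; have /choice[lift liftE] := sylow_lift.
have h_lift x v : sylow_val x = cok_class M v -> h (lift x) = h v.
  move=> xE; have /cok_classP[s sE] := etrans (esym (liftE x)) xE.
  by apply/subr0_eq; rewrite -raddfB /= sE hM0.
have h_zmod : zmod_morphism (h \o lift).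
  move=> x x'; rewrite /= -raddfB; apply: h_lift.
  have -> : sylow_val (x - x') = sylow_val x - sylow_val x' by [].
  by rewrite {1}liftE {1}(liftE x') /cok_class raddfB.
pose f : {additive sylow p (cok M) -> V} :=
  HB.pack (h \o lift) (GRing.isZmodMorphism.Build _ _ (h \o lift) h_zmod).
by exists f.
Qed.

Hypothesis symM : M^T = M.

Lemma torsion_ker_perp (t v : 'cV[int]_n) i : M *m t = v *~ (p ^ i)%N%:Z -> ker_perp M v.
Proof.
move=> MtE u Mu0; have : dot v u *+ (p ^ i) = 0.
  by rewrite -dotMnl -[v *+ _]/(v *~ (p ^ i)%N%:Z) -MtE -dot_sym// Mu0 /dot mulmx0 mxE.
by move/eqP; rewrite mulrn_eq0 expn_eq0 (gtn_eqF (prime_gt0 p_pr))/= => /eqP.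
Qed.

Lemma sylow_pairingE (x x' : sylow p (cok M)) v v' s j :
  sylow_val x = cok_class M v -> sylow_val x' = cok_class M v' ->
  M *m s = v *~ (p ^ j)%N%:Z ->
  sylow_pairing x x' = qz ((dot s v')%:~R / (p ^ j)%:R).
Proof.
move=> xE x'E MsE; have [s' [j' Ms'E]] := sylow_torsion x'E.
have ppower_gt0 i : (0 < p ^ i)%N by rewrite expn_gt0 prime_gt0.
apply: canonical_pairingE => //; exists v, v', s, s', (p ^ j)%N, (p ^ j')%N; split=> //.
  by split; [exact: torsion_ker_perp MsE|exact: torsion_ker_perp Ms'E].
congr qz; rewrite Ms'E [dot s (_ *~ _)]dotC -[v' *~ _]/(v' *+ (p ^ j')) dotMnl dotC rmorphMn/=.
rewrite -[X in _ = X / _]mulr_natr natrM.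
by rewrite -mulf_div divff ?mulr1// pnatr_eq0 -lt0n.
Qed.

End sylow_cokernel.

(** * Random integer matrices modulo a prime power *)

Section primitive_kernel_vectors.
Variables (R : realType) (p l : nat).
Hypothesis p_pr : prime p.
Local Notation q := (p ^ l.+1)%N.
Local Notation red := (red l p_pr).

Definition kernel_system : congruence_system q 1 := {|
  row_weight _ := 1;
  gram_weight _ _ := 0;
  gram_target _ _ := 0 |}.

(* The number of left kernel vectors of M that are nonzero modulo p. *)
Definition null_count n (M : 'M['Z_q]_n) : R :=
  weighted_solutions kernel_system (fun Y => (row_free (map_mx red Y))%:R) M.

Lemma solves_kernel_system n (Y : 'M['Z_q]_(1, n)) (M : 'M['Z_q]_n) :
  solves kernel_system Y M = (Y *m M == 0).
Proof.
apply/andP/eqP => [[/forallP rows0 _]|YM0].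
  apply/matrixP => s i; have /forallP/(_ s) := rows0 i; rewrite mul1r => /eqP ->.
  by rewrite mxE.
split; first by apply/forallP => i; apply/forallP => s; rewrite YM0 mxE mulr0.
by apply/forallP => st; rewrite mul0r.
Qed.

Lemma annihilator_count_kernel_system : annihilator_count kernel_system = 1%N.
Proof.
apply: big1 => s _; transitivity #|[set 0 : 'Z_q]%SET|; last exact: cards1.
by apply: eq_card => x; rewrite !inE mul1r.
Qed.

Lemma corner_count_kernel_system : corner_count kernel_system = 1%N.
Proof.
transitivity #|pred1 (0 : 'M['Z_q]_1)|; last exact: card1.
apply: eq_card => A; rewrite !inE solves_kernel_system mul1mx.
by apply: andb_idl => /eqP ->; rewrite trmx0.
Qed.

Lemma null_count_ge0 n (M : 'M['Z_q]_n) : 0 <= null_count M.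
Proof. by apply: sumr_ge0 => Y _; rewrite mulr_ge0. Qed.

Lemma mean_null_count_le1 n : (0 < n)%N -> mean (null_count (n:=n)) <= 1.
Proof.
case: n => // m _; rewrite -[m.+1]/(1 + m)%N.
have weights_reduce : row_weights_reduce p_pr kernel_system.
  by move=> s x; rewrite mul1r => ->; rewrite rmorph0.
have q_gt0 : 0 < (q ^ (1 * (1 + m)))%:R :> R by rewrite ltr0n !expn_gt0 prime_gt0.
have -> : mean (null_count (n:=1 + m)) =
    (full_rank_count l p_pr 1 (1 + m))%:R / (q ^ (1 * (1 + m)))%:R :> R; last first.
  by rewrite ler_pdivrMr// mul1r ler_nat full_rank_count_le.
rewrite expect_sum -sumr_constE [RHS]big_mkcond; apply: eq_bigr => Y _; rewrite expectZ.
case: ifP => [|_]; last by rewrite mul0r.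
move=> /(mean_solves weights_reduce (fun=> 1 : R)) meanE; rewrite mul1r -[RHS]mulr1.
rewrite -[LHS](eq_expect _ (h := fun M => (solves kernel_system Y M)%:R * 1)); last first.
  by move=> M _; rewrite mulr1.
rewrite meanE corner_count_kernel_system annihilator_count_kernel_system expr1n !mul1r.
have -> : #|upper_index 1| = 1%N by have := card_upper_index_double 1; lia.
have -> : mean_ker l p_pr m (fun=> 1 : R) = 1.
  by apply: expect_cst; apply: uniform_is_law; apply/card_gt0P; exists 0.
by rewrite mulr1 !natrX !mul1n.
Qed.

Lemma null_count_singular n (M : 'M[int]_n) : \det M = 0 ->
  (p ^ l)%:R <= null_count (map_mx intr M).
Proof.
move=> /(int_kernel_vector p_pr)[v vM0 [i p_ndvd]].
pose vq : 'rV['Z_q]_n := map_mx intr v.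
have vq_unit : vq 0 i \is a GRing.unit by rewrite (red_unit p_pr) mxE rmorph_int intr_Fp_eq0.
have scale_inj : injective (fun t : 'Z_q => t *: vq).
  by move=> t t' /rowP/(_ i); rewrite [LHS]mxE [RHS]mxE; exact: (mulIr vq_unit).
rewrite -(card_red_fiber l p_pr 1) -cardsE -(card_imset _ scale_inj) /null_count.
rewrite /weighted_solutions -sum1_card natr_sum big_mkcond /=.
apply: ler_sum => Y _; case: ifP => [/imsetP[t]|_]; last by rewrite mulr_ge0.
rewrite inE => /eqP t1 ->; rewrite solves_kernel_system -scalemxAl -map_mxM vM0.
rewrite map_mx0 scaler0 eqxx.
have -> : map_mx red (t *: vq) = map_mx intr v.
  by apply/rowP => j; rewrite !mxE rmorphM /= t1 mul1r rmorph_int.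
rewrite /row_free rank_rV.
have -> : map_mx intr v != 0 :> 'rV['F_p]_n; last by rewrite mulr1.
by apply: contra p_ndvd => /eqP/rowP/(_ i); rewrite !mxE -intr_Fp_eq0// => ->.
Qed.

Lemma near_null_count_le2 (alpha : R) (w : forall n, upper_index n -> 'Z_q -> R) :
  0 < alpha -> (forall n, is_law (w n)) -> (forall n, balanced p_pr alpha (w n)) ->
  \forall n \near \oo, expect (w n) (null_count (n:=n)) <= 2.
Proof.
move=> alpha_gt0 w_law w_bal.
have indicator_le1 n (Y : 'M['Z_q]_(1, n)) : `|(row_free (map_mx red Y))%:R| <= 1 :> R.
  by rewrite normr_nat; case: row_free; rewrite ?lexx ?ler01.
have := balanced_universality kernel_system alpha_gt0 w_law w_bal indicator_le1.
move=> /cvgrPdist_le/(_ _ ltr01) close; apply: filterS2 close (nbhs_infty_gt 0) => n + n_gt0.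
rewrite annihilator_count_kernel_system expr1n divr1 sub0r normrN => /ler_normlP[_].
have := mean_null_count_le1 n_gt0; rewrite /null_count.
by set x := mean _; set y := expect _ _; lra.
Qed.

End primitive_kernel_vectors.

Section finite_valued_maps.
Variables (d : measure_display) (T : measurableType d).

Lemma measurable_finite_preimage (K : finType) (h : T -> K) (A : pred K) :
  (forall k, measurable [set t | h t = k]) -> measurable [set t | A (h t)].
Proof.
move=> fibers; have -> : [set t | A (h t)] = \bigcup_(k in [set k | A k]) [set t | h t = k].
  by apply/seteqP; split=> [t At|t [k Ak /= ->]]; first by exists (h t).
by apply: fin_bigcup_measurable.
Qed.

Lemma measure_finite_preimage (R : realType) (P : {measure set T -> \bar R}) (K : finType)
    (h : T -> K) (A : pred K) : (forall k, measurable [set t | h t = k]) ->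
  P [set t | A (h t)] = (\sum_(k | A k) P [set t | h t = k])%E.
Proof.
move=> fibers; transitivity (P [set t | h t \in enum A]).
  by congr (P _); apply/seteqP; split=> t /=; rewrite mem_enum.
rewrite -[RHS]big_enum.
elim: (enum A) (enum_uniq A) => [_|k s IHs /= /andP[ks /IHs Ps]].
  by rewrite big_nil -[RHS](measure0 P); congr (P _); apply/seteqP; split.
rewrite big_cons -Ps -measureU//.
- by congr (P _); apply/seteqP; split=> t /=; rewrite inE => /predU1P.
- exact: (measurable_finite_preimage (mem s)).
- by apply/seteqP; split=> t //= -[->]; rewrite (negbTE ks).
Qed.

Lemma measurable_ffun_preimage (I : finType) (X : I -> T -> int) (B : set {ffun I -> int}) :
  (forall i, int_random_variable (X i)) ->
  measurable [set t | B [ffun i => X i t]].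
Proof.
move=> X_meas.
have fibers a : measurable [set t | [ffun i => X i t] = a].
  have -> : [set t | [ffun i => X i t] = a] = \big[setI/setT]_(i : I) (X i @^-1` [set a i]).
    rewrite -bigcap_seq; apply/seteqP; split=> t /=.
      by move=> <- i _ /=; rewrite ffunE.
    move=> Xa; apply/ffunP => i; rewrite ffunE.
    by apply: Xa; rewrite /= mem_index_enum.
  by apply: bigsetI_measurable => i _; exact: X_meas.
have -> : [set t | B [ffun i => X i t]] =
    \bigcup_(a in B) [set t | [ffun i => X i t] = a].
  by apply/seteqP; split=> [t Bt|t [a Ba /= ->]]; first by exists [ffun i => X i t].
rewrite bigcup_mkcond; apply: countable_bigcupT_measurable => [|a]; first exact: countableP.
by case: ifP.
Qed.

End finite_valued_maps.

Section random_matrix.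
Variables (R : realType) (d : measure_display) (T : measurableType d).
Variables (P : probability T R) (n : nat) (M : T -> 'M[int]_n).
Hypothesis symM : forall t, (M t)^T = M t.
Hypothesis M_meas : forall u, int_random_variable (upper_entry M u).

Lemma measurable_matrix_event (B : set 'M[int]_n) : measurable [set t | B (M t)].
Proof.
have := measurable_ffun_preimage [set a | B (sym_mx a)] M_meas.
have M_of_upper t : sym_mx [ffun u => upper_entry M u t] = M t by exact: upper_partK.
by congr (measurable _); apply/seteqP; split=> t /=; rewrite M_of_upper.
Qed.

Variables (p l : nat).
Hypothesis p_pr : prime p.
Local Notation q := (p ^ l.+1)%N.
Local Notation red := (red l p_pr).

Definition residue_law (u : upper_index n) (x : 'Z_q) : R :=
  fine (P [set t | (upper_entry M u t)%:~R = x]).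

Let residue_event u (x : 'Z_q) : measurable [set t | (upper_entry M u t)%:~R = x].
Proof. exact: (M_meas u [set z | z%:~R = x]). Qed.

Lemma residue_lawE u x : P [set t | (upper_entry M u t)%:~R = x] = (residue_law u x)%:E.
Proof. by rewrite fineK// fin_num_measure. Qed.

Lemma prob_residue (A : pred 'Z_q) u :
  P [set t | A (upper_entry M u t)%:~R] = (\sum_(x | A x) residue_law u x)%:E.
Proof.
rewrite (measure_finite_preimage _ A (residue_event u)) -sumEFin.
by apply: eq_bigr => x _; exact: residue_lawE.
Qed.

Lemma residue_is_law : is_law residue_law.
Proof.
split=> [u x|u]; first by rewrite fine_ge0// measure_ge0.
apply: EFin_inj; rewrite -(prob_residue predT) -[RHS](probability_setT P).
by congr (P _); apply/seteqP; split.
Qed.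

Lemma residue_balanced (alpha : R) :
  (forall u (z : int), (P [set t | (upper_entry M u t = z %[mod p])%Z] <= (1 - alpha)%:E)%E) ->
  balanced p_pr alpha residue_law.
Proof.
move=> M_bal u a; rewrite -lee_fin -(prob_residue (fun x => red x == a)).
apply: le_trans (M_bal u (a : nat)%:Z).
rewrite le_eqVlt; apply/orP; left; apply/eqP; congr (P _); apply/seteqP.
have aE : a = ((a : nat)%:Z)%:~R :> 'F_p by rewrite -pmulrn natr_Zp.
have modE t : (red (upper_entry M u t)%:~R == a) =
    (upper_entry M u t == (a : nat)%:Z %[mod p])%Z.
  by rewrite eqz_mod_dvd -intr_Fp_eq0// intrB -aE subr_eq0 rmorph_int.
by split=> t /=; rewrite modE => /eqP.
Qed.

Hypothesis M_indep : mutually_independent P (upper_entry M).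

Lemma prob_reduced_event (A : pred 'M['Z_q]_n) :
  P [set t | A (map_mx intr (M t))] = (expect residue_law (fun B => (A B)%:R))%:E.
Proof.
pose residues t : {ffun upper_index n -> 'Z_q} := [ffun u => (upper_entry M u t)%:~R].
have residuesE t : sym_mx (residues t) = map_mx intr (M t).
  rewrite -(upper_partK (M := map_mx intr (M t) : 'M['Z_q]_n)); last by rewrite map_trmx symM.
  by congr sym_mx; apply/ffunP => u; rewrite !ffunE mxE.
pose residues_are (a : {ffun upper_index n -> 'Z_q}) u := [set z : int | z%:~R = a u :> 'Z_q].
have fiberE a : [set t | residues t = a] = [set t | forall u, u \in [set: upper_index n]%SET ->
    residues_are a u (upper_entry M u t)].
  apply/seteqP; split=> t /=; first by move=> <- u _; rewrite /residues_are /= ffunE.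
  by move=> all_u; apply/ffunP => u; rewrite ffunE; apply: all_u; rewrite finset.in_setT.
have fiber_meas a : measurable [set t | residues t = a].
  have := measurable_ffun_preimage [set b : {ffun upper_index n -> int} |
    [ffun u => (b u)%:~R : 'Z_q] = a] M_meas.
  congr (measurable _); apply/seteqP.
  have residues_upper t : [ffun u => ([ffun i => upper_entry M i t] u)%:~R : 'Z_q] = residues t.
    by apply/ffunP => u; rewrite !ffunE.
  by split=> t /=; rewrite residues_upper.
have -> : [set t | A (map_mx intr (M t))] = [set t | A (sym_mx (residues t))].
  by apply/seteqP; split=> t /=; rewrite residuesE.
rewrite (measure_finite_preimage _ (fun a => A (sym_mx a)) fiber_meas) /expect -sumEFin.
rewrite [RHS](bigID (fun a => A (sym_mx a))) /=.
rewrite [X in (_ + X)%E]big1 ?adde0 => [|a /negbTE ->]; last by rewrite mulr0.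
apply: eq_bigr => a ->; rewrite mulr1 -prodEFin fiberE M_indep.
rewrite (eq_bigl xpredT) => [|u]; last by rewrite finset.in_setT.
by apply: eq_bigr => u _; rewrite -residue_lawE.
Qed.

Lemma prob_singular_le : expect residue_law (null_count R p_pr (n:=n)) <= 2 ->
  (P [set t | \det (M t) = 0%R] <= (2 / (p ^ l)%:R)%:E)%E.
Proof.
move=> null_le2; pose A (B : 'M['Z_q]_n) := (p ^ l)%:R <= null_count R p_pr B.
have ppower_gt0 : 0 < (p ^ l)%:R :> R by rewrite ltr0n expn_gt0 prime_gt0.
apply: (@le_trans _ _ (P [set t | A (map_mx intr (M t))])).
  apply: le_measure; rewrite ?inE.
  - exact: (measurable_matrix_event [set B | \det B = 0]).
  - exact: (measurable_matrix_event [set B | A (map_mx intr B)]).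
  by move=> t /= /(null_count_singular R l p_pr).
rewrite prob_reduced_event lee_fin ler_pdivlMr// mulrC; apply: le_trans null_le2.
rewrite -expectZ; apply: (le_expect residue_is_law) => B _.
by case: (boolP (A B)) => [A_B|_]; rewrite ?mulr1 // mulr0 null_count_ge0.
Qed.

End random_matrix.

Section random_matrices.
Variables (R : realType) (alpha : R) (p : nat).
Hypotheses (alpha_gt0 : 0 < alpha) (p_pr : prime p).
Variables (d : nat -> measure_display) (Omega : forall n, measurableType (d n)).
Variables (P : forall n, probability (Omega n) R) (M : forall n, Omega n -> 'M[int]_n).
Hypothesis symM : forall n (w : Omega n), (M w)^T = M w.
Hypothesis M_meas : forall n (u : upper_index n),
  int_random_variable (upper_entry (M (n:=n)) u).
Hypothesis M_indep : forall n, mutually_independent (P n) (upper_entry (M (n:=n))).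
Hypothesis M_bal : forall n (u : upper_index n) (t : int),
  (P n [set w | (upper_entry (M (n:=n)) u w = t %[mod p])%Z] <= (1 - alpha)%:E)%E.

Lemma prob_singular_cvg0 : fine (P n [set w | \det (M w) = 0]) @[n --> \oo] --> (0 : R).
Proof.
apply/cvgrPdist_le => eps eps_gt0.
have [l _ small] : \forall l \near \oo, (p%:R^-1 : R) ^+ l <= eps / 2.
  apply: near_expr_le; last by rewrite divr_gt0.
  by rewrite invr_ge0 ler0n /= invf_lt1 ?ltr0n ?ltr1n ?prime_gt0 ?prime_gt1.
pose w n := residue_law (P n) (M (n:=n)) (p:=p) (l:=l).
have w_law n : is_law (w n) by exact: residue_is_law.
have w_bal n : balanced p_pr alpha (w n) by exact: residue_balanced.
apply: filterS (near_null_count_le2 alpha_gt0 w_law w_bal) => n null_le2.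
have sing_meas := measurable_matrix_event (@symM n) (@M_meas n) [set B | \det B = 0].
rewrite sub0r normrN ger0_norm ?fine_ge0 ?measure_ge0//.
have := prob_singular_le (@symM n) (@M_meas n) (M_indep (n:=n)) null_le2.
rewrite -[X in (X <= _)%E]fineK ?fin_num_measure// lee_fin => /le_trans; apply.
by have := small l (leqnn l); rewrite ler_pdivlMr// mulrC exprVn natrX.
Qed.

Lemma cvg_prob_of_nonsingular (E : forall n, set 'M[int]_n) (c : R) :
  fine (P n [set w | \det (M w) != 0 /\ E n (M w)]) @[n --> \oo] --> c ->
  P n [set w | E n (M w)] @[n --> \oo] --> c%:E.
Proof.
move=> nonsingular_cvg.
have meas n (B : set 'M[int]_n) : measurable [set w | B (M w)].
  exact: measurable_matrix_event (@symM n) (@M_meas n) B.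
pose nonsing n := [set w | \det (M w) != 0 /\ E n (M w)].
pose sing n := [set w | \det (M (n:=n) w) = 0].
have mE n : measurable [set w | E n (M w)] by exact: meas.
have mnonsing n : measurable (nonsing n) by exact: (meas n [set B | \det B != 0 /\ E n B]).
have msing n : measurable (sing n) by exact: (meas n [set B | \det B = 0]).
have fin n (A : set (Omega n)) : measurable A -> P n A \is a fin_num.
  by move=> mA; rewrite fin_num_measure.
apply: cvg_EFin; first by near=> n; exact: fin.
apply: (@squeeze_cvgr _ _ _ _ (fun n => fine (P n (nonsing n)))
  (fun n => fine (P n (nonsing n)) + fine (P n (sing n)))) => //; last first.
  by rewrite -[X in _ --> X]addr0; apply: cvgD => //; exact: prob_singular_cvg0.
near=> n; rewrite /=; apply/andP; split.
  by rewrite -lee_fin !fineK ?fin//; apply: le_measure; rewrite ?inE// => w [].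
rewrite -lee_fin EFinD !fineK ?fin//.
apply: (@le_trans _ _ (P n (nonsing n `|` sing n))); last exact: measureU2.
apply: le_measure; rewrite ?inE//; first exact: measurableU.
by move=> w Ew; have [det0|det_neq0] := eqVneq (\det (M w)) 0; [right|left].
Unshelve. all: by end_near. Qed.

End random_matrices.

(** * Homomorphisms onto a group with a duality pairing *)

Section duality_pairing.
Variables (G : zmodType) (bG : G -> G -> QmodZ).
Hypothesis duality : is_duality_pairing bG.

Lemma pairingC x y : bG x y = bG y x. Proof. by case: duality. Qed.

Lemma pairing_zmod_morphism x : zmod_morphism (bG x).
Proof.
have [_ pairingDl _] := duality.
by move=> y z; apply/eqP; rewrite eq_sym subr_eq !(pairingC x) -pairingDl subrK.
Qed.

Lemma pairing_additive y : exists f : {additive G -> QmodZ}, forall x, f x = bG x y.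
Proof.
pose f : {additive G -> QmodZ} :=
  HB.pack (bG y) (GRing.isZmodMorphism.Build _ _ (bG y) (pairing_zmod_morphism y)).
by exists f => x; rewrite pairingC.
Qed.

Lemma pairingMzl x y m : bG (x *~ m) y = bG x y *~ m.
Proof. by have [f fE] := pairing_additive y; rewrite -!fE raddfMz. Qed.

Lemma pairing_suml (I : finType) (F : I -> G) y : bG (\sum_i F i) y = \sum_i bG (F i) y.
Proof.
have [f fE] := pairing_additive y; rewrite -fE raddf_sum.
by apply: eq_bigr => i _; exact: fE.
Qed.

Lemma pairing0l y : bG 0 y = 0.
Proof. by have [f fE] := pairing_additive y; rewrite -fE raddf0. Qed.

Lemma pairing_inj x y : (forall z, bG x z = bG y z) -> x = y.
Proof.
have [_ _ represented] := duality; have [f fE] := pairing_additive x.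
have [a [_ a_uniq]] := represented f.
move=> xy; rewrite -(a_uniq x) => [|z]; last by rewrite fE pairingC.
by apply: a_uniq => z; rewrite fE -xy pairingC.
Qed.

End duality_pairing.

Section pairing_automorphisms.
Variables (G : finZmodType) (bG : G -> G -> QmodZ).

Lemma pairing_AutP (a : {perm G}) :
  reflect (zmod_morphism a /\ forall x y, bG (a x) (a y) = bG x y) (a \in pairing_Aut bG).
Proof.
rewrite inE; apply: (iffP andP) => [[a_Aut /forallP a_isom]|[a_zmod a_isom]].
  have aD : {morph a : x y / x + y}.
    move=> x y; have /morphicP aM := Aut_morphic a_Aut.
    exact: aM (finset.in_setT x) (finset.in_setT y).
  split=> [x y|x y]; last by apply/eqP; have /forallP := a_isom x.
  by apply/eqP; rewrite eq_sym subr_eq -aD subrK.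
split; last by apply/forallP => x; apply/forallP => y; rewrite a_isom.
pose aA : {additive G -> G} :=
  HB.pack (a : G -> G) (GRing.isZmodMorphism.Build _ _ (a : G -> G) a_zmod).
rewrite inE; apply/andP; split; first by apply/fintype.subsetP => x _; rewrite inE.
by apply/morphicP => x y _ _; exact: (raddfD aA).
Qed.

Lemma isometries_Aut (A : zmodType) (f f0 : {additive A -> G}) :
  bijective f -> bijective f0 -> (forall x y, bG (f x) (f y) = bG (f0 x) (f0 y)) ->
  exists2 a, a \in pairing_Aut bG & f =1 a \o f0.
Proof.
move=> f_bij [f0i f0K f0iK] f_isom.
have h_inj : injective (f \o f0i) := inj_comp (bij_inj f_bij) (can_inj f0iK).
exists (perm h_inj) => [|x]; last by rewrite /= permE /= f0K.
apply/pairing_AutP; split=> x y; rewrite !permE /=; last by rewrite f_isom !f0iK.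
by rewrite -raddfB; congr (f _); apply: (can_inj f0K); rewrite raddfB /= !f0iK.
Qed.

End pairing_automorphisms.

Section row_hom.
Variables (V : zmodType) (n : nat).

Definition row_hom (z : 'rV[V]_n) (v : 'cV[int]_n) : V := \sum_i z 0 i *~ v i 0.

Lemma row_hom_is_zmod_morphism z : zmod_morphism (row_hom z).
Proof. by move=> u v; rewrite /row_hom -sumrB; apply: eq_bigr => i _; rewrite !mxE mulrzBr. Qed.

HB.instance Definition _ z :=
  GRing.isZmodMorphism.Build 'cV[int]_n V (row_hom z) (row_hom_is_zmod_morphism z).

Lemma row_hom_delta z i : row_hom z (delta_mx i 0) = z 0 i.
Proof.
rewrite -[RHS]mulr1z -(sum_mulrz_single (z 0)); apply: eq_bigr => j _.
by rewrite mxE eqxx andbT; case: (j == i).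
Qed.

Lemma row_hom_map (a : {additive V -> V}) z v : row_hom (map_mx a z) v = a (row_hom z v).
Proof. by rewrite raddf_sum; apply: eq_bigr => i _; rewrite mxE raddfMz. Qed.

End row_hom.

Section presented_pairing.
Variables (G : finZmodType) (bG : G -> G -> QmodZ).
Hypothesis duality : is_duality_pairing bG.
Variables (p r : nat) (e : 'I_r -> nat) (g : 'I_r -> G).
Hypotheses (p_pr : prime p) (basis : ppower_basis p e g).
Local Notation ppow j := (p ^ j)%N%:Z.
Local Notation exponent := (\sum_a e a)%N.

Let ppow_gt0 j : (0 < p ^ j)%N. Proof. by rewrite expn_gt0 prime_gt0. Qed.
Let ppow_neq0 j : ppow j != 0. Proof. by rewrite -lt0n. Qed.
Let ppow_rat_neq0 j : (p ^ j)%:R != 0 :> rat. Proof. by rewrite pnatr_eq0 -lt0n. Qed.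
Let e_le a : (e a <= exponent)%N. Proof. by rewrite (bigD1 a)//= leq_addr. Qed.

Lemma basis_eq (c d : 'I_r -> int) :
  \sum_a g a *~ c a = \sum_a g a *~ d a <-> forall a, (ppow (e a) %| c a - d a)%Z.
Proof.
have -> : \sum_a g a *~ c a = \sum_a g a *~ d a <-> \sum_a g a *~ (c a - d a) = 0.
  under [X in _ <-> X = 0]eq_bigr do rewrite mulrzBr.
  by rewrite sumrB; split=> [->|/subr0_eq]; rewrite ?subrr.
exact: basis_rel basis _.
Qed.

Lemma basis_order a : g a *~ ppow (e a) = 0.
Proof.
by rewrite -sum_mulrz_single; apply/(basis_rel basis) => b; case: eqP => [->|].
Qed.

Lemma dual_basis_exists : exists k : 'I_r -> G, forall a (c : 'I_r -> int),
  bG (k a) (\sum_b g b *~ c b) = qz ((c a)%:~R / (p ^ e a)%:R).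
Proof.
suff repr a : exists k : G, forall c : 'I_r -> int,
    bG k (\sum_b g b *~ c b) = qz ((c a)%:~R / (p ^ e a)%:R).
  by have [k kP] := choice repr; exists k.
have /choice[c cE] := basis_gen basis.
pose f x : QmodZ := qz ((c x a)%:~R / (p ^ e a)%:R).
have fE (d : 'I_r -> int) : f (\sum_b g b *~ d b) = qz ((d a)%:~R / (p ^ e a)%:R).
  apply/qzP; rewrite -mulrBl -intrB int_divr_nat//.
  by apply: (basis_eq _ _).1; rewrite -cE.
have f_zmod : zmod_morphism f.
  move=> x y; rewrite {1}(cE x) {1}(cE y) -sumrB.
  under eq_bigr do rewrite -mulrzBr.
  by rewrite fE intrB mulrBl qzB.
pose fA : {additive G -> QmodZ} := HB.pack f (GRing.isZmodMorphism.Build _ _ f f_zmod).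
have [_ _ /(_ fA)[k [kP _]]] := duality.
by exists k => d; rewrite kP -fE.
Qed.

Definition dual_basis : 'I_r -> G := sval (cid dual_basis_exists).

Lemma dual_basisP a (c : 'I_r -> int) :
  bG (dual_basis a) (\sum_b g b *~ c b) = qz ((c a)%:~R / (p ^ e a)%:R).
Proof. exact: (svalP (cid dual_basis_exists)). Qed.

Lemma dual_matrix_exists : exists theta : 'M[int]_r,
  forall a, dual_basis a = \sum_b g b *~ theta a b.
Proof.
have /choice[c cE] a := basis_gen basis (dual_basis a).
by exists (\matrix_(a, b) c a b) => a; rewrite [LHS]cE; apply: eq_bigr => b _; rewrite mxE.
Qed.

Definition dual_matrix : 'M[int]_r := sval (cid dual_matrix_exists).
Local Notation theta := dual_matrix.

Lemma dual_matrixE a : dual_basis a = \sum_b g b *~ theta a b.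
Proof. exact: (svalP (cid dual_matrix_exists)). Qed.

Lemma pairing_dual_basis (d c : 'I_r -> int) :
  bG (\sum_a dual_basis a *~ d a) (\sum_b g b *~ c b) =
  qz (\sum_a (d a)%:~R * ((c a)%:~R / (p ^ e a)%:R)).
Proof.
rewrite pairing_suml// qz_sum; apply: eq_bigr => a _.
by rewrite pairingMzl// dual_basisP -qzMz -mulrzl.
Qed.

Lemma dual_basis_gen x : exists d : 'I_r -> int, x = \sum_a dual_basis a *~ d a.
Proof.
have /choice[d dE] a : exists d : int, bG x (g a) = qz (d%:~R / (p ^ e a)%:R).
  have [s sE] := qz_surj (bG x (g a)).
  have : qz (s *~ ppow (e a)) = 0.
    by rewrite qzMz -sE pairingC// -pairingMzl// basis_order pairing0l.
  move=> /qz_eq0/intrP[d dE]; exists d; rewrite -dE sE; congr qz.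
  by rewrite -mulrzr mulfK//; exact: ppow_rat_neq0.
exists d; apply: pairing_inj duality _ _ _ => z; have [c ->] := basis_gen basis z.
rewrite pairing_dual_basis pairingC// pairing_suml// qz_sum; apply: eq_bigr => a _.
by rewrite pairingMzl// pairingC// dE -qzMz -mulrzl mulrCA.
Qed.

Lemma dual_basis_rel (d : 'I_r -> int) : \sum_a dual_basis a *~ d a = 0 ->
  forall a, (ppow (e a) %| d a)%Z.
Proof.
move=> d0 a; rewrite -int_divr_nat//; apply/qz_eq0.
have := pairing_dual_basis d (fun b => if b == a then 1 else 0).
rewrite d0 pairing0l// (bigD1 a)//= eqxx big1 ?addr0 ?mul1r// => b /negbTE ->.
by rewrite mul0r mulr0.
Qed.

Lemma dual_matrix_sym a b :
  (ppow (e a + e b) %| ppow (e a) * theta a b - ppow (e b) * theta b a)%Z.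
Proof.
have : qz ((theta b a)%:~R / (p ^ e a)%:R) = qz ((theta a b)%:~R / (p ^ e b)%:R).
  by rewrite -!dual_basisP -!dual_matrixE pairingC.
move/esym/qzP; rewrite -(int_divr_nat _ (ppow_gt0 (e a + e b))).
congr (_ \is a Num.int); rewrite intrB !intrM expnD natrM.
rewrite -[(ppow (e a))%:~R]/((p ^ e a)%:R : rat) -[(ppow (e b))%:~R]/((p ^ e b)%:R : rat).
by field; rewrite !ppow_rat_neq0.
Qed.

Lemma dual_matrix_unit : map_mx intr theta \in @unitmx 'F_p r.
Proof.
have /choice[c cE] a := dual_basis_gen (g a).
pose C : 'M[int]_r := \matrix_(a, b) c a b.
suff /mulmx1_unit[] : (map_mx intr C : 'M['F_p]_r) *m map_mx intr theta = 1%:M by [].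
rewrite -map_mxM; apply/matrixP => a b; rewrite mxE [RHS]mxE; apply/subr0_eq.
have : \sum_b g b *~ (C *m theta) a b = \sum_b g b *~ (if b == a then 1 else 0).
  rewrite sum_mulrz_single mulr1z [RHS]cE.
  under [RHS]eq_bigr do rewrite dual_matrixE mulrz_suml.
  rewrite exchange_big; apply: eq_bigr => b' _ /=; rewrite mxE mulrz_sumr.
  by apply: eq_bigr => i _; rewrite mxE mulrC mulrzA.
move=> /basis_eq/(_ b) CthetaE.
have : (p%:Z %| (C *m theta) a b - (if b == a then 1 else 0))%Z.
  by apply: dvdz_trans CthetaE; rewrite dvdzE /= dvdn_exp// (basis_exp_gt0 basis).
by rewrite -intr_Fp_eq0// intrB (eq_sym b) => /eqP; case: (a == b).
Qed.

Lemma mulrz_exponent (x : G) : x *~ ppow exponent = 0.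
Proof.
have [c ->] := basis_gen basis x; rewrite mulrz_suml big1// => a _.
rewrite -(subnK (e_le a)) expnD PoszM -mulrzA mulrA [_ * ppow (e a)]mulrC mulrzA.
by rewrite basis_order mul0rz.
Qed.

Definition images n (y : 'M[int]_(r, n)) : 'rV[G]_n := \row_i \sum_a g a *~ y a i.

Lemma row_hom_images n (y : 'M[int]_(r, n)) v :
  row_hom (images y) v = \sum_a g a *~ (y *m v) a 0.
Proof.
rewrite /row_hom; under eq_bigr do rewrite mxE mulrz_suml.
rewrite exchange_big; apply: eq_bigr => a _ /=; rewrite mxE mulrz_sumr.
by apply: eq_bigr => i _; rewrite mulrzA.
Qed.

Definition dual_congruences n (y : 'M[int]_(r, n)) (M : 'M[int]_n) : Prop :=
  (forall a i, (ppow (e a) %| (y *m M) a i)%Z) /\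
  (forall a b, (ppow (e a + e b) %| (y *m M *m y^T) a b - ppow (e a) * theta a b)%Z).

Definition dual_rows n (y : 'M[int]_(r, n)) (M : 'M[int]_n) : 'M[int]_(r, n) :=
  \matrix_(a, i) ((y *m M) a i %/ ppow (e a))%Z.

Section divisible_rows.
Variables (n : nat) (M : 'M[int]_n) (y : 'M[int]_(r, n)).
Hypothesis symM : M^T = M.
Hypothesis rows_dvd : forall a i, (ppow (e a) %| (y *m M) a i)%Z.
Local Notation H := (dual_rows y M).

Lemma dual_rowsE a i : (y *m M) a i = ppow (e a) * H a i.
Proof. by rewrite [H _ _]mxE mulrC divzK. Qed.

Lemma dual_rows_gram a b :
  (ppow (e b) %| (H *m y^T) a b - theta a b)%Z =
  (ppow (e a + e b) %| (y *m M *m y^T) a b - ppow (e a) * theta a b)%Z.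
Proof.
rewrite -[LHS](@dvdz_mul2l (ppow (e a)))// -PoszM -expnD mulrBr.
congr (_ %| _ - _)%Z; rewrite mxE [RHS]mxE mulr_sumr; apply: eq_bigr => i _.
by rewrite dual_rowsE mulrA.
Qed.

Lemma row_hom_images_col s : row_hom (images y) (M *m s) = 0.
Proof.
rewrite row_hom_images; apply/(basis_rel basis) => a; rewrite mulmxA mxE.
by apply: dvdz_sum => i; rewrite dual_rowsE -mulrA dvdz_mulr.
Qed.

Lemma reduced_kernel :
  (map_mx intr y : 'M['F_p]_(r, n)) *m (map_mx intr M : 'M['F_p]_n) = 0.
Proof.
rewrite -map_mxM; apply/matrixP => a i; rewrite mxE dual_rowsE [RHS]mxE.
apply/eqP; rewrite intr_Fp_eq0// dvdz_mulr// dvdzE /= dvdn_exp//.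
exact: basis_exp_gt0 basis _.
Qed.

Lemma mul_dual (d : 'cV[int]_r) :
  M *m (y^T *m d) = H^T *m \col_a (ppow (e a) * d a 0).
Proof.
rewrite mulmxA -{1}symM -trmx_mul; apply/matrixP => i j; rewrite !mxE.
apply: eq_bigr => a _; rewrite [(y *m M)^T i a]mxE dual_rowsE !mxE (ord1 j).
by rewrite mulrCA mulrA.
Qed.

Definition cofactor_col (d : 'cV[int]_r) : 'cV[int]_r :=
  \col_a (ppow (exponent - e a) * d a 0).

Lemma mul_dual_exponent (d : 'cV[int]_r) :
  M *m (y^T *m cofactor_col d) = (H^T *m d) *~ ppow exponent.
Proof.
rewrite mul_dual -mulmxMz; congr (_ *m _); apply/colP => a.
by rewrite mulrz_scale mxE [X in _ * X]mxE [RHS]mxE mulrA -PoszM -expnD subnKC.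
Qed.

Hypothesis dual_gram : forall a b, (ppow (e b) %| (H *m y^T) a b - theta a b)%Z.

Lemma row_hom_images_dual d :
  row_hom (images y) (H^T *m d) = \sum_a dual_basis a *~ d a 0.
Proof.
rewrite row_hom_images; under [RHS]eq_bigr do rewrite dual_matrixE mulrz_suml.
rewrite exchange_big /=.
under [RHS]eq_bigr do (under eq_bigr do rewrite -mulrzA; rewrite -mulrz_sumr).
apply/basis_eq => b; rewrite mulmxA mxE -sumrB.
apply: dvdz_sum => a; rewrite -mulrBl dvdz_mulr//.
have -> : y *m H^T = (H *m y^T)^T by rewrite trmx_mul trmxK.
by rewrite mxE.
Qed.

Lemma reduced_dual_unit :
  map_mx intr H *m (map_mx intr y)^T \in @unitmx 'F_p r.
Proof.
rewrite map_trmx -map_mxM.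
suff -> : map_mx intr (H *m y^T) = map_mx intr theta :> 'M['F_p]_r by exact: dual_matrix_unit.
apply/matrixP => a b; rewrite mxE [RHS]mxE; apply/subr0_eq/eqP.
rewrite -rmorphB /= intr_Fp_eq0//; apply: dvdz_trans (dual_gram a b).
by rewrite dvdzE /= dvdn_exp// (basis_exp_gt0 basis).
Qed.

Lemma corank_splitting : (n - \rank (map_mx intr M : 'M['F_p]_n))%N = r <->
  exists m (Z : 'M[int]_(n + r, n)), ~~ (p%:Z %| m)%Z /\ row_mx M H^T *m Z = m%:M.
Proof.
rewrite -(row_free_mod_inverse _ p_pr) map_row_mx -map_trmx.
split; first exact: corank_row_free reduced_kernel reduced_dual_unit.
exact: row_free_corank reduced_kernel reduced_dual_unit.
Qed.

Variables (m : int) (Z : 'M[int]_(n + r, n)).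
Hypotheses (p_ndvd : ~~ (p%:Z %| m)%Z) (splitting : row_mx M H^T *m Z = m%:M).
Local Notation X := (usubmx Z).
Local Notation X' := (dsubmx Z).

Lemma split_vector (v : 'cV[int]_n) : v *~ m = M *m (X *m v) + H^T *m (X' *m v).
Proof.
by rewrite !mulmxA -mulmxDl -mul_row_col vsubmxK splitting mul_scalar_mx mulrz_scale.
Qed.

Lemma split_vector_exponent (v : 'cV[int]_n) : v *~ (m * ppow exponent) =
  M *m ((X *m v) *~ ppow exponent + y^T *m cofactor_col (X' *m v)).
Proof. by rewrite mulrzA split_vector mulrzDl -mul_dual_exponent -(mulmxMz M) -mulmxDr. Qed.

Lemma split_det_neq0 : \det M != 0.
Proof.
have [S MS] : exists S, M *m S = (m * ppow exponent)%:M.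
  apply: mulmx_col_choice => j; eexists.
  exact: etrans (esym (split_vector_exponent (delta_mx j 0))) (esym (col_scalar_int _ _)).
apply/eqP => det0; have := congr1 determinant MS.
rewrite det_mulmx det0 mul0r det_scalar => /esym/eqP.
rewrite expf_eq0 mulf_eq0 (negbTE (ppow_neq0 _)) orbF => /andP[_ /eqP m0].
by move: p_ndvd; rewrite m0 dvdz0.
Qed.

Lemma split_row_hom_kernel (v : 'cV[int]_n) : row_hom (images y) v = 0 ->
  exists s, v *~ m = M *m s.
Proof.
move=> v0; have : row_hom (images y) (v *~ m) = 0 by rewrite raddfMz /= v0 mul0rz.
rewrite split_vector raddfD /= row_hom_images_col add0r row_hom_images_dual.
move=> /dual_basis_rel coord_dvd.
pose d : 'cV[int]_r := \col_a ((X' *m v) a ord0 %/ ppow (e a))%Z.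
have dE : X' *m v = \col_a (ppow (e a) * d a 0).
  by apply/colP => a; rewrite [RHS]mxE [X in _ * X]mxE mulrC divzK.
by exists (X *m v + y^T *m d); rewrite mulmxDr mul_dual -dE.
Qed.

Lemma split_dot (v v' s : 'cV[int]_n) j : M *m s = v *~ ppow j ->
  (dot s v')%:~R / (p ^ j)%:R *~ m = (dot (X *m v) v')%:~R +
    \sum_a ((X' *m v) a 0)%:~R * (((y *m v') a 0)%:~R / (p ^ e a)%:R) :> rat.
Proof.
move=> MsE; set u := X *m v; set d := X' *m v.
have : s *~ (m * ppow exponent) = (u *~ ppow exponent + y^T *m cofactor_col d) *~ ppow j.
  apply: (mulmx_det_inj split_det_neq0); rewrite !mulmxMz -split_vector_exponent MsE.
  by rewrite -!mulrzA mulrC.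
move=> /(congr1 (fun t : 'cV_n => dot t v'))/(congr1 (intr : int -> rat)) /=.
rewrite !dotMzl dotDl dotMzl dot_mul_trmx !intrM intrD intrM rmorph_sum /=.
have -> : \sum_a (cofactor_col d a 0 * (y *m v') a 0)%:~R =
    (p ^ exponent)%:R * \sum_a (d a 0)%:~R * (((y *m v') a 0)%:~R / (p ^ e a)%:R) :> rat.
  rewrite mulr_sumr; apply: eq_bigr => a _; rewrite mxE !intrM.
  have -> : (p ^ exponent)%:R = (p ^ (exponent - e a))%:R * (p ^ e a)%:R :> rat.
    by rewrite -natrM -expnD subnK.
  rewrite -[(ppow _)%:~R]/((p ^ (exponent - e a))%:R : rat).
  by field; rewrite !ppow_rat_neq0.
rewrite -![(ppow _)%:~R]/((p ^ _)%:R : rat) -mulrDr => dotE.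
apply: (mulfI (mulf_neq0 (ppow_rat_neq0 exponent) (ppow_rat_neq0 j))).
rewrite -mulrzl -[RHS]mulrA [RHS]mulrCA -dotE.
by field; rewrite ppow_rat_neq0.
Qed.

Lemma split_pairing (v v' s : 'cV[int]_n) j : M *m s = v *~ ppow j ->
  bG (row_hom (images y) v) (row_hom (images y) v') = qz ((dot s v')%:~R / (p ^ j)%:R).
Proof.
move=> MsE; apply/subr0_eq.
apply: (coprimez_torsion (coprimez_ppower (exponent + j) p_pr p_ndvd)).
  rewrite mulrzBl -pairingMzl// -qzMz -raddfMz /= split_vector raddfD /= row_hom_images_col.
  rewrite add0r row_hom_images_dual [row_hom _ v']row_hom_images pairing_dual_basis -qzB.
  rewrite (split_dot _ MsE) opprD addrCA subrr addr0; apply/qz_eq0.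
  by rewrite rpredN; apply/intrP; eexists.
rewrite mulrzBl expnD PoszM mulrzA -pairingMzl// mulrz_exponent pairing0l// mul0rz sub0r.
rewrite [ppow exponent * _]mulrC mulrzA -qzMz -mulrzr divfK; last exact: ppow_rat_neq0.
have -> : qz (dot s v')%:~R = 0 by apply/qz_eq0/intrP; eexists.
by rewrite mul0rz oppr0.
Qed.

End divisible_rows.

Definition induces_isometry n (M : 'M[int]_n) (z : 'rV[G]_n)
    (f : {additive sylow p (cok M) -> G}) : Prop :=
  [/\ bijective f, forall x x', bG (f x) (f x') = sylow_pairing x x' &
      forall x v, sylow_val x = cok_class M v -> f x = row_hom z v].

Lemma dual_congruences_isometry n (y : 'M[int]_(r, n)) (M : 'M[int]_n) : M^T = M ->
  dual_congruences y M -> (n - \rank (map_mx intr M : 'M['F_p]_n))%N = r ->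
  \det M != 0 /\ exists f : {additive sylow p (cok M) -> G}, induces_isometry (images y) f.
Proof.
move=> symM [rows_dvd gram_dvd].
have dual_gram a b : (ppow (e b) %| (dual_rows y M *m y^T) a b - theta a b)%Z.
  by rewrite dual_rows_gram.
move=> /(corank_splitting rows_dvd dual_gram)[m [Z [p_ndvd splitting]]].
split; first exact: split_det_neq0 p_ndvd splitting.
have [f fE] := sylow_hom_factor p (row_hom_images_col rows_dvd); exists f.
have f_inj : injective f.
  apply: raddf_inj => x; have [v xE] := sylow_lift x; rewrite (fE x v)//.
  move=> /(split_row_hom_kernel symM rows_dvd dual_gram splitting)[s vs].
  apply: val_inj; rewrite /= xE; have [s' [j MsE]] := sylow_torsion xE.
  apply: (coprimez_torsion (coprimez_ppower j p_pr p_ndvd)); rewrite -cok_classMz.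
    by apply/cok_class_eq0; exists s.
  by apply/cok_class_eq0; exists s'.
have /choice[fi fiK] x : exists z, f z = x.
  have [d ->] := dual_basis_gen x.
  have [z zE] := sylow_of_torsion (mul_dual_exponent symM rows_dvd (\col_a d a)).
  exists z; rewrite (fE _ _ zE) /= row_hom_images_dual//.
  by apply: eq_bigr => a _; rewrite mxE.
split=> [|x x'|]; last exact: fE.
  by exists fi => // x; apply: f_inj; rewrite fiK.
have [v xE] := sylow_lift x; have [v' x'E] := sylow_lift x'.
have [s [j MsE]] := sylow_torsion xE.
rewrite (fE x v)// (fE x' v')// (sylow_pairingE p_pr symM xE x'E MsE).
exact: split_pairing p_ndvd splitting _ _ _ _ MsE.
Qed.

Section isometry_congruences.
Variables (n : nat) (M : 'M[int]_n) (y : 'M[int]_(r, n)).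
Variable f : {additive sylow p (cok M) -> G}.
Hypotheses (symM : M^T = M) (induces : induces_isometry (images y) f).
Local Notation H := (dual_rows y M).

Lemma isometry_rows_dvd a i : (ppow (e a) %| (y *m M) a i)%Z.
Proof.
have [_ _ fE] := induces.
have : row_hom (images y) (M *m delta_mx i 0) = 0.
  by rewrite -(fE 0) ?raddf0//=; apply/esym/cok_class_eq0; exists (delta_mx i 0).
by rewrite row_hom_images => /(basis_rel basis)/(_ a); rewrite mulmxA -colE mxE.
Qed.

Lemma isometry_dual_basis a : row_hom (images y) (H^T *m delta_mx a 0) = dual_basis a.
Proof.
have [[fi _ fiK] f_isom fE] := induces.
have torsion : M *m (y^T *m delta_mx a 0) = (H^T *m delta_mx a 0) *~ ppow (e a) :> 'cV_n.
  rewrite (mul_dual symM isometry_rows_dvd) -mulmxMz; congr (_ *m _); apply/colP => b.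
  by rewrite mulrz_scale !mxE eqxx andbT; case: eqP => [->|_]; rewrite ?mulr0.
have [x xE] := sylow_of_torsion torsion; rewrite -(fE x)//.
apply: (pairing_inj duality) => z; rewrite -(fiK z) f_isom.
have [v fizE] := sylow_lift (fi z); rewrite (sylow_pairingE p_pr symM xE fizE torsion).
rewrite (fE _ _ fizE) row_hom_images dual_basisP; congr (qz (_%:~R / _)).
by rewrite /dot trmx_mul trmxK -mulmxA trmx_delta -rowE mxE.
Qed.

Lemma isometry_dual_gram a b : (ppow (e b) %| (H *m y^T) a b - theta a b)%Z.
Proof.
have := isometry_dual_basis a; rewrite row_hom_images dual_matrixE => /basis_eq/(_ b).
rewrite mulmxA -colE mxE.
have -> : y *m H^T = (H *m y^T)^T by rewrite trmx_mul trmxK.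
by rewrite mxE.
Qed.

Lemma isometry_corank : \det M != 0 -> (n - \rank (map_mx intr M : 'M['F_p]_n))%N = r.
Proof.
have [[fi fK _] _ fE] := induces.
move=> /(mulmx_ppower_coprime p_pr)[u [m [W [p_ndvd MW]]]].
apply/(corank_splitting isometry_rows_dvd isometry_dual_gram).
suff [Z ZE] : exists Z, row_mx M H^T *m Z = m%:M by exists m, Z.
apply: mulmx_col_choice => j; rewrite col_scalar_int.
have [d dE] := dual_basis_gen (row_hom (images y) (delta_mx j 0)).
pose v := delta_mx j 0 - H^T *m \col_a d a.
have v0 : row_hom (images y) v = 0.
  rewrite raddfB /= dE (row_hom_images_dual isometry_dual_gram) -sumrB big1// => a _.
  by rewrite mxE subrr.
have torsion : M *m (W *m v) = (v *~ m) *~ ppow u.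
  by rewrite mulmxA MW mul_scalar_mx -mulrzA mulrC mulrz_scale.
have [x xE] := sylow_of_torsion torsion.
have : f x = f 0 by rewrite raddf0 (fE _ _ xE) raddfMz /= v0 mul0rz.
move=> /(can_inj fK) x0; move: xE; rewrite x0 => /esym/cok_class_eq0[s vmE].
exists (col_mx s ((\col_a d a) *~ m)).
by rewrite mul_row_col -vmE mulmxMz -mulrzDl subrK.
Qed.

Lemma isometry_dual_congruences : dual_congruences y M.
Proof.
split; first exact: isometry_rows_dvd.
by move=> a b; rewrite -(dual_rows_gram isometry_rows_dvd) isometry_dual_gram.
Qed.

End isometry_congruences.

Section isometries.
Variables (n : nat) (M : 'M[int]_n).
Hypothesis det_neq0 : \det M != 0.

Lemma sylow_delta_lifts : exists (m : int) (x : 'I_n -> sylow p (cok M)),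
  ~~ (p%:Z %| m)%Z /\ forall i, sylow_val (x i) = cok_class M (delta_mx i 0 *~ m).
Proof.
have [u [m [W [p_ndvd MW]]]] := mulmx_ppower_coprime p_pr det_neq0.
have /choice[x xE] i : exists x : sylow p (cok M),
    sylow_val x = cok_class M (delta_mx i 0 *~ m).
  apply: (@sylow_of_torsion _ _ _ _ (W *m delta_mx i 0) u).
  by rewrite mulmxA MW mul_scalar_mx -mulrzA mulrC mulrz_scale.
by exists m, x.
Qed.

Lemma isometry_induced (f : {additive sylow p (cok M) -> G}) : bijective f ->
  (forall x x', bG (f x) (f x') = sylow_pairing x x') ->
  exists z, induces_isometry z f.
Proof.
move=> f_bij f_isom; have [m [x [p_ndvd xE]]] := sylow_delta_lifts.
have /coprimezP[[m' t] /= bezout] := coprimez_ppower exponent p_pr p_ndvd.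
exists (\row_i (f (x i) *~ m')); split=> // w v wE.
have -> : row_hom (\row_i (f (x i) *~ m')) v = f (\sum_i x i *~ v i 0) *~ m'.
  rewrite raddf_sum /= mulrz_suml; apply: eq_bigr => i _.
  by rewrite mxE raddfMz /= mulrzAC.
have -> : \sum_i x i *~ v i 0 = w *~ m.
  apply: val_inj; rewrite raddf_sum /= sylow_valMz wE -cok_classMz.
  under eq_bigr do rewrite sylow_valMz xE -cok_classMz.
  rewrite -(big_morph (cok_class M) (@cok_classD _ M) (cok_class0 M)).
  congr cok_class; rewrite [in RHS](matrix_sum_delta v) mulrz_suml; apply: eq_bigr => i _.
  by rewrite big_ord1 -!mulrz_scale -!mulrzA mulrC.
rewrite raddfMz /= -mulrzA -[LHS]mulr1z -bezout mulrzDr [t * _]mulrC.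
by rewrite [f w *~ (_ * t)]mulrzA mulrz_exponent mul0rz addr0 mulrC.
Qed.

Lemma induced_images_uniq z z' (f f' : {additive sylow p (cok M) -> G}) :
  induces_isometry z f -> induces_isometry z' f' -> f =1 f' -> z = z'.
Proof.
move=> [_ _ fE] [_ _ f'E] ff'; have [m [x [p_ndvd xE]]] := sylow_delta_lifts.
apply/rowP => i; apply/subr0_eq.
apply: (coprimez_torsion (coprimez_ppower exponent p_pr p_ndvd)); last exact: mulrz_exponent.
by rewrite mulrzBl -!row_hom_delta -!raddfMz /= -(fE _ _ (xE i)) -(f'E _ _ (xE i)) ff' subrr.
Qed.

End isometries.

Definition isometry_images n (M : 'M[int]_n) : {set 'rV[G]_n} :=
  [set z | `[< exists f : {additive sylow p (cok M) -> G}, induces_isometry z f >]]%SET.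

Lemma card_isometry_images n (M : 'M[int]_n) : \det M != 0 ->
  #|isometry_images M| =
  (`[< pairing_isomorphic (@sylow_pairing p n M) bG >] * #|pairing_Aut bG|)%N.
Proof.
move=> det_neq0; case: asboolP => [[f0 f0_bij f0_isom]|not_iso]; last first.
  apply/eqP; rewrite cards_eq0; apply/eqP/setP => z; rewrite !inE.
  by apply/asboolP => -[f [f_bij f_isom _]]; apply: not_iso; exists f.
have [z0 z0_f0] := isometry_induced det_neq0 f0_bij f0_isom; rewrite mul1n.
have [[f0i _ f0iK] _ f0E] := z0_f0.
have Aut_f0 (a : {perm G}) : a \in pairing_Aut bG ->
    exists2 f, induces_isometry (map_mx a z0) f & f =1 a \o f0.
  move=> /pairing_AutP[a_zmod a_isom].
  pose aA : {additive G -> G} :=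
    HB.pack (a : G -> G) (GRing.isZmodMorphism.Build _ _ (a : G -> G) a_zmod).
  exists (aA \o f0) => //; split=> [|x y|x v xE].
  - exact: bij_comp (injF_bij perm_inj) f0_bij.
  - by rewrite /= a_isom f0_isom.
  - by rewrite /= (f0E _ _ xE); exact: esym (row_hom_map aA z0 v).
have map_inj : {in pairing_Aut bG &, injective (fun a : {perm G} => map_mx a z0)}.
  move=> a b /Aut_f0[f [_ _ fE] f_a] /Aut_f0[f' [_ _ f'E] f'_b] ab.
  apply/permP => x; rewrite -(f0iK x); have [v xE] := sylow_lift (f0i x).
  by rewrite -[LHS]f_a -[RHS]f'_b (fE _ _ xE) (f'E _ _ xE) ab.
rewrite -(card_in_imset map_inj); apply: eq_card => z; rewrite inE.
apply/asboolP/imsetP => [[f z_f]|[a /Aut_f0[f map_f _] ->]]; last by exists f.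
have [f_bij f_isom _] := z_f.
have f_f0 x y : bG (f x) (f y) = bG (f0 x) (f0 y) by rewrite f_isom f0_isom.
have [a a_Aut f_a] := isometries_Aut f_bij f0_bij f_f0.
exists a => //; have [f' map_f' f'_a] := Aut_f0 _ a_Aut.
apply: (induced_images_uniq det_neq0 z_f map_f') => x.
by rewrite f_a f'_a.
Qed.

Section pairing_system.
Variable l : nat.
Hypothesis exps_le : forall a b, (e a + e b <= l.+1)%N.
Local Notation q := (p ^ l.+1)%N.
Local Notation q_gt1 := (prime_power_gt1 l p_pr).
Local Notation kercard := (kercard (l := l) p_pr).

Let exp_le a : (e a <= l.+1)%N. Proof. exact: leq_trans (leq_addr _ _) (exps_le a a). Qed.

(* The weights p^(l+1-j) express divisibility by p^j of a residue modulo q. *)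
Definition pairing_system : congruence_system q r := {|
  row_weight a := (p ^ (l.+1 - e a))%:R;
  gram_weight a b := (p ^ (l.+1 - (e a + e b)))%:R;
  gram_target a b := (ppow (e a) * theta a b)%:~R |}.

Lemma solves_pairing_system n (y : 'M[int]_(r, n)) (M : 'M[int]_n) :
  solves pairing_system (map_mx intr y) (map_mx intr M) <-> dual_congruences y M.
Proof.
rewrite /solves -!map_mxM; split=> [/andP[/forallP rows0 /forallP gram0]|[rows_dvd gram_dvd]].
  split=> [a i|a b]; first by have /forallP/(_ a) := rows0 i; rewrite mxE ppower_mul_intr_eq0.
  by have := gram0 (a, b); rewrite /= map_trmx -map_mxM mxE -intrB ppower_mul_intr_eq0.
apply/andP; split.
  by apply/forallP => i; apply/forallP => a; rewrite mxE ppower_mul_intr_eq0.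
by apply/forallP => -[a b]; rewrite /= map_trmx -map_mxM mxE -intrB ppower_mul_intr_eq0.
Qed.

Lemma pairing_system_weights_reduce : row_weights_reduce p_pr pairing_system.
Proof.
move=> a x; rewrite -(intr_val_Zp x) => /eqP; rewrite ppower_mul_intr_eq0// => x_dvd.
apply/eqP; rewrite rmorph_int intr_Fp_eq0//; apply: dvdz_trans x_dvd.
by rewrite dvdzE /= dvdn_exp// (basis_exp_gt0 basis).
Qed.

Lemma pairing_system_forces_row_free : forces_row_free p_pr pairing_system.
Proof.
move=> n Y M _; rewrite -(int_liftK Y) -(int_liftK M).
move=> /solves_pairing_system[rows_dvd gram_dvd]; rewrite map_red_intr.
apply: (dual_row_free (H := map_mx intr (dual_rows (int_lift Y) (int_lift M)))).
by apply: reduced_dual_unit => a b; rewrite dual_rows_gram.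
Qed.

Lemma kercard_intr n (M : 'M[int]_n) : (kercard (map_mx intr M) == p ^ r)%N =
  ((n - \rank (map_mx intr M : 'M['F_p]_n))%N == r).
Proof. by rewrite kercardE map_red_intr eqn_exp2l ?prime_gt1. Qed.

Lemma solves_isometry_images n (M : 'M[int]_n) (Y : 'M['Z_q]_(r, n)) : M^T = M ->
  solves pairing_system Y (map_mx intr M) && (kercard (map_mx intr M) == p ^ r)%N =
  (\det M != 0) && (images (int_lift Y) \in isometry_images M).
Proof.
move=> symM; rewrite kercard_intr -{1}(int_liftK Y) inE; apply/andP/andP.
  move=> [/solves_pairing_system congs /eqP corankM].
  have [det_neq0 induces] := dual_congruences_isometry symM congs corankM.
  by split=> //; apply/asboolP.
move=> [det_neq0 /asboolP[f induces]].
split; last by apply/eqP; exact: isometry_corank symM induces det_neq0.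
by apply/solves_pairing_system; exact: isometry_dual_congruences induces.
Qed.

Lemma annihilator_count_pairing_system : (annihilator_count pairing_system * #|G| = q ^ r)%N.
Proof.
rewrite (basis_card basis) -big_split /= (eq_bigr (fun=> q)) => [|a _]; last first.
  by rewrite card_annihilator_ppower ?leq_subr// -expnD subnK.
by rewrite prod_nat_const card_ord.
Qed.

Lemma images_int_lift n (y : 'M[int]_(r, n)) :
  images (int_lift (map_mx intr y : 'M['Z_q]_(r, n))) = images y.
Proof.
apply/rowP => i; rewrite !mxE; apply/basis_eq => a; rewrite !mxE.
apply: (@dvdz_trans q%:Z); first by rewrite dvdzE /= dvdn_exp2l.
by rewrite -intr_Zp_eq0 ?q_gt1// intrB intr_val_Zp subrr.
Qed.

Lemma card_images n (z : 'rV[G]_n) :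
  #|[pred Y : 'M['Z_q]_(r, n) | images (int_lift Y) == z]| =
  (annihilator_count pairing_system ^ n)%N.
Proof.
pose f (Y : 'M['Z_q]_(r, n)) := images (int_lift Y).
have f_zmod : zmod_morphism f.
  move=> Y Y'; rewrite -{1}(int_liftK Y) -{1}(int_liftK Y') -map_mxB /f images_int_lift.
  apply/rowP => i; rewrite !mxE -sumrB; apply: eq_bigr => a _.
  by rewrite !mxE mulrzBr.
pose fA : {additive 'M['Z_q]_(r, n) -> 'rV[G]_n} :=
  HB.pack f (GRing.isZmodMorphism.Build _ _ f f_zmod).
have f_surj z' : exists Y, fA Y = z'.
  have /choice[c cE] i := basis_gen basis (z' 0 i).
  exists (map_mx intr (\matrix_(a, i) c i a)); rewrite [LHS]images_int_lift; apply/rowP => i.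
  by rewrite mxE [RHS]cE; apply: eq_bigr => a _; rewrite mxE.
have G_gt0 : (0 < #|G| ^ n)%N by rewrite expn_gt0; apply/orP; left; apply/card_gt0P; exists 0.
apply/eqP; rewrite -(eqn_pmul2r G_gt0) -expnMn annihilator_count_pairing_system -expnM.
by rewrite -(card_mx_Zq l p_pr r n) -(card_surj_fiber z f_surj) card_mx mul1n.
Qed.

Lemma card_images_in n (S : {set 'rV[G]_n}) :
  #|[pred Y : 'M['Z_q]_(r, n) | images (int_lift Y) \in S]| =
  (#|S| * annihilator_count pairing_system ^ n)%N.
Proof.
rewrite -[LHS]sum1_card (partition_big (fun Y => images (int_lift Y)) (mem S)) //=.
rewrite -sum_nat_const; apply: eq_bigr => z z_S; rewrite sum1_card -(card_images z).
by apply: eq_card => Y; rewrite !inE [in LHS]/in_mem /=; apply: andb_idl => /eqP ->.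
Qed.

Lemma pairing_solution_count n (M : 'M[int]_n) : M^T = M ->
  (solution_count pairing_system (map_mx intr M) * (kercard (map_mx intr M) == p ^ r) =
   `[< \det M != 0 /\ pairing_isomorphic (@sylow_pairing p n M) bG >] *
     (#|pairing_Aut bG| * annihilator_count pairing_system ^ n))%N.
Proof.
move=> symM; transitivity ((\det M != 0) *
    #|[pred Y : 'M['Z_q]_(r, n) | images (int_lift Y) \in isometry_images M]|)%N.
  rewrite /solution_count -!sum1_card big_distrl big_distrr /= big_mkcond [RHS]big_mkcond /=.
  apply: eq_bigr => Y _; have := solves_isometry_images Y symM; rewrite !inE.
  by case: solves; case: (_ == _); case: (_ != _); case: asbool.
rewrite card_images_in; have [det0|det_neq0] := eqVneq (\det M) 0.
  by case: asboolP => [[/eqP]|].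
rewrite card_isometry_images// mul1n -mulnA; congr (nat_of_bool _ * _)%N.
by apply: asbool_equiv_eq; split=> [|[]].
Qed.

Lemma corner_count_pairing_system : corner_count pairing_system =
  (\prod_(u : upper_index r) p ^ (l.+1 - (e (val u).1 + e (val u).2)))%N.
Proof.
pose S a b : {set 'Z_q} := [set x | gram_weight pairing_system a b *
  (x - gram_target pairing_system a b) == 0]%SET.
have symS a b : S a b = S b a.
  apply/setP => x; rewrite !inE /= -(intr_val_Zp x) -!intrB (addnC (e b)).
  rewrite !ppower_mul_intr_eq0// -[RHS](rpredBr _ (dual_matrix_sym a b)).
  by congr (_ %| _)%Z; rewrite opprB addrA subrK.
have cardS a b : #|S a b| = (p ^ (l.+1 - (e a + e b)))%N.
  rewrite -(card_annihilator_ppower p_pr (leq_subr (e a + e b) l.+1)).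
  rewrite -[RHS](card_imset _ (addIr (gram_target pairing_system a b))).
  apply: eq_card => x; rewrite [LHS]inE; apply/idP/imsetP => [x_S|[t]].
    by exists (x - gram_target pairing_system a b); rewrite ?inE// subrK.
  by rewrite inE => t0 ->; rewrite addrK.
under eq_bigr do rewrite -cardS; rewrite -(card_sym_mx_family symS).
apply: eq_card => A; rewrite !inE; congr (_ && _).
rewrite /solves trmx1 !mulmx1 mul1mx; apply/andP/forallP => [[_ /forallP gramA] a|gramA].
  by apply/forallP => b; rewrite inE; exact: gramA (a, b).
split; last by apply/forallP => -[a b]; have /forallP/(_ b) := gramA a; rewrite inE.
apply/forallP => b; apply/forallP => a; have /forallP/(_ b) := gramA a; rewrite inE /=.
rewrite -(intr_val_Zp (A a b)) -intrB !ppower_mul_intr_eq0// => Aab_dvd.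
have : (ppow (e a) %| (A a b : nat)%:Z - ppow (e a) * theta a b)%Z.
  by apply: dvdz_trans Aab_dvd; rewrite dvdzE /= dvdn_exp2l// leq_addr.
by rewrite rpredBr// dvdz_mulr.
Qed.

Lemma solution_density_pairing_system (R : realType) :
  solution_density R pairing_system = (#|G|%:R)^-1.
Proof.
have cardG_gt0 : (0 < #|G|)%N by apply/card_gt0P; exists 0.
have cornerE : (corner_count pairing_system * #|G| ^ r.+1 = q ^ #|upper_index r|)%N.
  have prod_expn (I : finType) (f : I -> nat) : (\prod_i p ^ f i = p ^ \sum_i f i)%N.
    by rewrite (big_morph _ (expnD p) (expn0 p)).
  rewrite corner_count_pairing_system (basis_card basis) (prod_expn _ e) -expnM.
  rewrite [(_ * r.+1)%N]mulnC -sum_upper_index_ends -prod_expn -big_split /=.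
  rewrite (eq_bigr (fun=> q)) => [|u _]; first by rewrite prod_nat_const.
  by rewrite -expnD subnK.
rewrite /solution_density -cornerE expnM -annihilator_count_pairing_system expnMn.
have neq0 (m : nat) : (0 < m)%N -> m%:R != 0 :> R by rewrite pnatr_eq0 lt0n.
have corner_neq0 : (corner_count pairing_system)%:R != 0 :> R.
  apply: neq0; have : (0 < q ^ #|upper_index r|)%N by rewrite !expn_gt0 prime_gt0.
  by rewrite -cornerE muln_gt0 => /andP[].
rewrite !natrM !natrX exprS; field.
by rewrite corner_neq0 !expf_neq0// neq0// annihilator_count_gt0.
Qed.

Lemma prob_nonsingular_isometric (R : realType) (d : measure_display) (T : measurableType d)
    (P : probability T R) n (M : T -> 'M[int]_n) :
  (forall t, (M t)^T = M t) -> (forall u, int_random_variable (upper_entry M u)) ->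
  mutually_independent P (upper_entry M) ->
  P [set t | \det (M t) != 0 /\ pairing_isomorphic (@sylow_pairing p n (M t)) bG] =
  (expect (residue_law P M (p:=p) (l:=l))
      (weighted_count p_pr pairing_system (corank_indicator R p r) (n:=n)) /
    (annihilator_count pairing_system)%:R ^+ n / #|pairing_Aut bG|%:R)%:E.
Proof.
move=> symM M_meas M_indep.
pose isom (B : 'M[int]_n) :=
  `[< \det B != 0 /\ pairing_isomorphic (@sylow_pairing p n B) bG >].
pose mult := (#|pairing_Aut bG| * annihilator_count pairing_system ^ n)%N.
have mult_neq0 : mult%:R != 0 :> R.
  rewrite pnatr_eq0 -lt0n muln_gt0 expn_gt0 annihilator_count_gt0 andbT.
  by apply/card_gt0P; exists 1%g; apply/pairing_AutP; split=> x y; rewrite !perm1.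
have weightedE (B : 'M[int]_n) : B^T = B ->
    weighted_count p_pr pairing_system (corank_indicator R p r) (map_mx intr B) =
    mult%:R * (isom B)%:R.
  move=> symB; rewrite /weighted_count /corank_indicator -natrM pairing_solution_count//.
  by rewrite natrM mulrC.
have sym_int_lift (B : 'M['Z_q]_n) : B^T = B -> (int_lift B)^T = int_lift B.
  by move=> symB; rewrite /int_lift map_trmx symB.
have isomE (B : 'M[int]_n) : B^T = B -> isom (int_lift (map_mx intr B : 'M['Z_q]_n)) = isom B.
  move=> symB; have symBq : (map_mx intr B : 'M['Z_q]_n)^T = map_mx intr B.
    by rewrite map_trmx symB.
  have := weightedE _ (sym_int_lift _ symBq); rewrite int_liftK weightedE//.
  by move=> /(mulfI mult_neq0)/eqP; rewrite eqr_nat; case: (isom (int_lift _)); case: (isom B).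
have -> : [set t | \det (M t) != 0 /\ pairing_isomorphic (@sylow_pairing p n (M t)) bG] =
    [set t | isom (int_lift (map_mx intr (M t) : 'M['Z_q]_n))].
  by apply/seteqP; split=> t /=; rewrite isomE// => /asboolP.
rewrite (prob_reduced_event symM M_meas M_indep (fun B => isom (int_lift B))); congr EFin.
rewrite -mulrA -invfM -natrX -natrM mulnC mulrC -expectZ; apply: eq_expect => B symB.
by rewrite -{2}(int_liftK B) weightedE ?sym_int_lift// mulrA mulVf// mul1r.
Qed.

End pairing_system.

Theorem nonsingular_isometric_cvg (R : realType) (alpha : R) (d : nat -> measure_display)
    (Omega : forall n, measurableType (d n)) (P : forall n, probability (Omega n) R)
    (M : forall n, Omega n -> 'M[int]_n) :
  0 < alpha -> (forall n (w : Omega n), (M n w)^T = M n w) ->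
  (forall n (u : upper_index n), int_random_variable (upper_entry (M n) u)) ->
  (forall n, mutually_independent (P n) (upper_entry (M n))) ->
  (forall n (u : upper_index n) (t : int),
     (P n [set w | (upper_entry (M n) u w = t %[mod p])%Z] <= (1 - alpha)%:E)%E) ->
  fine (P n [set w | \det (M n w) != 0 /\
    pairing_isomorphic (@sylow_pairing p n (M n w)) bG]) @[n --> \oo] -->
  odd_power_product R p / (#|G| * #|pairing_Aut bG|)%N%:R.
Proof.
move=> alpha_gt0 symM M_meas M_indep M_bal.
have exps_le a b : (e a + e b <= (exponent + exponent).+1)%N by apply/leqW/leq_add.
under eq_fun do rewrite (prob_nonsingular_isometric exps_le) //=.
rewrite natrM invfM mulrA [_ / #|G|%:R]mulrC -(solution_density_pairing_system exps_le).
apply: cvgM; last exact: cvg_cst.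
apply: expect_corank_cvg alpha_gt0 _ _ => [||n|n].
- exact: pairing_system_weights_reduce.
- exact: pairing_system_forces_row_free.
- exact: residue_is_law.
- exact: residue_balanced.
Qed.

End presented_pairing.

Theorem theorem1p3 (R : realType) (alpha : R) (p : nat)
  (halpha : 0 < alpha < 1) (hp : prime p)
  (d : nat -> measure_display)
  (Omega : forall n : nat, measurableType (d n))
  (P : forall n : nat, probability (Omega n) R)
  (M : forall n : nat, Omega n -> 'M[int]_n)
  (hsym : forall (n : nat) (w : Omega n), (M n w)^T = M n w)
  (hmeas : forall (n : nat) (ij : upper_index n),
     int_random_variable (upper_entry (M n) ij))
  (hindep : forall n : nat, mutually_independent (P n) (upper_entry (M n)))
  (hbal : forall (n : nat) (ij : upper_index n) (t : int),
     (P n [set w | (upper_entry (M n) ij w = t %[mod p])%Z] <= (1 - alpha)%:E)%E)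
  (G : finZmodType) (hG : (p.-group [set: G]%SET)%g)
  (bG : G -> G -> QmodZ) (hbG : is_duality_pairing bG) :
  P n [set w | pairing_isomorphic (@sylow_pairing p n (M n w)) bG] @[n --> \oo]
    --> (odd_power_product R p / (#|G| * #|pairing_Aut bG|)%N%:R)%:E.
Proof.
have [alpha_gt0 _] := andP halpha.
have [r [e [g basis]]] := ppower_basis_exists hG.
have nonsingular_cvg := nonsingular_isometric_cvg hbG hp basis alpha_gt0 hsym hmeas hindep hbal.
exact: (cvg_prob_of_nonsingular alpha_gt0 hp hsym hmeas hindep hbal
  (E := fun n => [set B | pairing_isomorphic (@sylow_pairing p n B) bG]) nonsingular_cvg).
Qed.
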